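(* Let $M_t$, $t\in[0,T)$, be a family of smooth closed strictly convex surfaces in $\mathbb{R}^3$ flowing according to $\frac{d}{dt}X=-H|A|^2\nu$. Then $$\max_{M_t}\frac{(\lambda_1+\lambda_2)^2(\lambda_1-\lambda_2)^2}{2\lambda_1\lambda_2}$$ is non-increasing in time.
   Context: A closed surface is a compact connected embedded surface without boundary. $X=X(x,t)$ is the (smooth) embedding vector of $M_t$ into $\mathbb{R}^3$, $\frac{d}{dt}X$ its total time derivative, and $\nu$ the outer unit normal to $M_t$. The principal curvatures $\lambda_1,\lambda_2$ are the eigenvalues of the second fundamental form with respect to the induced metric, with sign such that round spheres have positive principal curvatures. A surface is strictly convex if all its principal curvatures are strictly positive. $H=\lambda_1+\lambda_2$ and $|A|^2=\lambda_1^2+\lambda_2^2$. *)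

(* Defs.v *)
From HB Require Import structures.
From mathcomp Require Import all_boot all_order all_algebra.
From mathcomp Require Import all_classical all_reals all_analysis.

Set Implicit Arguments.
Unset Strict Implicit.
Unset Printing Implicit Defensive.

Import Order.TTheory GRing.Theory Num.Theory.
Import numFieldNormedType.Exports.

Local Open Scope classical_set_scope.
Local Open Scope ring_scope.

(** C^oo at every point of [A], for an open set [A] of a finite-dimensional
    space: every iterated directional derivative is Frechet differentiable on
    [A].  (Each of them is then continuous on [A].) *)
Definition smooth_open (R : realType) (V W : normedModType R)
    (A : set V) (f : V -> W) : Prop :=
  forall (vs : seq V) (x : V), A x ->
    differentiable (foldr (fun v g => 'D_v g) f vs) x.

(** Smoothness on an arbitrary subset [A]: [f] is locally the restriction to
    [A] of a smooth map defined on an open set.  On [S `*` `[0, T[] this means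
    smoothness up to the initial time. *)
Definition smooth_on (R : realType) (V W : normedModType R)
    (A : set V) (f : V -> W) : Prop :=
  forall x, A x -> exists (O : set V) (F : V -> W),
    [/\ open O, O x, smooth_open O F & {in A `&` O, F =1 f}].

Definition diffeo (R : realType) (V W : normedModType R)
    (A : set V) (B : set W) (f : V -> W) : Prop :=
  [/\ f @` A = B, smooth_on A f &
      exists g : W -> V, smooth_on B g /\ {in A, cancel f g}].

Section Surfaces.
Context {R : realType}.
Implicit Types (M : set 'rV[R]_3) (phi : 'rV[R]_2 -> 'rV[R]_3).

Definition dot (n : nat) (u v : 'rV[R]_n) : R := (u *m v^T) 0 0.

Definition local_param M (U : set 'rV[R]_2) phi : Prop :=
  open U /\ exists2 O : set 'rV[R]_3, open O & diffeo U (M `&` O) phi.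

Definition closed_surface M : Prop :=
  [/\ forall p, M p -> exists U phi, local_param M U phi /\ (phi @` U) p,
      M !=set0, compact M & connected M].

Definition tangent M (p : 'rV[R]_3) : set 'rV[R]_3 :=
  [set v | exists U phi u w,
    [/\ local_param M U phi, U u, phi u = p & v = 'D_w phi u]].

(** Outer: for small [s > 0] the point [p + s *: nu] lies in an unbounded
    component of the complement of [M]. *)
Definition outer_unit_normal M (p nu : 'rV[R]_3) : Prop :=
  [/\ dot nu nu = 1,
      forall v, tangent M p v -> dot nu v = 0 &
      \forall s \near 0^'+,
        ~ bounded_set (connected_component (~` M) (p + s *: nu))].

Definition basis_vec (i : 'I_2) : 'rV[R]_2 := delta_mx 0 i.

Definition first_form phi (u : 'rV[R]_2) : 'M[R]_2 :=
  \matrix_(i, j) dot ('D_(basis_vec i) phi u) ('D_(basis_vec j) phi u).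

(** The minus sign makes round spheres positively curved when [nu] is the
    outer normal. *)
Definition second_form phi (u : 'rV[R]_2) (nu : 'rV[R]_3) : 'M[R]_2 :=
  \matrix_(i, j) - dot ('D_(basis_vec i) ('D_(basis_vec j) phi) u) nu.

(** [l1] and [l2] are the eigenvalues, with multiplicity, of the second
    fundamental form with respect to the metric; the characteristic polynomial
    does not depend on the local parametrization. *)
Definition principal_curvatures M (p nu : 'rV[R]_3) (l1 l2 : R) : Prop :=
  forall U phi u, local_param M U phi -> U u -> phi u = p ->
    char_poly (invmx (first_form phi u) *m second_form phi u nu)
      = ('X - l1%:P) * ('X - l2%:P).

Definition strictly_convex M : Prop :=
  forall p nu l1 l2, M p -> outer_unit_normal M p nu ->
    principal_curvatures M p nu l1 l2 -> 0 < l1 /\ 0 < l2.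

Definition is_max (A : set R) (m : R) : Prop := A m /\ ubound A m.

End Surfaces.

(* Main.v *)
Require Import Defs.
From HB Require Import structures.
From mathcomp Require Import all_boot all_order all_algebra.
From mathcomp Require Import all_classical all_reals all_analysis.
From mathcomp Require Import ring lra.

Set Implicit Arguments.
Unset Strict Implicit.
Unset Printing Implicit Defensive.

Import Order.TTheory GRing.Theory Num.Theory.
Import numFieldNormedType.Exports.

Local Open Scope classical_set_scope.
Local Open Scope ring_scope.

(** The proof is a maximum principle for the function
    [w = (l1 + l2)^2 (l1 - l2)^2 / (2 l1 l2)] on space-time.

    For a parametrization [Z] of the moving surface put [n = Z_1 x Z_2],
    [D = |n|^2], [b_ij = <Z_ij, n>], [B = b_11 b_22 - b_12^2] and
    [P = g_11 b_22 - 2 g_12 b_12 + g_22 b_11].  Then [(l1 + l2)^2 D^3 = P^2] and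
    [l1 l2 D^2 = B], so that
    [w = P^2 (P^2 - 4 B D) / (2 B D^4)], and the flow reads
    [D^5 Z_t = P (P^2 - 2 B D) n].  The letters on the right are polynomials in the
    derivatives of [Z], and the formulas are unchanged under [n -> - n], so no unit
    normal has to be followed in time, and no square root or quotient is
    differentiated.

    If the maximum of [w] increased from time [s] to time [t], then
    [w - e r], where [r] is time, would for a small [e > 0] attain its maximum
    over the surfaces at the times [s <= r <= t] at some time [t0 > s].
    At that point the moving surface is written over a chart in which [Z_1],
    [Z_2] are orthonormal principal directions and the Christoffel symbols
    vanish ([principal_chart], [flow_chart]).  With the value [N0 / k] of [w] at
    the point, the polynomial [G = k wnum - N0 wden] has the sign of
    [w - N0 / k].  Being maximal in space, it has vanishing first and
    nonpositive second derivatives there; being maximal for [w - e r] on earlier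
    times, it has a positive time derivative ([derive_gt0_left]).

    The evolution equation contradicts this.  The time derivatives of the
    principal curvatures are [F_ii + F l_i^2] for the speed [F = H |A|^2], and,
    after the Codazzi and Simons identities, the time derivative of [G] at a point
    with [l1 <> l2] equals a positive combination of [G_11] and [G_22] minus a
    reaction term and minus two squares of gradients of the curvature, whose
    coefficients ([gradient_weight]) are nonnegative because the surface is convex
    ([reaction_le0]); at an umbilic point it is zero.  Hence the time derivative of [G] is nonpositive
    ([flow_defect_le0]), and [no_late_max] follows. *)

(** * Finitely often differentiable maps *)

Section Smooth.
Context {R : realType}.
Implicit Types (V W : normedModType R).

Definition iter_derive V W (f : V -> W) (vs : seq V) : V -> W :=
  foldr (fun v g => 'D_v g) f vs.

(** Membership counts Frechet differentiability of the derivatives up to order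
    [k], so that [Ck 0] already means differentiable and a smooth map is one
    that is [Ck k] for all [k]; finite orders make induction possible. *)
Definition Ck V W (k : nat) (A : set V) (f : V -> W) : Prop :=
  forall vs : seq V, (size vs <= k)%N ->
    forall x, A x -> differentiable (iter_derive f vs) x.

Lemma smooth_openP V W (A : set V) (f : V -> W) :
  smooth_open A f <-> forall k, Ck k A f.
Proof.
split=> [fA k vs _ x Ax|fA vs x Ax]; first exact: fA.
exact: (fA (size vs)).
Qed.

Lemma Ck0 V W (A : set V) (f : V -> W) :
  Ck 0 A f <-> forall x, A x -> differentiable f x.
Proof. by split=> [fA x Ax|fA [|//] _ x Ax]; [exact: (fA [::])|exact: fA]. Qed.

Lemma Ck_differentiable V W k (A : set V) (f : V -> W) x :
  Ck k A f -> A x -> differentiable f x.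
Proof. by move=> fA Ax; exact: (fA [::]). Qed.

(** The head of the list is the outermost derivative, so the induction removes
    directions at its end. *)
Lemma CkS V W k (A : set V) (f : V -> W) :
  Ck k.+1 A f <->
  (forall x, A x -> differentiable f x) /\ forall v, Ck k A ('D_v f).
Proof.
split=> [fA|[f0 fS] vs].
  split=> [x Ax|v vs vsk x Ax]; first exact: (fA [::]).
  have := fA (rcons vs v); rewrite size_rcons ltnS => /(_ vsk x Ax).
  by rewrite /iter_derive foldr_rcons.
case/lastP: vs => [_|vs v]; first exact: f0.
by rewrite size_rcons ltnS => vsk x Ax; rewrite /iter_derive foldr_rcons; exact: fS.
Qed.

Lemma Ck_le V W k l (A : set V) (f : V -> W) : (l <= k)%N -> Ck k A f -> Ck l A f.
Proof. by move=> lk fA vs vsl; apply: fA; exact: leq_trans lk. Qed.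

Lemma Ck_derive V W k (A : set V) (f : V -> W) v : Ck k.+1 A f -> Ck k A ('D_v f).
Proof. by move=> /CkS[]. Qed.

Lemma Ck_sub V W k (A B : set V) (f : V -> W) : A `<=` B -> Ck k B f -> Ck k A f.
Proof. by move=> AB fB vs vsk x /AB; exact: fB. Qed.

(** A map that vanishes near [x] has the zero map as its first-order expansion;
    this is what makes differentiability a local property below. *)
Lemma near0_differentiable V W (r : V -> W) x :
  (\forall z \near x, r z = 0) -> differentiable r x.
Proof.
move=> r0; have rx := nbhs_singleton r0.
have H : continuous (0 : V -> W) /\ r \o shift x = cst (r x) + \0 +o_ 0 id.
  split; first exact: cst_continuous.
  apply/eqaddoP => e e0; move: r0; rewrite (near_shift 0) => r0.
  near=> h; rewrite !fctE /= rx addr0 subr0.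
  have -> : r (h + x) = 0.
    have : (r \o shift (x - 0)) h = 0 by near: h; exact: r0.
    by rewrite /= subr0.
  by rewrite normr0 mulr_ge0// ltW.
have d0 := diff_unique (df := \0) H.1 H.2.
by apply/diff_locallyP; rewrite d0.
Unshelve. all: by end_near. Qed.

Lemma near_eq_differentiable V W (f g : V -> W) x :
  (\forall z \near x, f z = g z) -> differentiable f x -> differentiable g x.
Proof.
move=> fg df; rewrite (_ : g = f + (g - f)); last first.
  by apply/funext => z; rewrite !fctE addrC subrK.
apply: differentiableD => //; apply: near0_differentiable.
by near=> z; rewrite !fctE (near fg z)// subrr.
Unshelve. all: by end_near. Qed.

Lemma open_near V (A : set V) (P : V -> Prop) x : open A -> A x ->
  (forall z, A z -> P z) -> \forall z \near x, P z.
Proof.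
by move=> oA Ax AP; near=> z; apply: AP; near: z; exact: open_nbhs_nbhs.
Unshelve. all: by end_near. Qed.

Lemma eq_on_derive V W (A : set V) (f g : V -> W) v : open A ->
  {in A, f =1 g} -> {in A, 'D_v f =1 'D_v g}.
Proof.
move=> oA fg x /set_mem Ax; apply: near_eq_derive.
by apply: (open_near oA Ax) => z Az; apply: fg; rewrite inE.
Qed.

Lemma Ck_ext V W k (A : set V) (f g : V -> W) : open A ->
  {in A, f =1 g} -> Ck k A f -> Ck k A g.
Proof.
move=> oA; elim: k f g => [|k IH] f g fg.
  rewrite !Ck0 => df x Ax; apply: near_eq_differentiable (df x Ax).
  by apply: (open_near oA Ax) => z Az; apply: fg; rewrite inE.
rewrite !CkS => -[df Df]; split=> [x Ax|v].
  apply: near_eq_differentiable (df x Ax).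
  by apply: (open_near oA Ax) => z Az; apply: fg; rewrite inE.
exact: (IH _ _ (eq_on_derive v oA fg) (Df v)).
Qed.

Lemma Ck_cst V W k (A : set V) (c : W) : Ck k A (cst c).
Proof.
elim: k c => [|k IH] c; first by apply/Ck0 => x _.
apply/CkS; split => // v.
rewrite (_ : 'D_v (cst c) = cst 0) //.
by apply/funext => x; rewrite derive_cst.
Qed.

Lemma Ck_id V k (A : set V) : Ck k A (id : V -> V).
Proof.
case: k => [|k]; first by apply/Ck0 => x _; exact: ex_diff.
apply/CkS; split=> [x _|v]; first exact: ex_diff.
rewrite (_ : 'D_v id = cst v); first exact: Ck_cst.
by apply/funext => x; exact: derive_id.
Qed.

Lemma Ck_add V W k (A : set V) (f g : V -> W) : open A ->
  Ck k A f -> Ck k A g -> Ck k A (fun x => f x + g x).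
Proof.
move=> oA; elim: k f g => [|k IH] f g.
  by rewrite !Ck0 => df dg x Ax; apply: differentiableD; [exact: df|exact: dg].
rewrite !CkS => -[df Df] [dg Dg]; split=> [x Ax|v].
  by apply: differentiableD; [exact: df|exact: dg].
apply: Ck_ext oA _ (IH _ _ (Df v) (Dg v)) => x /set_mem Ax.
by rewrite [RHS]deriveD//; apply: diff_derivable; [exact: df|exact: dg].
Qed.

Lemma Ck_sum V W (I : Type) k (A : set V) (r : seq I) (F : I -> V -> W) : open A ->
  (forall i, Ck k A (F i)) -> Ck k A (fun x => \sum_(i <- r) F i x).
Proof.
move=> oA FA; elim: r => [|i r IH].
  by under eq_fun do rewrite big_nil; exact: Ck_cst.
by under eq_fun do rewrite big_cons; exact: Ck_add.
Qed.

Lemma Ck_mul V k (A : set V) (f g : V -> R) : open A ->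
  Ck k A f -> Ck k A g -> Ck k A (fun x => f x * g x).
Proof.
move=> oA; elim: k f g => [|k IH] f g.
  by rewrite !Ck0 => df dg x Ax; apply: differentiableM; [exact: df|exact: dg].
move=> Cf Cg; have [df Df] := (CkS _ _ _).1 Cf; have [dg Dg] := (CkS _ _ _).1 Cg.
apply/CkS; split=> [x Ax|v].
  by apply: differentiableM; [exact: df|exact: dg].
apply: Ck_ext oA _ (Ck_add oA (IH _ _ (Ck_le (leqnSn _) Cf) (Dg v))
   (IH _ _ (Ck_le (leqnSn _) Cg) (Df v))) => x /set_mem Ax.
by rewrite [RHS]deriveM//; apply: diff_derivable; [exact: df|exact: dg].
Qed.

Lemma Ck_scale V W k (A : set V) (f : V -> R) (w : W) : open A ->
  Ck k A f -> Ck k A (fun x => f x *: w).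
Proof.
move=> oA; elim: k f => [|k IH] f.
  by rewrite !Ck0 => df x Ax; apply: differentiableZl; exact: df.
move=> /CkS[df Df]; apply/CkS; split=> [x Ax|v].
  by apply: differentiableZl; exact: df.
apply: Ck_ext oA _ (IH _ (Df v)) => x /set_mem Ax.
rewrite deriveE; last exact: df.
by rewrite deriveE ?diffZl//; [exact: df | apply: differentiableZl; exact: df].
Qed.

Lemma derive_linear V W W' (l : {linear W -> W'}) (f : V -> W) x v :
  continuous l -> differentiable f x ->
  'D_v (l \o f) x = l ('D_v f x).
Proof.
move=> cl df; have dl : differentiable l (f x) by exact: linear_differentiable.
rewrite deriveE; last exact: differentiable_comp.
by rewrite diff_comp//= deriveE// diff_lin.
Qed.

Lemma Ck_linear V W W' k (A : set V) (l : {linear W -> W'}) (f : V -> W) :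
  open A -> continuous l -> Ck k A f -> Ck k A (l \o f).
Proof.
move=> oA cl; elim: k f => [|k IH] f.
  rewrite !Ck0 => df x Ax; apply: differentiable_comp; first exact: df.
  exact: linear_differentiable.
move=> /CkS[df Df]; apply/CkS; split=> [x Ax|v].
  by apply: differentiable_comp; [exact: df|exact: linear_differentiable].
apply: Ck_ext oA _ (IH _ (Df v)) => x /set_mem Ax.
by rewrite [RHS]derive_linear//; exact: df.
Qed.

(** Continuous linear coordinates [c] with respect to [e].  They reduce a
    chain rule of arbitrary order to products and sums of scalar functions, and
    they serve both for row vectors and for pairs (point, time). *)
Definition coordinates W (I : finType) (e : I -> W) (c : I -> {linear W -> R}) :=
  (forall i, continuous (c i)) /\ forall w, w = \sum_i c i w *: e i.

Lemma differentiable_coords V W (I : finType) (e : I -> W)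
    (c : I -> {linear W -> R}) (g : V -> W) x : coordinates e c ->
  (forall i, differentiable (c i \o g) x) -> differentiable g x.
Proof.
move=> [_ ec] dg; rewrite (_ : g = \sum_i (fun z => c i (g z) *: e i)); last first.
  by apply/funext => z; rewrite fct_sumE; exact: ec.
elim/big_ind : _ => //.
- by move=> f h df dh; apply: differentiableD.
- by move=> i _; apply: differentiableZl; exact: dg.
Qed.

Lemma derive_comp_coords V W W' (I : finType) (e : I -> W)
    (c : I -> {linear W -> R}) (f : W -> W') (g : V -> W) x v : coordinates e c ->
  differentiable f (g x) -> (forall i, differentiable (c i \o g) x) ->
  'D_v (f \o g) x = \sum_i 'D_v (c i \o g) x *: 'D_(e i) f (g x).
Proof.
move=> ec df dcg; have dg := differentiable_coords ec dcg.
rewrite deriveE; last exact: differentiable_comp.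
have -> : 'd (f \o g) x v = 'd f (g x) ('D_v g x) by rewrite diff_comp//= deriveE.
rewrite {1}(ec.2 ('D_v g x)) linear_sum.
by apply: eq_bigr => i _; rewrite linearZ/= -deriveE// derive_linear//; exact: ec.1.
Qed.

(** By induction on the order: [D_v (f o g)] is the sum over the coordinates of
    [D_v (c_i o g) * (D_(e_i) f o g)], and each factor is of the lower order. *)
Lemma Ck_comp V W (I : finType) (e : I -> W) (c : I -> {linear W -> R}) k
    (A : set V) (B : set W) (f : W -> R) (g : V -> W) :
  coordinates e c -> open A -> Ck k B f -> (forall i, Ck k A (c i \o g)) ->
  (forall x, A x -> B (g x)) -> Ck k A (f \o g).
Proof.
move=> ec oA; elim: k f => [|k IH] f Cf Cg AB.
  apply/Ck0 => x Ax; apply: differentiable_comp.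
    by apply: (differentiable_coords ec) => i; exact: (Ck_differentiable (Cg i)).
  by apply: (Ck_differentiable Cf); exact: AB.
apply/CkS; split=> [x Ax|v].
  apply: differentiable_comp.
    by apply: (differentiable_coords ec) => i; exact: (Ck_differentiable (Cg i)).
  by apply: (Ck_differentiable Cf); exact: AB.
have H : Ck k A (fun x => \sum_i 'D_v (c i \o g) x * 'D_(e i) f (g x)).
  apply: Ck_sum => // i; apply: Ck_mul => //; first exact: Ck_derive.
  by apply: (IH _ (Ck_derive (e i) Cf) _ AB) => j; exact: Ck_le (Cg j).
apply: Ck_ext oA _ H => x /set_mem Ax.
rewrite (derive_comp_coords v ec)//.
  by apply: (Ck_differentiable Cf); exact: AB.
by move=> i; exact: (Ck_differentiable (Cg i)).
Qed.

Definition rV_coord n (i : 'I_n) (u : 'rV[R]_n) : R := u 0 i.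

Lemma rV_coord_is_linear n (i : 'I_n) : linear (@rV_coord n i).
Proof. by move=> a u v; rewrite /rV_coord !mxE. Qed.

HB.instance Definition _ n i :=
  GRing.isLinear.Build R 'rV[R]_n R _ (@rV_coord n i) (@rV_coord_is_linear n i).

Lemma rV_coord_continuous n (i : 'I_n) : continuous (@rV_coord n i).
Proof. exact: coord_continuous. Qed.

Lemma rV_coordinates n :
  coordinates (fun i => delta_mx 0 i) (fun i : 'I_n => @rV_coord n i).
Proof.
by split=> [i|w]; [exact: rV_coord_continuous|exact: row_sum_delta].
Qed.

Lemma Ck_coords V n k (A : set V) (f : V -> 'rV[R]_n) : open A ->
  (forall i, Ck k A (fun x => f x 0 i)) -> Ck k A f.
Proof.
move=> oA fA; rewrite (_ : f = fun x => \sum_i f x 0 i *: delta_mx 0 i).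
  by apply: Ck_sum => // i; apply: Ck_scale.
by apply/funext => x; exact: row_sum_delta.
Qed.

Lemma Ck_coord V n k (A : set V) (f : V -> 'rV[R]_n) i : open A ->
  Ck k A f -> Ck k A (fun x => f x 0 i).
Proof.
by move=> oA; apply: (Ck_linear (l := @rV_coord n i)) => //; exact: rV_coord_continuous.
Qed.

Lemma derive_coord V n (f : V -> 'rV[R]_n) x v i : differentiable f x ->
  'D_v (fun z => f z 0 i) x = 'D_v f x 0 i.
Proof.
by move=> df; apply: (derive_linear (l := @rV_coord n i)) => //; exact: rV_coord_continuous.
Qed.

End Smooth.

(** * Derivatives at a maximum, and symmetry of second derivatives *)

Section Lines.
Context {R : realType}.
Implicit Types (V W : normedModType R).

Lemma is_diff_line V (v y : V) (s : R) :
  is_diff s (fun s : R => s *: v + y) ( *:%R ^~ v).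
Proof. by apply: is_diff_eq; rewrite addr0. Qed.

Lemma is_derive_line V W (g : V -> W) (v y : V) (s : R) :
  differentiable g (s *: v + y) ->
  is_derive s 1 (fun s => g (s *: v + y)) ('D_v g (s *: v + y)).
Proof.
move=> dg; have dl := is_diff_line v y s.
pose l (s : R) := s *: v + y.
have dgl : differentiable (g \o l) s by exact: differentiable_comp.
apply: DeriveDef; first exact: (diff_derivable (f := g \o l)).
rewrite (deriveE (f := g \o l))// diff_comp//=.
by rewrite (deriveE _ dg) diff_val scale1r.
Qed.

Lemma line_cvg V (v y : V) : (s *: v + y) @[s --> (0:R)] --> y.
Proof.
have := differentiable_continuous (@ex_diff _ _ _ _ _ _ _ (is_diff_line v y 0)).
by rewrite /prop_for /continuous_at scale0r add0r.
Qed.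

Lemma derive_ge0_left V (f : V -> R) (x v : V) : differentiable f x ->
  (\forall s \near (0:R), s < 0 -> f (s *: v + x) <= f x) -> 0 <= 'D_v f x.
Proof.
move=> df fmax; rewrite leNgt; apply/negP => D0.
have dv : derivable f x v by exact: diff_derivable.
have H : \forall h \near (0:R)^'-, h^-1 *: (f (h *: v + x) - f x) < 0.
  by apply: cvgr_lt D0; apply: cvg_dnbhs_at_left; exact: dv.
have fmax' : \forall h \near (0:R)^'-, f (h *: v + x) <= f x.
  exact: fmax.
have [h /=] : exists h : R, [/\ h < 0, h^-1 *: (f (h *: v + x) - f x) < 0 &
    f (h *: v + x) <= f x].
  apply: (@filter_ex _ (0:R)^'-); near=> h; split; near: h => //.
  exact: nbhs_left_lt.
move=> [h0 Hh fh]; move: Hh; rewrite ltNge => /negP; apply.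
by rewrite /GRing.scale/= mulr_le0// ?invr_le0 ?subr_le0// ltW.
Unshelve. all: by end_near. Qed.

(** Compared with [G <= 0] alone, the comparison function [c * h * d] has
    positive slope [c * d x] at [h = 0]; approaching from [h < 0] this slope
    bounds the derivative of [G] from below. *)
Lemma derive_gt0_left V (G d : V -> R) (x v : V) (c : R) :
  differentiable G x -> {for x, continuous d} -> 0 < c -> 0 < d x -> G x = 0 ->
  (\forall h \near (0 : R), h < 0 -> G (h *: v + x) <= c * (h * d (h *: v + x))) ->
  0 < 'D_v G x.
Proof.
move=> dG cd c0 dx0 Gx Gle; rewrite ltNge; apply/negP => D0.
have quot : \forall h \near (0:R)^'-, h^-1 *: (G (h *: v + x) - G x) < c * (d x / 2).
  have D1 : 'D_v G x < c * (d x / 2) by rewrite (le_lt_trans D0)// mulr_gt0// divr_gt0.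
  by apply: cvgr_lt D1; apply: cvg_dnbhs_at_left; exact: (diff_derivable dG).
have dh : \forall h \near (0:R)^'-, d x / 2 < d (h *: v + x).
  have near_d : \forall z \near x, d x / 2 < d z.
    by apply: (cvgr_gt _ cd); rewrite ltr_pdivrMr// ltr_pMr ?ltr1n.
  have dl : \forall h \near (0:R), d x / 2 < d (h *: v + x) := @line_cvg _ v x _ near_d.
  exact: cvg_within dl.
have Gle' : \forall h \near (0:R)^'-, G (h *: v + x) <= c * (h * d (h *: v + x)) by exact: Gle.
have [h [h0 Hq Hd HG]] : exists h : R, [/\ h < 0, h^-1 *: (G (h *: v + x) - G x) < c * (d x / 2),
    d x / 2 < d (h *: v + x) & G (h *: v + x) <= c * (h * d (h *: v + x))].
  apply: (@filter_ex _ (0:R)^'-); near=> h; split; near: h => //.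
  exact: nbhs_left_lt.
move: Hq; rewrite Gx subr0 => Hq.
have : c * d (h *: v + x) <= h^-1 * G (h *: v + x).
  rewrite (_ : c * _ = h^-1 * (c * (h * d (h *: v + x)))).
    by rewrite ler_nM2l// invr_lt0.
  by rewrite mulrCA mulKf// lt_eqF.
rewrite leNgt => /negP; apply; apply: (lt_trans Hq).
by rewrite ltr_pM2l.
Unshelve. all: by end_near. Qed.

Lemma deriveNv V W (f : V -> W) (x v : V) : differentiable f x -> 'D_(- v) f x = - 'D_v f x.
Proof. by move=> df; rewrite !deriveE// linearN. Qed.

Lemma derive_max_eq0 V (f : V -> R) (x v : V) : differentiable f x ->
  (\forall s \near (0:R), f (s *: v + x) <= f x) -> 'D_v f x = 0.
Proof.
move=> df fmax; apply/eqP; rewrite eq_le; apply/andP; split; last first.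
  by apply: derive_ge0_left => //; near=> s => _; near: s.
rewrite -oppr_ge0 -deriveNv//; apply: derive_ge0_left => //.
have : \forall s \near (0:R), f ((- s) *: v + x) <= f x.
  move: fmax => /nbhs_ballP[e e0 H]; apply/nbhs_ballP; exists e => // s.
  by rewrite /ball/= sub0r normrN => se; apply: H; rewrite /ball/= sub0r opprK.
by apply: filterS => s + _; rewrite scalerN scaleNr.
Unshelve. all: by end_near. Qed.

(** A positive second derivative would make [D_v f] positive just after [0] on
    the line through [x], so that by the mean value theorem [f] would exceed
    [f x] there. *)
Lemma derive2_max_le0 V (f : V -> R) (x v : V) (A : set V) : open A -> A x -> Ck 1 A f ->
  (\forall s \near (0:R), f (s *: v + x) <= f x) -> 'D_v ('D_v f) x <= 0.
Proof.
move=> oA Ax Cf fmax; rewrite leNgt; apply/negP => D0.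
have df := Ck_differentiable Cf.
have dDf : differentiable ('D_v f) x := Ck_differentiable (Ck_derive v Cf) Ax.
have Dv0 := derive_max_eq0 (df _ Ax) fmax.
have dv : derivable ('D_v f) x v by exact: diff_derivable.
have H : \forall h \near (0:R)^'+, 0 < h^-1 *: ('D_v f (h *: v + x) - 'D_v f x).
  by apply: cvgr_gt D0; apply: cvg_dnbhs_at_right; exact: dv.
have HA : \forall h \near (0:R), A (h *: v + x).
  by apply: line_cvg; exact: open_nbhs_nbhs.
have [e /= e0 He] : exists2 e : R, 0 < e & forall h, 0 < h < e ->
    0 < 'D_v f (h *: v + x).
  move: H => /nbhs_ballP[e /= e0 He]; exists e => // h /andP[h0 he].
  have := He h; rewrite /ball/= sub0r normrN gtr0_norm// => /(_ he h0).
  by rewrite Dv0 subr0 /GRing.scale/= pmulr_rgt0// invr_gt0.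
move: HA => /nbhs_ballP[e1 /= e10 HA].
move: fmax => /nbhs_ballP[e2 /= e20 fmax].
pose h := Num.min e (Num.min e1 e2) / 2.
have h0 : 0 < h by rewrite divr_gt0// !lt_min e0 e10.
have hm : h < Num.min e (Num.min e1 e2).
  by rewrite ltr_pdivrMr// ltr_pMr ?ltr1n// !lt_min e0 e10.
move: hm; rewrite !lt_min => /and3P[he he1 he2].
have bA s : 0 <= s <= h -> A (s *: v + x).
  move=> /andP[s0 sh]; apply: HA; rewrite /ball/= sub0r normrN ger0_norm//.
  exact: le_lt_trans he1.
have [| |] := @MVT _ (fun s => f (s *: v + x)) (fun s => 'D_v f (s *: v + x)) 0 h h0.
- move=> s; rewrite in_itv/= => /andP[s0 sh].
  by apply: is_derive_line; apply: df; apply: bA; rewrite !ltW.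
- apply: derivable_within_continuous => s; rewrite in_itv/= => sI.
  by apply: ex_derive; apply: is_derive_line; apply: df; exact: bA.
move=> s; rewrite in_itv/= => /andP[s0 sh]; rewrite scale0r add0r subr0 => E.
have : f (h *: v + x) <= f x.
  by apply: fmax; rewrite /ball/= sub0r normrN gtr0_norm.
rewrite -subr_le0 E leNgt => /negP; apply; apply: mulr_gt0 => //.
by apply: He; rewrite s0 (lt_trans sh he).
Qed.

(** Two applications of the mean value theorem to the second difference of [f];
    exchanging [v] and [w] gives the same difference, hence [derive_comm]. *)
Lemma mixed_MVT V (f : V -> R) (A : set V) (x v w : V) (h : R) : 0 < h ->
  (forall s t : R, 0 <= s <= h -> 0 <= t <= h -> A (s *: v + (t *: w + x))) ->
  Ck 1 A f -> exists s t : R, [/\ 0 <= s <= h, 0 <= t <= h &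
    f (h *: v + (h *: w + x)) - f (h *: v + x) - (f (h *: w + x) - f x)
    = 'D_w ('D_v f) (s *: v + (t *: w + x)) * h * h].
Proof.
move=> h0 bA Cf; have df := Ck_differentiable Cf.
have dDf := Ck_differentiable (Ck_derive v Cf).
have hh : 0 <= h <= h by rewrite lexx ltW.
have h00 : 0 <= (0:R) <= h by rewrite lexx ltW.
have D1 s : 0 <= s <= h -> is_derive s 1
    (fun s => f (s *: v + (h *: w + x)) - f (s *: v + x))
    ('D_v f (s *: v + (h *: w + x)) - 'D_v f (s *: v + x)).
  move=> sh; apply: is_deriveB; apply: is_derive_line; apply: df; first exact: bA.
  by have := bA _ _ sh h00; rewrite scale0r add0r.
have [| |s] := @MVT _ (fun s => f (s *: v + (h *: w + x)) - f (s *: v + x))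
   (fun s => 'D_v f (s *: v + (h *: w + x)) - 'D_v f (s *: v + x)) 0 h h0.
- by move=> s; rewrite in_itv/= => /andP[s0 sh]; apply: D1; rewrite !ltW.
- apply: derivable_within_continuous => s; rewrite in_itv/= => sI.
  by apply: ex_derive; exact: D1.
rewrite in_itv/= => /andP[/ltW s0 /ltW sh]; have sI : 0 <= s <= h by rewrite s0.
rewrite !scale0r !add0r subr0 => E.
have D2 t : 0 <= t <= h -> is_derive t 1
    (fun t => 'D_v f (t *: w + (s *: v + x)))
    ('D_w ('D_v f) (t *: w + (s *: v + x))).
  move=> th; apply: is_derive_line; apply: dDf.
  by rewrite addrCA; exact: bA.
have [| |t] := @MVT _ (fun t => 'D_v f (t *: w + (s *: v + x)))
   (fun t => 'D_w ('D_v f) (t *: w + (s *: v + x))) 0 h h0.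
- by move=> t; rewrite in_itv/= => /andP[t0 th]; apply: D2; rewrite !ltW.
- apply: derivable_within_continuous => t; rewrite in_itv/= => tI.
  by apply: ex_derive; exact: D2.
rewrite in_itv/= => /andP[/ltW t0 /ltW th].
rewrite scale0r add0r subr0 => E2.
exists s, t; split => //; first by rewrite t0.
by rewrite E (addrCA (s *: v) (h *: w)) E2 (addrCA (t *: w)).
Qed.

(** Schwarz's theorem for maps whose second derivatives are continuous: both
    mixed derivatives are within [e / 2] of a common value, the second difference
    quotient. *)
Lemma derive_comm V (f : V -> R) (A : set V) (x v w : V) : open A -> A x ->
  Ck 2 A f -> 'D_w ('D_v f) x = 'D_v ('D_w f) x.
Proof.
move=> oA Ax Cf; apply/eqP; rewrite -subr_eq0 -normr_le0; apply/ler_addgt0Pr => e e0.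
rewrite add0r.
(* the mixed derivatives are made opaque, as only their continuity matters *)
have [a ea] : {a | a = 'D_w ('D_v f)} := exist _ _ erefl.
have [b eb] : {b | b = 'D_v ('D_w f)} := exist _ _ erefl.
have da : differentiable a x.
  by rewrite ea; exact: (Ck_differentiable (Ck_derive w (Ck_derive v Cf)) Ax).
have db : differentiable b x.
  by rewrite eb; exact: (Ck_differentiable (Ck_derive v (Ck_derive w Cf)) Ax).
have near_cts (g : V -> R) : differentiable g x ->
    \forall z \near x, `|g x - g z| < e / 2.
  by move=> /differentiable_continuous /cvgr_dist_lt; apply; rewrite divr_gt0.
have na := near_cts a da; have nb := near_cts b db.
have nA : \forall z \near x, A z by exact: open_nbhs_nbhs.
have : \forall z \near x, [/\ A z, `|a x - a z| < e / 2 & `|b x - b z| < e / 2].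
  by move: nA na nb; apply: filterS3 => z.
move=> /nbhs_ballP[r /= r0 Hr].
(* a step for which the parallelogram spanned at [x] stays in the ball *)
pose d := r / (`|v| + `|w| + 1).
have N0 : 0 < `|v| + `|w| + 1 by rewrite ltr_wpDl// addr_ge0.
have d0 : 0 < d by rewrite divr_gt0.
pose h := d / 2; have h0 : 0 < h by rewrite divr_gt0.
have hd : h < d by rewrite ltr_pdivrMr// ltr_pMr ?ltr1n.
clearbody h.
have bH s t : 0 <= s <= h -> 0 <= t <= h -> ball x r (s *: v + (t *: w + x)).
  move=> /andP[s0 sh] /andP[t0 th]; rewrite -ball_normE/=.
  rewrite addrA opprD addrCA subrr addr0 normrN (le_lt_trans (ler_normD _ _))//.
  rewrite !normrZ !ger0_norm//.
  have : d * (`|v| + `|w| + 1) = r by rewrite divfK ?gt_eqF.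
  have : s * `|v| <= d * `|v| by rewrite ler_wpM2r// (le_trans sh)// ltW.
  have : t * `|w| <= d * `|w| by rewrite ler_wpM2r// (le_trans th)// ltW.
  move: d0; lra.
have C1 : Ck 1 A f by exact: Ck_le Cf.
have [|s1 [t1 [s1h t1h E1]]] := @mixed_MVT _ f A x v w h h0 _ C1.
  by move=> s t sh th; have [] := Hr _ (bH _ _ sh th).
have [|t2 [s2 [t2h s2h E2]]] := @mixed_MVT _ f A x w v h h0 _ C1.
  by move=> s t sh th; rewrite addrCA; have [] := Hr _ (bH _ _ th sh).
have Eab : a (s1 *: v + (t1 *: w + x)) = b (t2 *: w + (s2 *: v + x)).
  have hh : h * h != 0 by rewrite mulf_neq0// gt_eqF.
  move: E1 E2; rewrite (_ : derive _ _ w = a (s1 *: v + (t1 *: w + x))); last by rewrite ea.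
  rewrite (_ : derive _ _ v = b (t2 *: w + (s2 *: v + x))); last by rewrite eb.
  move=> E1 E2; apply: (mulIf hh); rewrite 2!mulrA -E1 -E2 (addrCA (h *: w)).
  ring.
have [_ Ha _] := Hr _ (bH _ _ s1h t1h).
have [_ _] := Hr _ (bH _ _ s2h t2h); rewrite addrCA -Eab => Hb.
have -> : 'D_w ('D_v f) x = a x by rewrite ea.
have -> : 'D_v ('D_w f) x = b x by rewrite eb.
rewrite (_ : a x - b x = (a x - a (s1 *: v + (t1 *: w + x))) -
   (b x - a (s1 *: v + (t1 *: w + x)))); last by ring.
rewrite (le_trans (ler_normB _ _))//.
move: (a x) (b x) (a _) Ha Hb => ax bx ap Ha Hb; clear -Ha Hb; lra.
Unshelve. all: by end_near. Qed.

End Lines.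

(** * Second-order jets along a direction *)

Section Jets.
Context {R : realType} {V : normedModType R}.
Implicit Types (f g : V -> R) (x v : V).

(** The curvature is a polynomial in derivatives of the parametrization.  Jets
    turn its first two derivatives at one point into polynomial arithmetic on
    Taylor coefficients. *)
Definition jet x v f (a b c : R) :=
  [/\ \forall z \near x, derivable f z v, derivable ('D_v f) x v,
      f x = a, 'D_v f x = b & 'D_v ('D_v f) x = c].

Lemma jet_Ck x v f (A : set V) : open A -> A x -> Ck 1 A f ->
  jet x v f (f x) ('D_v f x) ('D_v ('D_v f) x).
Proof.
move=> oA Ax Cf; split => //.
  apply: (open_near oA Ax) => z Az.
  by apply: diff_derivable; exact: Ck_differentiable Cf Az.
by apply: diff_derivable; exact: Ck_differentiable (Ck_derive v Cf) Ax.
Qed.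

Lemma jet_eq x v f a b c a' b' c' : jet x v f a b c ->
  a = a' -> b = b' -> c = c' -> jet x v f a' b' c'.
Proof. by move=> + <- <- <-. Qed.

Lemma jet_ext x v f g a b c : (\forall z \near x, f z = g z) ->
  jet x v f a b c -> jet x v g a b c.
Proof.
move=> fg [df dDf fa fb fc].
have Dfg : \forall z \near x, 'D_v f z = 'D_v g z.
  have /nbhs_interior : nbhs x [set z | f z = g z] by exact: fg.
  apply: filterS => z Hz; apply: near_eq_derive.
  exact: Hz.
split.
- have /nbhs_interior : nbhs x [set z | f z = g z] by exact: fg.
  move: df; apply: filterS2 => z dfz fgz; apply: (@near_eq_derivable _ _ _ f) dfz.
  exact: fgz.
- exact: (near_eq_derivable Dfg dDf).
- by rewrite -fa (nbhs_singleton fg).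
- by rewrite -fb (nbhs_singleton Dfg).
- by rewrite -fc; apply: near_eq_derive; apply: filterS Dfg => z ->.
Unshelve. all: by end_near. Qed.

Lemma jet_cst x v a : jet x v (cst a) a 0 0.
Proof.
have E : 'D_v (cst a : V -> R) = cst 0 by apply/funext => z; exact: derive_cst.
split.
- by near=> z; exact: derivable_cst.
- by rewrite E; exact: derivable_cst.
- by [].
- exact: derive_cst.
- by rewrite E; exact: derive_cst.
Unshelve. all: by end_near. Qed.

Lemma jet_add x v f g a b c a' b' c' : jet x v f a b c -> jet x v g a' b' c' ->
  jet x v (fun z => f z + g z) (a + a') (b + b') (c + c').
Proof.
move=> [df dDf fa fb fc] [dg dDg ga gb gc].
have E : \forall z \near x, ('D_v f + 'D_v g) z = 'D_v (fun z => f z + g z) z.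
  by move: df dg; apply: filterS2 => z dfz dgz; exact: esym (deriveD dfz dgz).
split.
- by move: df dg; apply: filterS2 => z dfz dgz; exact: derivableD.
- exact: (near_eq_derivable E (derivableD dDf dDg)).
- by rewrite fa ga.
- by rewrite -fb -gb -(nbhs_singleton E).
- apply: (etrans (esym (near_eq_derive v E))).
  by apply: (etrans (deriveD dDf dDg)); rewrite fc gc.
Unshelve. all: by end_near. Qed.

Lemma jet_mul x v f g a b c a' b' c' : jet x v f a b c -> jet x v g a' b' c' ->
  jet x v (fun z => f z * g z) (a * a') (a * b' + b * a')
     (a * c' + 2 * b * b' + c * a').
Proof.
move=> [df dDf fa fb fc] [dg dDg ga gb gc].
have E : \forall z \near x, (f * 'D_v g + g * 'D_v f) z = 'D_v (fun z => f z * g z) z.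
  by move: df dg; apply: filterS2 => z dfz dgz; exact: esym (deriveM dfz dgz).
have fx := nbhs_singleton df; have gx := nbhs_singleton dg.
split.
- by move: df dg; apply: filterS2 => z dfz dgz; exact: (derivableM dfz dgz).
- exact: (near_eq_derivable E (derivableD (derivableM fx dDg) (derivableM gx dDf))).
- by rewrite fa ga.
- by rewrite -(nbhs_singleton E) !fctE fa ga fb gb; ring.
- have -> : 'D_v ('D_v (fun z => f z * g z)) x =
      (f x *: 'D_v ('D_v g) x + 'D_v g x *: 'D_v f x) +
      (g x *: 'D_v ('D_v f) x + 'D_v f x *: 'D_v g x).
    apply: (etrans (esym (near_eq_derive v E))).
    apply: (etrans (deriveD (derivableM fx dDg) (derivableM gx dDf))).
    exact: (congr2 +%R (deriveM fx dDg) (deriveM gx dDf)).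
  by rewrite fa ga fb gb fc gc /GRing.scale/=; ring.
Unshelve. all: by end_near. Qed.

Lemma jet_opp x v f a b c : jet x v f a b c -> jet x v (fun z => - f z) (- a) (- b) (- c).
Proof.
move=> Jf; have := jet_mul (jet_cst x v (-1)) Jf.
have -> : (fun z => cst (-1) z * f z) = (fun z => - f z).
  by apply/funext => z; rewrite /= mulN1r.
by move/jet_eq; apply; ring.
Qed.

Lemma jet_uniq x v f a b c a' b' c' : jet x v f a b c -> jet x v f a' b' c' ->
  [/\ a = a', b = b' & c = c'].
Proof. by move=> [_ _ <- <- <-] [_ _ <- <- <-]. Qed.

End Jets.

(** * Reaction and gradient terms at a critical point *)

Section Algebra.
Context {R : realType}.

(** The coefficient with which the square of the derivative of the curvature
    along the first principal direction enters the evolution of the defect at a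
    critical point, up to the factor [2 b^2] produced by [reaction_le0]. *)
Definition gradient_weight (a b : R) : R :=
  12 * b ^+ 10 + 36 * a * b ^+ 9 + 168 * a ^+ 2 * b ^+ 8 + 288 * a ^+ 3 * b ^+ 7
  + 520 * a ^+ 4 * b ^+ 6 + 744 * a ^+ 5 * b ^+ 5 + 736 * a ^+ 6 * b ^+ 4
  + 576 * a ^+ 7 * b ^+ 3 + 76 * a ^+ 8 * b ^+ 2 - 108 * a ^+ 9 * b + 24 * a ^+ 10.

(** For [a, b > 0] the only negative coefficient, that of [a^9 b], is absorbed by
    [24 a^8 (a - 3 b)^2 + 36 a^7 b (a - 3 b)^2].  As the polynomial is homogeneous
    of even degree, [a, b < 0] reduces to this case. *)
Lemma gradient_weight_ge0 (a b : R) : 0 < a * b -> 0 <= gradient_weight a b.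
Proof.
have pos (u v : R) : 0 < u -> 0 < v -> 0 <= gradient_weight u v.
  move=> u0 v0; pose P (i j : nat) := u ^+ i * v ^+ j.
  have P0 i j : 0 <= P i j by rewrite mulr_ge0// exprn_ge0// ltW.
  have S0 i j : 0 <= P i j * (u - 3 * v) ^+ 2 by rewrite mulr_ge0// sqr_ge0.
  have -> : gradient_weight u v = 12 * P 0%N 10%N + 36 * P 1%N 9%N + 168 * P 2%N 8%N
    + 288 * P 3%N 7%N + 520 * P 4%N 6%N + 744 * P 5%N 5%N + 736 * P 6%N 4%N + 252 * P 7%N 3%N
    + 76 * P 8%N 2%N + 24 * (P 8%N 0%N * (u - 3 * v) ^+ 2) + 36 * (P 7%N 1%N * (u - 3 * v) ^+ 2).
    rewrite /gradient_weight /P; ring.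
  have h0 := P0 0%N 10%N; have h1 := P0 1%N 9%N; have h2 := P0 2%N 8%N; have h3 := P0 3%N 7%N.
  have h4 := P0 4%N 6%N; have h5 := P0 5%N 5%N; have h6 := P0 6%N 4%N; have h7 := P0 7%N 3%N.
  have h8 := P0 8%N 2%N; have h9 := S0 8%N 0%N; have h10 := S0 7%N 1%N.
  lra.
move=> ab; have [a0|a0|a0] := ltgtP a 0.
- have b0 : b < 0 by rewrite -(nmulr_rgt0 _ a0).
  have <- : gradient_weight (- a) (- b) = gradient_weight a b.
    rewrite /gradient_weight; ring.
  by apply: pos; rewrite oppr_gt0.
- by apply: pos => //; rewrite -(pmulr_rgt0 _ a0).
- by move: ab; rewrite a0 mul0r ltxx.
Qed.

(** The heart of the proof.  [a], [b] are the principal curvatures; by the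
    Codazzi equations the derivatives of the second fundamental form are
    [al = h_111], [be = h_112], [ga = h_122], [de = h_222]; [A1], [B1] (resp. [A2],
    [B2]) are the second derivatives of the two diagonal coefficients of the shape
    operator along the first (resp. second) direction, related by the Simons
    identity.  [Ga], ..., [Gs] are the derivatives of the defect in the
    coefficients of the shape operator and [F] is the speed, so that [G2] and [F2]
    are second derivatives of the defect and of the speed, and the conclusion
    bounds the time derivative of the defect.

    At a critical point with [a <> b] the vectors [(al, ga)] and [(be, de)] are
    multiples [m], [l] of [(a (3 b^2 + a^2), b (3 a^2 + b^2))], and the time
    derivative is [F_a G_11 + F_b G_22] minus
    [16 (a b)^3 (a^2 - b^2)^2], [2 (b m)^2 gradient_weight a b] and
    [2 (a l)^2 gradient_weight b a].  At an umbilic point it vanishes. *)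
Lemma reaction_le0 (a b al be ga de A1 B1 A2 B2 : R) :
  0 < a * b -> B1 - A2 = a * b * (b - a) ->
  let Ga := 2 * b * (a ^+ 2 - b ^+ 2) * (3 * a ^+ 2 + b ^+ 2) in
  let Gb := - (2 * a * (a ^+ 2 - b ^+ 2) * (3 * b ^+ 2 + a ^+ 2)) in
  let Gaa := 2 * a * b * (12 * a ^+ 2 - 4 * b ^+ 2) in
  let Gab := 2 * a * b * (- (8 * a * b)) - 2 * (a ^+ 2 - b ^+ 2) ^+ 2 in
  let Gbb := 2 * a * b * (12 * b ^+ 2 - 4 * a ^+ 2) in
  let Gs := 16 * a * b * (a + b) ^+ 2 + 4 * (a ^+ 2 - b ^+ 2) ^+ 2 in
  let G2 A B r t s := Ga * A + Gb * B + Gaa * r ^+ 2 + 2 * Gab * r * t + Gbb * t ^+ 2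
     + Gs * s ^+ 2 in
  let F := (a + b) * (a ^+ 2 + b ^+ 2) in
  let F2 A B r t s := (3 * a ^+ 2 + 2 * a * b + b ^+ 2) * A
     + (3 * b ^+ 2 + 2 * a * b + a ^+ 2) * B + (6 * a + 2 * b) * r ^+ 2
     + 4 * (a + b) * r * t + (6 * b + 2 * a) * t ^+ 2 + 4 * (a + b) * s ^+ 2 in
  Ga * al + Gb * ga = 0 -> Ga * be + Gb * de = 0 ->
  G2 A1 B1 al ga be <= 0 -> G2 A2 B2 be de ga <= 0 ->
  Ga * (F2 A1 B1 al ga be + F * a ^+ 2) + Gb * (F2 A2 B2 be de ga + F * b ^+ 2) <= 0.
Proof.
move=> ab0 simons Ga Gb Gaa Gab Gbb Gs G2 F F2 g1 g2 g11 g22.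
have [eab|nab] := eqVneq a b.
  have -> : Ga = 0 by rewrite /Ga eab subrr !(mulr0, mul0r).
  have -> : Gb = 0 by rewrite /Gb eab subrr !(mulr0, mul0r) oppr0.
  by rewrite !mul0r addr0.
have a0 : a != 0 by apply: contraTneq ab0 => ->; rewrite mul0r ltxx.
have b0 : b != 0 by apply: contraTneq ab0 => ->; rewrite mulr0 ltxx.
have sab : a ^+ 2 - b ^+ 2 != 0.
  rewrite subr_sqr mulf_neq0 ?subr_eq0//; apply: contraTneq ab0 => /eqP.
  rewrite addr_eq0 => /eqP ->; rewrite mulNr -leNgt oppr_le0 -expr2 sqr_ge0//.
have pa : 3 * b ^+ 2 + a ^+ 2 != 0.
  have := sqr_ge0 b; have : 0 < a ^+ 2 by rewrite exprn_even_gt0.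
  by move=> h1 h2; rewrite gt_eqF//; clear -h1 h2; lra.
have pb : 3 * a ^+ 2 + b ^+ 2 != 0.
  have := sqr_ge0 a; have : 0 < b ^+ 2 by rewrite exprn_even_gt0.
  by move=> h1 h2; rewrite gt_eqF//; clear -h1 h2; lra.
have crit r t : Ga * r + Gb * t = 0 -> exists m,
    r = a * (3 * b ^+ 2 + a ^+ 2) * m /\ t = b * (3 * a ^+ 2 + b ^+ 2) * m.
  move=> E; exists (r / (a * (3 * b ^+ 2 + a ^+ 2))); split.
    by rewrite mulrCA divff ?mulr1// mulf_neq0.
  have E' : b * (3 * a ^+ 2 + b ^+ 2) * r = t * (a * (3 * b ^+ 2 + a ^+ 2)).
    have s2 : 2 * (a ^+ 2 - b ^+ 2) != 0 by rewrite mulf_neq0// pnatr_eq0.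
    apply: (mulfI s2); apply/eqP; rewrite -subr_eq0 -E; apply/eqP.
    by rewrite /Ga /Gb; ring.
  by rewrite mulrA E' mulfK// mulf_neq0.
have [m [eal ega]] := crit _ _ g1; have [l [ebe ede]] := crit _ _ g2.
have E : Ga * (F2 A1 B1 al ga be + F * a ^+ 2) + Gb * (F2 A2 B2 be de ga + F * b ^+ 2)
  = (3 * a ^+ 2 + 2 * a * b + b ^+ 2) * G2 A1 B1 al ga be
  + (3 * b ^+ 2 + 2 * a * b + a ^+ 2) * G2 A2 B2 be de ga
  - (16 * (a * b) ^+ 3 * (a ^+ 2 - b ^+ 2) ^+ 2
     + 2 * (b * m) ^+ 2 * gradient_weight a b + 2 * (a * l) ^+ 2 * gradient_weight b a).
  have -> : B1 = A2 + a * b * (b - a) by rewrite -simons; ring.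
  rewrite /G2 /F2 /F /Gs /Gaa /Gbb /Gab /Ga /Gb /gradient_weight eal ega ebe ede.
  ring.
have Fa0 : 0 <= 3 * a ^+ 2 + 2 * a * b + b ^+ 2.
  have := sqr_ge0 a; have := sqr_ge0 b; move: ab0; nra.
have Fb0 : 0 <= 3 * b ^+ 2 + 2 * a * b + a ^+ 2.
  have := sqr_ge0 a; have := sqr_ge0 b; move: ab0; nra.
have wa := gradient_weight_ge0 ab0.
have wb : 0 <= gradient_weight b a by apply: gradient_weight_ge0; rewrite mulrC.
rewrite E subr_le0; apply: (@le_trans _ _ 0).
  by rewrite -[leRHS]addr0 lerD// mulr_ge0_le0.
have t1 : 0 <= (a * b) ^+ 3 * (a ^+ 2 - b ^+ 2) ^+ 2.
  by rewrite mulr_ge0 ?sqr_ge0// exprn_ge0// ltW.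
have t2 : 0 <= (b * m) ^+ 2 * gradient_weight a b by rewrite mulr_ge0 ?sqr_ge0.
have t3 : 0 <= (a * l) ^+ 2 * gradient_weight b a by rewrite mulr_ge0 ?sqr_ge0.
rewrite -!mulrA; move: t1 t2 t3; clear; lra.
Qed.

End Algebra.

(** * Curvature as polynomials in the derivatives of a parametrization *)

Section Vectors.
Context {R : realType}.
Implicit Types (u v w p q r s t : 'rV[R]_3).

Definition row3 (x y z : R) : 'rV[R]_3 := \row_(k < 3) nth 0 [:: x; y; z] k.

Lemma row3_0 x y z : row3 x y z 0 0 = x. Proof. by rewrite mxE. Qed.
Lemma row3_1 x y z : row3 x y z 0 1 = y. Proof. by rewrite mxE. Qed.
Lemma row3_2 x y z : row3 x y z 0 2 = z. Proof. by rewrite mxE. Qed.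
Definition row3E := (row3_0, row3_1, row3_2).

Lemma forall_I3 (P : 'I_3 -> Prop) : P 0 -> P 1 -> P 2 -> forall k, P k.
Proof.
move=> P0 P1 P2 [[|[|[|//]]] i].
- by rewrite (_ : Ordinal i = 0)//; exact: val_inj.
- by rewrite (_ : Ordinal i = 1)//; exact: val_inj.
- by rewrite (_ : Ordinal i = 2)//; exact: val_inj.
Qed.

Lemma eq_row3 u v : u 0 0 = v 0 0 -> u 0 1 = v 0 1 -> u 0 2 = v 0 2 -> u = v.
Proof.
move=> e0 e1 e2; apply/rowP; exact: forall_I3.
Qed.

Lemma row3_eta u : u = row3 (u 0 0) (u 0 1) (u 0 2).
Proof. by apply: eq_row3; rewrite row3E. Qed.

Lemma dotE u v : dot u v = u 0 0 * v 0 0 + u 0 1 * v 0 1 + u 0 2 * v 0 2.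
Proof.
rewrite /dot mxE !big_ord_recr big_ord0/= add0r !mxE.
by congr (_ * _ + _ * _ + _ * _); congr (_ _ _); exact: val_inj.
Qed.

Definition cross u v : 'rV[R]_3 := row3 (u 0 1 * v 0 2 - u 0 2 * v 0 1)
  (u 0 2 * v 0 0 - u 0 0 * v 0 2) (u 0 0 * v 0 1 - u 0 1 * v 0 0).

(** In the next definitions [p], [q] stand for the first derivatives [Z_1], [Z_2]
    of a parametrization and [r], [s], [t] for [Z_11], [Z_12], [Z_22].  The normal
    is the cross product of [p] and [q] without normalization, which keeps
    everything polynomial. *)
Definition gram p q : R := dot (cross p q) (cross p q).
Definition second_coef p q r : R := dot r (cross p q).
Definition shape_tr p q r s t : R :=
  dot p p * second_coef p q t - 2 * dot p q * second_coef p q s + dot q q * second_coef p q r.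
Definition shape_det p q r s t : R := second_coef p q r * second_coef p q t - second_coef p q s ^+ 2.

(** Numerator and denominator of the pinching quotient; both carry the factor
    [D^6], see [curvature_wnum_wden]. *)
Definition wnum (P B D : R) : R := P ^+ 2 * (P ^+ 2 - 4 * B * D).
Definition wden (B D : R) : R := 2 * B * D ^+ 4.

End Vectors.

Section VJets.
Context {R : realType} {V : normedModType R}.
Implicit Types (f g p q r s t : V -> 'rV[R]_3) (x v : V).

Definition vjet x v f (a b c : 'rV[R]_3) :=
  forall k, jet x v (fun z => f z 0 k) (a 0 k) (b 0 k) (c 0 k).

Lemma jet_sub x v (f g : V -> R) a b c a' b' c' :
  jet x v f a b c -> jet x v g a' b' c' ->
  jet x v (fun z => f z - g z) (a - a') (b - b') (c - c').
Proof. by move=> jf jg; exact: jet_add jf (jet_opp jg). Qed.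

Lemma jet_scale x v (f : V -> R) k a b c : jet x v f a b c ->
  jet x v (fun z => k * f z) (k * a) (k * b) (k * c).
Proof.
move=> jf; have := jet_mul (jet_cst x v k) jf => /jet_eq; apply; ring.
Qed.

Lemma jet_sqr x v (f : V -> R) a b c : jet x v f a b c ->
  jet x v (fun z => f z ^+ 2) (a ^+ 2) (2 * a * b) (2 * a * c + 2 * b ^+ 2).
Proof. by move=> jf; have := jet_mul jf jf => /jet_eq; apply; ring. Qed.

Lemma jet_dot x v f g a b c a' b' c' : vjet x v f a b c -> vjet x v g a' b' c' ->
  jet x v (fun z => dot (f z) (g z)) (dot a a') (dot a b' + dot b a')
    (dot a c' + 2 * dot b b' + dot c a').
Proof.
move=> jf jg; under eq_fun do rewrite dotE.
have := jet_add (jet_add (jet_mul (jf 0) (jg 0)) (jet_mul (jf 1) (jg 1)))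
  (jet_mul (jf 2) (jg 2)).
by move=> /jet_eq; apply; rewrite !dotE; ring.
Qed.

Lemma vjet_cross x v f g a b c a' b' c' : vjet x v f a b c -> vjet x v g a' b' c' ->
  vjet x v (fun z => cross (f z) (g z)) (cross a a') (cross a b' + cross b a')
    (cross a c' + 2 *: cross b b' + cross c a').
Proof.
move=> jf jg; apply: forall_I3; rewrite !(mxE, row3E).
- under eq_fun do rewrite row3E.
  have := jet_sub (jet_mul (jf 1) (jg 2)) (jet_mul (jf 2) (jg 1)).
  by move=> /jet_eq; apply; rewrite /GRing.scale/=; ring.
- under eq_fun do rewrite row3E.
  have := jet_sub (jet_mul (jf 2) (jg 0)) (jet_mul (jf 0) (jg 2)).
  by move=> /jet_eq; apply; rewrite /GRing.scale/=; ring.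
- under eq_fun do rewrite row3E.
  have := jet_sub (jet_mul (jf 0) (jg 1)) (jet_mul (jf 1) (jg 0)).
  by move=> /jet_eq; apply; rewrite /GRing.scale/=; ring.
Qed.

End VJets.

(** * Jets of the curvature at a normalized point *)

Section Axis.
Context {R : realType} {V : normedModType R}.
Implicit Types (p q r s t : V -> 'rV[R]_3) (x v : V).

(** At a point where [p], [q] are the first two unit vectors and the second
    derivatives are normal and diagonal, the metric has vanishing first derivative.
    [A] and [B] are then the second derivatives along [v] of the diagonal
    coefficients of the shape operator; the multiples of [D2] come from the powers
    [D^(3/2)] and [D^2] by which [shape_tr] and [shape_det] differ from its trace
    and determinant.  For [v] the first principal direction [(c, d)] is [(a, 0)],
    for the second it is [(0, b)]. *)
Lemma jet_shape_axis x v (p q r s t : V -> 'rV[R]_3)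
    (a b c d p1 p2 p3 q1 q2 q3 r1 r2 r3 s1 s2 s3 t1 t2 t3
     ra rb R3 sa sb S3 ta tb T3 : R) :
  vjet x v p (row3 1 0 0) (row3 0 0 c) (row3 p1 p2 p3) ->
  vjet x v q (row3 0 1 0) (row3 0 0 d) (row3 q1 q2 q3) ->
  vjet x v r (row3 0 0 a) (row3 r1 r2 r3) (row3 ra rb R3) ->
  vjet x v s (row3 0 0 0) (row3 s1 s2 s3) (row3 sa sb S3) ->
  vjet x v t (row3 0 0 b) (row3 t1 t2 t3) (row3 ta tb T3) ->
  let m := p1 + q2 in
  let A := R3 - 2 * (c * r1 + d * r2) - 2 * a * p1 - 3 * a * c ^+ 2 - a * d ^+ 2 in
  let B := T3 - 2 * (c * t1 + d * t2) - 2 * b * q2 - 3 * b * d ^+ 2 - b * c ^+ 2 in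
  let D2 := 2 * m + 2 * (c ^+ 2 + d ^+ 2) in
  [/\ vjet x v (fun z => cross (p z) (q z))
        (row3 0 0 1) (row3 (- c) (- d) 0) (row3 (- p3) (- q3) m),
      jet x v (fun z => gram (p z) (q z)) 1 0 D2,
      jet x v (fun z => shape_tr (p z) (q z) (r z) (s z) (t z))
        (a + b) (r3 + t3) (A + B + 3 / 2 * (a + b) * D2) &
      jet x v (fun z => shape_det (p z) (q z) (r z) (s z) (t z))
        (a * b) (a * t3 + b * r3)
        (a * B + b * A + 2 * r3 * t3 - 2 * s3 ^+ 2 + 2 * a * b * D2)].
Proof.
move=> jp jq jr js jt m A B D2.
have jn : vjet x v (fun z => cross (p z) (q z))
    (row3 0 0 1) (row3 (- c) (- d) 0) (row3 (- p3) (- q3) m).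
  have jn := vjet_cross jp jq.
  by apply: forall_I3; [have := jn 0|have := jn 1|have := jn 2];
    move=> /jet_eq; apply; rewrite /cross /m !(mxE, row3E)/= /GRing.scale/=; ring.
have jD : jet x v (fun z => gram (p z) (q z)) 1 0 D2.
  by have := jet_dot jn jn => /jet_eq; apply; rewrite !dotE !row3E /D2; ring.
have js1 := jet_dot js jn; have jr1 := jet_dot jr jn; have jt1 := jet_dot jt jn.
rewrite !dotE !row3E in js1 jr1 jt1.
have g11 := jet_dot jp jp; have g12 := jet_dot jp jq; have g22 := jet_dot jq jq.
rewrite !dotE !row3E in g11 g12 g22.
split => //.
- have := jet_add (jet_sub (jet_mul g11 jt1) (jet_mul (jet_scale 2 g12) js1))
    (jet_mul g22 jr1).
  by move=> /jet_eq; apply; rewrite /A /B /D2 /m; field.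
- have := jet_sub (jet_mul jr1 jt1) (jet_sqr js1).
  by move=> /jet_eq; apply; rewrite /A /B /D2 /m; ring.
Qed.

(** The explicit second derivative is the one along the space directions, where
    [D = 1] is critical; along the time direction only the first one enters. *)
Lemma jet_defect (k N0 : R) x v (P B D : V -> R) P0 P1 P2 B0 B1 B2 D0 D1 D2 :
  jet x v P P0 P1 P2 -> jet x v B B0 B1 B2 -> jet x v D D0 D1 D2 ->
  exists G2, jet x v (fun z => k * wnum (P z) (B z) (D z) - N0 * wden (B z) (D z))
    (k * wnum P0 B0 D0 - N0 * wden B0 D0)
    (k * (2 * P0 * P1 * (P0 ^+ 2 - 4 * B0 * D0)
          + P0 ^+ 2 * (2 * P0 * P1 - 4 * (B1 * D0 + B0 * D1)))
     - N0 * (2 * (B1 * D0 ^+ 4 + 4 * B0 * D0 ^+ 3 * D1))) G2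
   /\ (D0 = 1 -> D1 = 0 -> G2 =
    k * ((2 * P0 * P2 + 2 * P1 ^+ 2) * (P0 ^+ 2 - 4 * B0) +
         4 * P0 * P1 * (2 * P0 * P1 - 4 * B1) +
         P0 ^+ 2 * (2 * P0 * P2 + 2 * P1 ^+ 2 - 4 * (B2 + B0 * D2)))
      - N0 * 2 * (B2 + 4 * B0 * D2)).
Proof.
move=> jP jB jD.
have jP2 := jet_sqr jP; have jBD := jet_mul jB jD.
have jnum := jet_mul jP2 (jet_sub jP2 (jet_scale 4 jBD)).
have jD4 := jet_sqr (jet_sqr jD); have jden := jet_scale 2 (jet_mul jB jD4).
have j := jet_sub (jet_scale k jnum) (jet_scale N0 jden).
eexists; split.
  have := jet_ext _ j; move=> /(_ (fun z => k * wnum (P z) (B z) (D z) - N0 * wden (B z) (D z))).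
  move=> j'; apply: jet_eq; first apply: j'.
  - apply: nearW => z; rewrite /wnum /wden; ring.
  - by rewrite /wnum /wden; ring.
  - by ring.
  - reflexivity.
move=> -> ->; ring.
Qed.

End Axis.

Section PointJets.
Context {R : realType} {V : normedModType R}.

Lemma vjet_Ck (x v : V) (f : V -> 'rV[R]_3) (A : set V) : open A -> A x -> Ck 1 A f ->
  vjet x v f (f x) ('D_v f x) ('D_v ('D_v f) x).
Proof.
move=> oA Ax Cf k.
have := @jet_Ck _ _ x v _ A oA Ax (Ck_coord k oA Cf).
have df z : A z -> differentiable f z by exact: (Ck_differentiable Cf).
have dDf : differentiable ('D_v f) x by exact: (Ck_differentiable (Ck_derive v Cf)).
move=> /jet_eq; apply; first reflexivity.
  exact: (derive_coord _ _ (df _ Ax)).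
rewrite -(derive_coord _ _ dDf); apply: near_eq_derive.
by apply: (open_near oA Ax) => z Az; rewrite (derive_coord _ _ (df _ Az)).
Qed.

Lemma vderive_comm (f : V -> 'rV[R]_3) (A : set V) (v w : V) : open A ->
  Ck 2 A f -> {in A, 'D_w ('D_v f) =1 'D_v ('D_w f)}.
Proof.
move=> oA Cf x /set_mem Ax; apply/rowP => k.
have Cfk := Ck_coord k oA Cf.
have df z : A z -> differentiable f z by exact: (Ck_differentiable Cf).
have dD u : differentiable ('D_u f) x by exact: (Ck_differentiable (Ck_derive u Cf)).
have E u u' : 'D_u' ('D_u f) x 0 k = 'D_u' ('D_u (fun z => f z 0 k)) x.
  rewrite -(derive_coord _ _ (dD u)).
  apply: near_eq_derive.
  by apply: (open_near oA Ax) => z Az; rewrite (derive_coord _ _ (df _ Az)).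
exact: (etrans (E v w) (etrans (derive_comm v w oA Ax Cfk) (esym (E w v)))).
Qed.

(** The flow equation, differentiated twice along a space direction and solved
    for the derivatives of the velocity [u].  The power [D^5] contributes
    [- 5 F D2] because [D] is critical with value [1]. *)
Lemma vjet_speed (x v : V) (u n : V -> 'rV[R]_3) (P B D : V -> R)
    (c d P0 P1 P2 B0 B1 B2 D2 n1 n2 n3 : R) (u0 u1 u2 : 'rV[R]_3) :
  vjet x v n (row3 0 0 1) (row3 (- c) (- d) 0) (row3 n1 n2 n3) ->
  jet x v D 1 0 D2 -> jet x v P P0 P1 P2 -> jet x v B B0 B1 B2 ->
  vjet x v u u0 u1 u2 ->
  (\forall z \near x, D z ^+ 5 *: u z = (P z * (P z ^+ 2 - 2 * B z * D z)) *: n z) ->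
  let F := P0 ^+ 3 - 2 * P0 * B0 in
  let F1 := 3 * P0 ^+ 2 * P1 - 2 * (P0 * B1 + P1 * B0) in
  let F2 := 3 * P0 ^+ 2 * P2 + 6 * P0 * P1 ^+ 2
    - 2 * (P0 * B2 + 2 * P1 * B1 + P2 * B0 + P0 * B0 * D2) in
  u1 = row3 (- (F * c)) (- (F * d)) F1 /\
  u2 = row3 (- (2 * F1 * c) + F * n1) (- (2 * F1 * d) + F * n2)
         (F2 + F * n3 - 5 * F * D2).
Proof.
move=> jn jD jP jB ju flow F F1 F2.
have jD5 := jet_mul jD (jet_sqr (jet_sqr jD)).
have jsp := jet_mul jP (jet_sub (jet_sqr jP) (jet_scale 2 (jet_mul jB jD))).
have key k : [/\ u0 0 k = F * row3 0 0 1 0 k,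
    u1 0 k = F1 * row3 0 0 1 0 k + F * row3 (- c) (- d) 0 0 k &
    u2 0 k = (F2 - 5 * F * D2) * row3 0 0 1 0 k
       + 2 * F1 * row3 (- c) (- d) 0 0 k + F * row3 n1 n2 n3 0 k].
  have j1 := jet_mul jD5 (ju k); have j2 := jet_mul jsp (jn k).
  have [] := jet_uniq j1 (jet_ext _ j2).
    apply: filterS flow => z /rowP/(_ k); rewrite !mxE => e.
    rewrite (_ : D z * _ = D z ^+ 5); last by ring.
    by rewrite e; ring.
  move=> e0 e1 e2.
  have h0 : u0 0 k = F * row3 0 0 1 0 k.
    move: e0; rewrite !(expr1n, mulr1, mul1r) => ->; rewrite /F; ring.
  have h1 : u1 0 k = F1 * row3 0 0 1 0 k + F * row3 (- c) (- d) 0 0 k.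
    move: e1; rewrite h0; set U := u1 0 k; set V1 := row3 (- c) _ _ _ _; set V0 := row3 0 0 1 _ _.
    move=> e1; transitivity (U + 0); first by ring.
    transitivity (1 * (1 ^+ 2) ^+ 2 * U); first by ring.
    by move: e1; rewrite /F1 /F => e1; apply/eqP; rewrite -subr_eq0;
      move/eqP: e1; rewrite -subr_eq0 => /eqP e1; rewrite -e1; apply/eqP; ring.
  split=> //; move: e2; rewrite h0 h1.
  set U := u2 0 k; set V2 := row3 n1 _ _ _ _; set V1 := row3 (- c) _ _ _ _; set V0 := row3 0 0 1 _ _.
  move/eqP; rewrite -subr_eq0 => /eqP e2; apply/eqP; rewrite -subr_eq0 -e2; apply/eqP.
  rewrite /F2 /F1 /F; ring.
split; apply: eq_row3; rewrite !row3E.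
- by have [_ -> _] := key 0; rewrite !row3E; ring.
- by have [_ -> _] := key 1; rewrite !row3E; ring.
- by have [_ -> _] := key 2; rewrite !row3E; ring.
- by have [_ _ ->] := key 0; rewrite !row3E; ring.
- by have [_ _ ->] := key 1; rewrite !row3E; ring.
- by have [_ _ ->] := key 2; rewrite !row3E; ring.
Qed.

(** First variation of the invariants, for a velocity whose tangential part
    leaves [p] and [q] orthogonal, as the form of the derivatives of [p] and [q]
    says. *)
Lemma jet_shape_time (x v : V) (p q r s t : V -> 'rV[R]_3)
    (a b p1 p3 q2 q3 r1 r2 r3 t1 t2 t3 : R) (st p'' q'' r'' s'' t'' : 'rV[R]_3) :
  vjet x v p (row3 1 0 0) (row3 p1 0 p3) p'' ->
  vjet x v q (row3 0 1 0) (row3 0 q2 q3) q'' ->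
  vjet x v r (row3 0 0 a) (row3 r1 r2 r3) r'' ->
  vjet x v s (row3 0 0 0) st s'' ->
  vjet x v t (row3 0 0 b) (row3 t1 t2 t3) t'' ->
  exists D2 P2 B2,
  [/\ jet x v (fun z => gram (p z) (q z)) 1 (2 * (p1 + q2)) D2,
      jet x v (fun z => shape_tr (p z) (q z) (r z) (s z) (t z))
        (a + b) (t3 + r3 + (a + b) * (p1 + q2) + 2 * (b * p1 + a * q2)) P2 &
      jet x v (fun z => shape_det (p z) (q z) (r z) (s z) (t z))
        (a * b) (a * t3 + b * r3 + 2 * a * b * (p1 + q2)) B2].
Proof.
move=> jp jq jr js jt.
have jn := vjet_cross jp jq.
have jD := jet_dot jn jn.
have js1 := jet_dot js jn; have jr1 := jet_dot jr jn; have jt1 := jet_dot jt jn.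
have g11 := jet_dot jp jp; have g12 := jet_dot jp jq; have g22 := jet_dot jq jq.
have jP := jet_add (jet_sub (jet_mul g11 jt1) (jet_mul (jet_scale 2 g12) js1))
    (jet_mul g22 jr1).
have jB := jet_sub (jet_mul jr1 jt1) (jet_sqr js1).
eexists; eexists; eexists; split.
- by apply: (jet_eq jD); last reflexivity; rewrite !dotE /cross !(mxE, row3E)/=; ring.
- by apply: (jet_eq jP); last reflexivity; rewrite !dotE /cross !(mxE, row3E)/=; ring.
- by apply: (jet_eq jB); last reflexivity; rewrite !dotE /cross !(mxE, row3E)/=; ring.
Qed.

End PointJets.

Section DefectJets.
Context {R : realType} {V : normedModType R}.

(** When [N0 / k] is a value of the pinching quotient, the defect has the sign of
    the difference of the quotient to that value wherever [k] and the
    denominator are positive; its maxima can be studied without dividing. *)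
Definition defect (p q r s t : 'rV[R]_3) (k N0 : R) : R :=
  k * wnum (shape_tr p q r s t) (shape_det p q r s t) (gram p q)
  - N0 * wden (shape_det p q r s t) (gram p q).

(** All derivatives are plain vectors here, named after the derivative of the
    parametrization they stand for: [p], [q], [r], [s], [t], [u] are [Z_1], [Z_2],
    [Z_11], [Z_12], [Z_22], [Z_t].  The coincidences between the jets encode the
    symmetry of mixed derivatives, in particular that the time derivatives [U1],
    [U2], [U11], [U22] of [p], [q], [r], [t] are space derivatives of [u].  The third
    components of the third derivatives are the [h_ijk], so the Codazzi equations
    hold by construction and the Simons identity is a ring identity. *)
Lemma flow_defect_jets (e1 e2 et x : V) (p q r s t u : V -> 'rV[R]_3) (a b : R)
   (Z111 Z112 Z122 Z222 Z1111 Z1122 Z2222 S1 S2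
    u0 u0' U1 U2 U11 U22 Us U1' U2' U11' U22' Us' : 'rV[R]_3) :
  vjet x e1 p (row3 1 0 0) (row3 0 0 a) Z111 ->
  vjet x e1 q (row3 0 1 0) (row3 0 0 0) Z112 ->
  vjet x e1 r (row3 0 0 a) Z111 Z1111 ->
  vjet x e1 s (row3 0 0 0) Z112 S1 ->
  vjet x e1 t (row3 0 0 b) Z122 Z1122 ->
  vjet x e2 p (row3 1 0 0) (row3 0 0 0) Z122 ->
  vjet x e2 q (row3 0 1 0) (row3 0 0 b) Z222 ->
  vjet x e2 r (row3 0 0 a) Z112 Z1122 ->
  vjet x e2 s (row3 0 0 0) Z122 S2 ->
  vjet x e2 t (row3 0 0 b) Z222 Z2222 ->
  vjet x et p (row3 1 0 0) U1 U1' ->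
  vjet x et q (row3 0 1 0) U2 U2' ->
  vjet x et r (row3 0 0 a) U11 U11' ->
  vjet x et s (row3 0 0 0) Us Us' ->
  vjet x et t (row3 0 0 b) U22 U22' ->
  vjet x e1 u u0 U1 U11 -> vjet x e2 u u0' U2 U22 ->
  0 < a * b ->
  let D z := gram (p z) (q z) in
  let P z := shape_tr (p z) (q z) (r z) (s z) (t z) in
  let B z := shape_det (p z) (q z) (r z) (s z) (t z) in
  (\forall z \near x, D z ^+ 5 *: u z = (P z * (P z ^+ 2 - 2 * B z * D z))
     *: cross (p z) (q z)) ->
  let G z := defect (p z) (q z) (r z) (s z) (t z) (2 * a * b) ((a ^+ 2 - b ^+ 2) ^+ 2) in
  (forall g0 g1 g2, jet x e1 G g0 g1 g2 -> g1 = 0 /\ g2 <= 0) ->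
  (forall g0 g1 g2, jet x e2 G g0 g1 g2 -> g1 = 0 /\ g2 <= 0) ->
  forall g0 g1 g2, jet x et G g0 g1 g2 -> g1 <= 0.
Proof.
rewrite [Z111]row3_eta [Z112]row3_eta [Z122]row3_eta [Z222]row3_eta
  [Z1111]row3_eta [Z1122]row3_eta [Z2222]row3_eta [S1]row3_eta [S2]row3_eta.
move: (Z111 0 0) (Z111 0 1) (Z111 0 2) => X111 Y111 al.
move: (Z112 0 0) (Z112 0 1) (Z112 0 2) => X112 Y112 be.
move: (Z122 0 0) (Z122 0 1) (Z122 0 2) => X122 Y122 ga.
move: (Z222 0 0) (Z222 0 1) (Z222 0 2) => X222 Y222 de.
move: (Z1111 0 0) (Z1111 0 1) (Z1111 0 2) => X1111 Y1111 W1.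
move: (Z1122 0 0) (Z1122 0 1) (Z1122 0 2) => X1122 Y1122 W12.
move: (Z2222 0 0) (Z2222 0 1) (Z2222 0 2) => X2222 Y2222 W2.
move=> p1 q1 r1 s1 t1 p2 q2 r2 s2 t2 pt qt rt st tt ue1 ue2 ab0 D P B flow G m1 m2.
have [n1 D1 P1 B1] := jet_shape_axis p1 q1 r1 s1 t1.
have [n2 D2 P2 B2] := jet_shape_axis p2 q2 r2 s2 t2.
set A1 := (X in jet x e1 _ _ _ (X + _ + _)) in P1.
rewrite -/A1 in B1.
set A2 := (X in jet x e2 _ _ _ (X + _ + _)) in P2.
rewrite -/A2 in B2.
set C1 := (X in jet x e1 _ _ _ (_ + X + _)) in P1.
rewrite -/C1 in B1.
set C2 := (X in jet x e2 _ _ _ (_ + X + _)) in P2.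
rewrite -/C2 in B2.
(* space derivatives of the velocity, from the flow equation *)
have [EU1 EU11] := vjet_speed n1 D1 P1 B1 ue1 flow.
have [EU2 EU22] := vjet_speed n2 D2 P2 B2 ue2 flow.
pose F := (a + b) * (a ^+ 2 + b ^+ 2).
pose F2 A B r t s := (3 * a ^+ 2 + 2 * a * b + b ^+ 2) * A
     + (3 * b ^+ 2 + 2 * a * b + a ^+ 2) * B + (6 * a + 2 * b) * r ^+ 2
     + 4 * (a + b) * r * t + (6 * b + 2 * a) * t ^+ 2 + 4 * (a + b) * s ^+ 2.
have [g1' [jG1 EG1]] := jet_defect (2 * a * b) ((a ^+ 2 - b ^+ 2) ^+ 2) P1 B1 D1.
have [g2' [jG2 EG2]] := jet_defect (2 * a * b) ((a ^+ 2 - b ^+ 2) ^+ 2) P2 B2 D2.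
have {EG1} EG1 := EG1 erefl erefl; have {EG2} EG2 := EG2 erefl erefl.
have [d1 dd1] := m1 _ _ _ jG1; have [d2 dd2] := m2 _ _ _ jG2.
move=> g0 g1 g2 jG.
have [Dt [Pt [Bt [jDt jPt jBt]]]] : exists D2 P2 B2,
  [/\ jet x et D 1 (2 * (- (F * a) + - (F * b))) D2,
      jet x et P (a + b) (U22 0 2 + U11 0 2 + (a + b) * (- (F * a) + - (F * b))
          + 2 * (b * - (F * a) + a * - (F * b))) P2 &
      jet x et B (a * b) (a * U22 0 2 + b * U11 0 2
          + 2 * a * b * (- (F * a) + - (F * b))) B2].
  apply: (jet_shape_time (st := Us) (p3 := U1 0 2) (q3 := U2 0 2)
     (r1 := U11 0 0) (r2 := U11 0 1) (t1 := U22 0 0) (t2 := U22 0 1)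
     (p'' := U1') (q'' := U2') (r'' := U11') (s'' := Us') (t'' := U22')) => //.
  - have <- // : U1 = row3 (- (F * a)) 0 (U1 0 2).
    by rewrite EU1; apply: eq_row3; rewrite !row3E// /F; ring.
  - have <- // : U2 = row3 0 (- (F * b)) (U2 0 2).
    by rewrite EU2; apply: eq_row3; rewrite !row3E// /F; ring.
  - by rewrite -row3_eta.
  - by rewrite -row3_eta.
have [gt' [jGt _]] := jet_defect (2 * a * b) ((a ^+ 2 - b ^+ 2) ^+ 2) jPt jBt jDt.
have [_ -> _] := jet_uniq jG jGt.
have e11 : U11 0 2 = F2 A1 C1 al ga be - F * a ^+ 2.
  by rewrite EU11 row3E /F2 /F; field.
have e22 : U22 0 2 = F2 A2 C2 be de ga - F * b ^+ 2.
  by rewrite EU22 row3E /F2 /F; field.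
rewrite e11 e22.
(* the fourth derivative [Z_1122] occurs in both terms and cancels *)
have simons : C1 - A2 = a * b * (b - a) by rewrite /C1 /A2; ring.
have := @reaction_le0 R a b al be ga de A1 C1 A2 C2 ab0 simons.
rewrite -/F => /=.
move: d1 dd1 d2 dd2; rewrite EG1 EG2; clearbody A1 A2 C1 C2.
move=> d1 dd1 d2 dd2 H.
apply: le_trans (H _ _ _ _).
- by rewrite le_eqVlt; apply/orP; left; apply/eqP; rewrite /F2 /F; ring.
- by rewrite -[RHS]d1; ring.
- by rewrite -[RHS]d2; ring.
- by apply: le_trans dd1; rewrite le_eqVlt; apply/orP; left; apply/eqP; field.
- by apply: le_trans dd2; rewrite le_eqVlt; apply/orP; left; apply/eqP; field.
Qed.

End DefectJets.

(** * The defect of the pinching quotient under the flow *)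

Section Defect.
Context {R : realType} {V : normedModType R}.

Definition gram_at (e1 e2 : V) (Z : V -> 'rV[R]_3) z := gram ('D_e1 Z z) ('D_e2 Z z).
Definition shape_tr_at (e1 e2 : V) (Z : V -> 'rV[R]_3) z :=
  shape_tr ('D_e1 Z z) ('D_e2 Z z) ('D_e1 ('D_e1 Z) z) ('D_e1 ('D_e2 Z) z)
    ('D_e2 ('D_e2 Z) z).
Definition shape_det_at (e1 e2 : V) (Z : V -> 'rV[R]_3) z :=
  shape_det ('D_e1 Z z) ('D_e2 Z z) ('D_e1 ('D_e1 Z) z) ('D_e1 ('D_e2 Z) z)
    ('D_e2 ('D_e2 Z) z).
Definition defect_at (e1 e2 : V) (Z : V -> 'rV[R]_3) (k N0 : R) z :=
  defect ('D_e1 Z z) ('D_e2 Z z) ('D_e1 ('D_e1 Z) z) ('D_e1 ('D_e2 Z) z)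
    ('D_e2 ('D_e2 Z) z) k N0.

Lemma vjet_eq x v (f : V -> 'rV[R]_3) a b c a' b' c' : vjet x v f a b c ->
  a = a' -> b = b' -> c = c' -> vjet x v f a' b' c'.
Proof. by move=> + <- <- <-. Qed.

(** [2 a b] and [(a^2 - b^2)^2] are denominator and numerator of the pinching
    quotient at the point.  Since derivatives commute, the flow equation determines
    the time derivatives of [Z_1], ..., [Z_22] and hence that of the defect. *)
Lemma flow_defect_le0 (e1 e2 et x : V) (Z : V -> 'rV[R]_3) (A : set V) (a b : R) :
  open A -> A x -> Ck 4 A Z -> 0 < a * b ->
  'D_e1 Z x = row3 1 0 0 -> 'D_e2 Z x = row3 0 1 0 ->
  'D_e1 ('D_e1 Z) x = row3 0 0 a -> 'D_e1 ('D_e2 Z) x = row3 0 0 0 ->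
  'D_e2 ('D_e2 Z) x = row3 0 0 b ->
  (forall z, A z -> gram_at e1 e2 Z z ^+ 5 *: 'D_et Z z
     = (shape_tr_at e1 e2 Z z * (shape_tr_at e1 e2 Z z ^+ 2 - 2 * shape_det_at e1 e2 Z z * gram_at e1 e2 Z z))
       *: cross ('D_e1 Z z) ('D_e2 Z z)) ->
  let G := defect_at e1 e2 Z (2 * a * b) ((a ^+ 2 - b ^+ 2) ^+ 2) in
  Ck 1 A G ->
  (\forall s \near (0:R), G (s *: e1 + x) <= G x) ->
  (\forall s \near (0:R), G (s *: e2 + x) <= G x) ->
  'D_et G x <= 0.
Proof.
move=> oA Ax C4 ab0 Ep Eq Er Es Et flow G CG max1 max2.
have C3 v : Ck 3 A ('D_v Z) := Ck_derive v C4.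
have C2 v w : Ck 2 A ('D_v ('D_w Z)) := Ck_derive v (C3 w).
have C1 u v w : Ck 1 A ('D_u ('D_v ('D_w Z))) := Ck_derive u (C2 v w).
have comm (f : V -> 'rV[R]_3) v w (Cf : Ck 2 A f) := vderive_comm v w oA Cf.
have D (f g : V -> 'rV[R]_3) v (fg : {in A, f =1 g}) := eq_on_derive v oA fg.
have inx : x \in A by rewrite inE.
have C2' v : Ck 2 A ('D_v Z) := Ck_le (leqnSn _) (C3 v).
have CZ2 : Ck 2 A Z := Ck_le (isT : (2 <= 4)%N) C4.
have E12 : {in A, 'D_e2 ('D_e1 Z) =1 'D_e1 ('D_e2 Z)} := comm Z e1 e2 CZ2.
have Et1 : {in A, 'D_et ('D_e1 Z) =1 'D_e1 ('D_et Z)} := comm Z e1 et CZ2.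
have Et2 : {in A, 'D_et ('D_e2 Z) =1 'D_e2 ('D_et Z)} := comm Z e2 et CZ2.
have E211 : {in A, 'D_e2 ('D_e1 ('D_e1 Z)) =1 'D_e1 ('D_e1 ('D_e2 Z))} :=
  fun z Az => etrans (comm _ e1 e2 (C2' e1) z Az) (D _ _ e1 E12 z Az).
have E212 : {in A, 'D_e2 ('D_e1 ('D_e2 Z)) =1 'D_e1 ('D_e2 ('D_e2 Z))} :=
  comm _ e1 e2 (C2' e2).
have E221 : {in A, 'D_e2 ('D_e2 ('D_e1 Z)) =1 'D_e1 ('D_e2 ('D_e2 Z))} :=
  fun z Az => etrans (D _ _ e2 E12 z Az) (E212 z Az).
have E2211 : {in A, 'D_e2 ('D_e2 ('D_e1 ('D_e1 Z))) =1 'D_e1 ('D_e1 ('D_e2 ('D_e2 Z)))} :=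
  fun z Az => etrans (D _ _ e2 E211 z Az)
    (etrans (comm _ e1 e2 (C2 e1 e2) z Az) (D _ _ e1 E212 z Az)).
have Et11 : {in A, 'D_et ('D_e1 ('D_e1 Z)) =1 'D_e1 ('D_e1 ('D_et Z))} :=
  fun z Az => etrans (comm _ e1 et (C2' e1) z Az) (D _ _ e1 Et1 z Az).
have Et22 : {in A, 'D_et ('D_e2 ('D_e2 Z)) =1 'D_e2 ('D_e2 ('D_et Z))} :=
  fun z Az => etrans (comm _ e2 et (C2' e2) z Az) (D _ _ e2 Et2 z Az).
have J v f (Cf : Ck 1 A f) := vjet_Ck v oA Ax Cf.
have C1' v : Ck 1 A ('D_v Z) := Ck_le (isT : (1 <= 3)%N) (C3 v).
have C1'' v w : Ck 1 A ('D_v ('D_w Z)) := Ck_le (isT : (1 <= 2)%N) (C2 v w).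
have flow' : \forall z \near x, gram_at e1 e2 Z z ^+ 5 *: 'D_et Z z
     = (shape_tr_at e1 e2 Z z * (shape_tr_at e1 e2 Z z ^+ 2 - 2 * shape_det_at e1 e2 Z z * gram_at e1 e2 Z z))
       *: cross ('D_e1 Z z) ('D_e2 Z z) := open_near oA Ax flow.
have maxjet v : (\forall s \near (0:R), G (s *: v + x) <= G x) ->
    forall g0 g1 g2, jet x v G g0 g1 g2 -> g1 = 0 /\ g2 <= 0.
  move=> maxv g0 g1 g2 [_ _ _ <- <-]; split.
    exact: (derive_max_eq0 (Ck_differentiable CG Ax) maxv).
  exact: (derive2_max_le0 oA Ax CG maxv).
have p1 := vjet_eq (J e1 _ (C1' e1)) Ep Er erefl.
have q1 := vjet_eq (J e1 _ (C1' e2)) Eq Es erefl.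
have r1 := vjet_eq (J e1 _ (C1'' e1 e1)) Er erefl erefl.
have s1 := vjet_eq (J e1 _ (C1'' e1 e2)) Es erefl erefl.
have t1 := vjet_eq (J e1 _ (C1'' e2 e2)) Et erefl erefl.
have p2 := vjet_eq (J e2 _ (C1' e1)) Ep (etrans (E12 x inx) Es) (E221 x inx).
have q2 := vjet_eq (J e2 _ (C1' e2)) Eq Et erefl.
have r2 := vjet_eq (J e2 _ (C1'' e1 e1)) Er (E211 x inx) (E2211 x inx).
have s2 := vjet_eq (J e2 _ (C1'' e1 e2)) Es (E212 x inx) erefl.
have t2 := vjet_eq (J e2 _ (C1'' e2 e2)) Et erefl erefl.
have pt := vjet_eq (J et _ (C1' e1)) Ep (Et1 x inx) erefl.
have qt := vjet_eq (J et _ (C1' e2)) Eq (Et2 x inx) erefl.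
have rt := vjet_eq (J et _ (C1'' e1 e1)) Er (Et11 x inx) erefl.
have st := vjet_eq (J et _ (C1'' e1 e2)) Es erefl erefl.
have tt := vjet_eq (J et _ (C1'' e2 e2)) Et (Et22 x inx) erefl.
have u1 := J e1 _ (C1' et).
have u2 := J e2 _ (C1' et).
have Gt := jet_Ck et oA Ax CG.
have m1 := maxjet _ max1.
have m2 := maxjet _ max2.
have H := flow_defect_jets p1 q1 r1 s1 t1 p2 q2 r2 s2 t2 pt qt rt st tt u1 u2 ab0 flow'.
have H7 := H m1.
have H8 := H7 m2.
have H9 := H8 _ _ _ Gt.
exact: H9.
Qed.
End Defect.

(** * Local parametrizations *)

Section Charts.
Context {R : realType}.
Implicit Types (V W : normedModType R).

Lemma smooth_open_sub V W (A B : set V) (f : V -> W) : A `<=` B ->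
  smooth_open B f -> smooth_open A f.
Proof. by move=> AB fB vs x /AB; exact: fB. Qed.

Lemma smooth_on_open V W (A : set V) (f : V -> W) : open A ->
  smooth_on A f -> smooth_open A f.
Proof.
move=> oA fA; apply/smooth_openP => k vs vsk x Ax.
have [N [F [oO Ox FO eF]]] := fA x Ax.
have oAO : open (A `&` N) by exact: openI.
have CkF : Ck k (A `&` N) F.
  by apply: Ck_sub ((smooth_openP _ _).1 FO k) => z [].
by have := Ck_ext oAO eF CkF => /(_ vs vsk x); apply.
Qed.

Lemma smooth_open_continuous V W (A : set V) (f : V -> W) x : smooth_open A f -> A x ->
  {for x, continuous f}.
Proof. by move=> fA Ax; apply: differentiable_continuous; exact: (fA [::]). Qed.

(** The inverse of a diffeomorphism between arbitrary sets is locally the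
    restriction of a smooth map [g] of the surrounding space, which can be composed
    and differentiated. *)
Lemma diffeo_inverse V W (A : set V) (B : set W) (f : V -> W) b :
  diffeo A B f -> B b ->
  exists (N : set W) (g : W -> V), [/\ open N, N b, smooth_open N g,
    forall y, B y -> N y -> A (g y) /\ f (g y) = y &
    forall x, A x -> N (f x) -> g (f x) = x].
Proof.
move=> [fAB _ [g [gs gK]]] Bb; have [N [F [oO Ob FO eF]]] := gs b Bb.
exists N, F; split=> // [y By Oy|x Ax Ofx].
  have : (f @` A) y by rewrite fAB.
  move=> [x Ax fxy]; have -> : F y = x.
    by rewrite eF ?inE// -fxy gK// inE.
  by split.
rewrite eF ?inE; last by split=> //; rewrite -fAB; exists x.
by rewrite gK// inE.
Qed.

Lemma local_param_inverse (M : set 'rV[R]_3) U phi u :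
  local_param M U phi -> U u ->
  exists (N : set 'rV[R]_3) (g : 'rV[R]_3 -> 'rV[R]_2),
  [/\ open N, N (phi u), smooth_open N g,
    forall y, M y -> N y -> U (g y) /\ phi (g y) = y &
    forall x, U x -> N (phi x) -> g (phi x) = x].
Proof.
move=> [oU [N1 oO1 dphi]] Uu.
have MO : (M `&` N1) (phi u) by case: dphi => <- _ _; exists u.
have [N [g [oO Ou sg H1 H2]]] := diffeo_inverse dphi MO.
exists (N `&` N1), g; split; first exact: openI.
- by split=> //; case: MO.
- by apply: smooth_open_sub sg => z [].
- by move=> y My [Oy O1y]; apply: H1.
- by move=> x Ux [Ox _]; apply: H2.
Qed.

Lemma local_param_smooth (M : set 'rV[R]_3) U phi : local_param M U phi ->
  smooth_open U phi.
Proof. by move=> [oU [N _ [_ sphi _]]]; exact: smooth_on_open. Qed.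

Lemma local_param_in (M : set 'rV[R]_3) U phi u : local_param M U phi -> U u -> M (phi u).
Proof.
move=> [oU [N _ [im _ _]]] Uu.
by have : (M `&` N) (phi u) by [rewrite -im; exists u]; case.
Qed.

(** Differentiate [g o phi = id], with [g] a smooth local left inverse. *)
Lemma local_param_immersive (M : set 'rV[R]_3) U phi u (v : 'rV[R]_2) :
  local_param M U phi -> U u -> 'D_v phi u = 0 -> v = 0.
Proof.
move=> lp Uu Dv.
have [N [g [oO Ou sg _ gK]]] := local_param_inverse lp Uu.
have sphi := local_param_smooth lp; have oU : open U by case: lp.
have dphi : differentiable phi u by exact: (sphi [::]).
have dg : differentiable g (phi u) by exact: (sg [::]).
have cphi := differentiable_continuous dphi.
have gid : \forall z \near u, (g \o phi) z = z.
  have nO : \forall z \near u, N (phi z) by apply: cphi; exact: open_nbhs_nbhs.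
  have nU : \forall z \near u, U z by exact: open_nbhs_nbhs.
  by move: nO nU; apply: filterS2 => z Oz Uz; exact: gK.
have := near_eq_derive v gid.
rewrite derive_id deriveE; last exact: differentiable_comp.
by rewrite diff_comp//= -(deriveE v dphi) Dv linear0.
Qed.

End Charts.

(** * The shape operator *)

Section Curvature.
Context {R : realType}.
Implicit Types (u v w p q r s t n nu : 'rV[R]_3).

Lemma dotC u v : dot u v = dot v u.
Proof. by rewrite !dotE; ring. Qed.

Lemma dotZl (a : R) u v : dot (a *: u) v = a * dot u v.
Proof. by rewrite !dotE !mxE; ring. Qed.

Lemma dotDl u v w : dot (u + v) w = dot u w + dot v w.
Proof. by rewrite !dotE !mxE; ring. Qed.

Lemma dot_ge0 u : 0 <= dot u u.
Proof. by rewrite dotE -!expr2 !addr_ge0 ?sqr_ge0. Qed.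

Lemma dot_eq0 u : dot u u = 0 -> u = 0.
Proof.
rewrite dotE -!expr2 => E.
have := sqr_ge0 (u 0 0); have := sqr_ge0 (u 0 1); have := sqr_ge0 (u 0 2) => a b c.
by apply: eq_row3; rewrite !mxE; apply/eqP; rewrite -sqrf_eq0; apply/eqP; lra.
Qed.

Lemma dot0l u : dot 0 u = 0. Proof. by rewrite dotE !mxE; ring. Qed.

Lemma gramE p q : gram p q = dot p p * dot q q - dot p q ^+ 2.
Proof. by rewrite /gram !dotE /cross !row3E; ring. Qed.

(** A vector orthogonal to the plane of [p] and [q] is parallel to their cross
    product: expand the double cross product with [nu]. *)
Lemma normal_parallel p q nu : dot nu nu = 1 -> dot nu p = 0 -> dot nu q = 0 ->
  cross p q = dot (cross p q) nu *: nu.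
Proof.
move=> nn np nq.
have E : dot nu nu *: cross p q - dot (cross p q) nu *: nu
   = dot nu q *: cross p nu - dot nu p *: cross q nu.
  by apply: eq_row3; rewrite !dotE !mxE /=; ring.
by apply/eqP; rewrite -subr_eq0 -[X in X - _]scale1r -nn E np nq !scale0r subrr.
Qed.

Lemma det_mx2 (A : 'M[R]_2) : \det A = A 0 0 * A 1 1 - A 0 1 * A 1 0.
Proof.
rewrite (expand_det_row _ 0) !big_ord_recl big_ord0 addr0 /cofactor !det_mx11 !mxE.
rewrite /= expr0 mul1r expr1 mulN1r mulrN.
congr (_ * _ - _ * _); congr (A _ _); exact: val_inj.
Qed.

Lemma tr_mx2 (A : 'M[R]_2) : \tr A = A 0 0 + A 1 1.
Proof.
by rewrite /mxtrace !big_ord_recl big_ord0 addr0; congr (_ + A _ _); exact: val_inj.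
Qed.

Lemma mulmx2E (A B : 'M[R]_2) i j : (A *m B) i j = A i 0 * B 0 j + A i 1 * B 1 j.
Proof.
by rewrite mxE !big_ord_recl big_ord0 addr0; congr (_ + A _ _ * B _ _); exact: val_inj.
Qed.

Lemma char_poly2_roots (A : 'M[R]_2) (l1 l2 : R) :
  char_poly A = ('X - l1%:P) * ('X - l2%:P) -> \tr A = l1 + l2 /\ \det A = l1 * l2.
Proof.
move=> E; have := char_poly_trace A isT; have := char_poly_det A; rewrite E.
have -> : ('X - l1%:P) * ('X - l2%:P) = 'X^2 - (l1 + l2) *: 'X + (l1 * l2)%:P.
  by rewrite -mul_polyC polyCD polyCM; ring.
rewrite !coefE /=. move=> e0 e1; split.
  by move: e1; rewrite !(mulr1, mulr0, addr0, sub0r) => /eqP; rewrite eqr_opp => /eqP.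
by move: e0; rewrite !(mulr0, subr0, add0r, oppr0) sqrrN expr1n mul1r => ->.
Qed.

(** Trace and determinant of [g^-1 h], cleared of the denominator [det g]. *)
Lemma shape_operator (g h : 'M[R]_2) (l1 l2 : R) : \det g != 0 ->
  char_poly (invmx g *m h) = ('X - l1%:P) * ('X - l2%:P) ->
  (l1 + l2) * \det g = g 0 0 * h 1 1 - g 0 1 * h 1 0 - g 1 0 * h 0 1 + g 1 1 * h 0 0
  /\ l1 * l2 * \det g = \det h.
Proof.
move=> dg /char_poly2_roots[<- <-].
have ug : g \in unitmx by rewrite unitmxE unitfE.
have gA : g *m (invmx g *m h) = h by rewrite mulmxA mulmxV// mul1mx.
split; last by rewrite mulrC -det_mulmx gA.
move: (invmx g *m h) gA => A <-; rewrite det_mx2 tr_mx2 !mulmx2E; ring.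
Qed.

End Curvature.

(** * Curvatures in an arbitrary parametrization *)

Section ParamCurvature.
Context {R : realType}.
Implicit Types (M : set 'rV[R]_3).

Local Notation b0 := (@basis_vec R 0).
Local Notation b1 := (@basis_vec R 1).

Lemma rV2_basis (v : 'rV[R]_2) : v = v 0 0 *: b0 + v 0 1 *: b1.
Proof.
rewrite {1}(row_sum_delta v) !big_ord_recl big_ord0 addr0.
by congr (_ + v _ _ *: basis_vec _); exact: val_inj.
Qed.

Lemma derive_dir2 (W : normedModType R) (f : 'rV[R]_2 -> W) u (x y : R) :
  differentiable f u ->
  'D_(x *: b0 + y *: b1) f u = x *: 'D_b0 f u + y *: 'D_b1 f u.
Proof. by move=> df; rewrite !deriveE// linearD !linearZ. Qed.

(** If [p x q = 0] then [(p x q) x q = 0] is a linear relation between [p] and [q],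
    and immersivity makes its coefficients vanish. *)
Lemma param_gram_gt0 M U phi u : local_param M U phi -> U u -> 0 < gram_at b0 b1 phi u.
Proof.
move=> lp Uu; rewrite lt_neqAle dot_ge0 andbT eq_sym; apply/eqP => D0.
have dphi : differentiable phi u by exact: (local_param_smooth lp [::]).
have imm x y : x *: 'D_b0 phi u + y *: 'D_b1 phi u = 0 -> x = 0 /\ y = 0.
  rewrite -derive_dir2// => /(local_param_immersive lp Uu) E.
  have := congr1 (fun v : 'rV[R]_2 => v 0 0) E.
  have := congr1 (fun v : 'rV[R]_2 => v 0 1) E.
  by rewrite !mxE /= !(mulr0, mulr1, add0r, addr0).
move: imm D0; rewrite /gram_at; move: ('D_b0 phi u) ('D_b1 phi u) => p q imm /dot_eq0 n0.
have E : dot q q *: p + (- dot p q) *: q = 0.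
  have -> : dot q q *: p + (- dot p q) *: q = - cross (cross p q) q.
    by apply: eq_row3; rewrite !dotE !mxE/=; ring.
  by rewrite n0; apply: eq_row3; rewrite !mxE/=; ring.
have [/dot_eq0 q0 _] := imm _ _ E.
have [] := imm 0 1; last by move=> _ /eqP; rewrite oner_eq0.
by rewrite q0 scaler0 scale0r addr0.
Qed.

(** [k] is the signed length of [p x q] with respect to the given normal [nu]; it
    disappears from the formulas as soon as they are squared or multiplied by the
    normal, which is what [curvature_invariants] does. *)
Lemma weingarten (p q r s t nu : 'rV[R]_3) (g h : 'M[R]_2) (l1 l2 : R) :
  0 < gram p q -> dot nu nu = 1 -> dot nu p = 0 -> dot nu q = 0 ->
  char_poly (invmx g *m h) = ('X - l1%:P) * ('X - l2%:P) ->
  g 0 0 = dot p p -> g 0 1 = dot p q -> g 1 0 = dot q p -> g 1 1 = dot q q ->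
  h 0 0 = - dot r nu -> h 0 1 = - dot s nu -> h 1 0 = - dot s nu ->
  h 1 1 = - dot t nu ->
  exists k, [/\ k ^+ 2 = gram p q, cross p q = k *: nu,
    k * (l1 + l2) * gram p q = - shape_tr p q r s t &
    l1 * l2 * gram p q ^+ 2 = shape_det p q r s t].
Proof.
move=> D0 nn np nq pc g00 g01 g10 g11 h00 h01 h10 h11.
have nE := normal_parallel nn np nq.
set k := dot _ nu in nE.
have kD : k ^+ 2 = gram p q.
  by rewrite /gram nE dotZl dotC dotZl nn; ring.
have scE w : second_coef p q w = k * dot w nu.
  by rewrite /second_coef nE dotC dotZl dotC.
have gE : \det g = gram p q.
  by rewrite det_mx2 g00 g01 g10 g11 gramE [dot q p]dotC; ring.
have [|] := shape_operator (g := g) _ pc; first by rewrite gE gt_eqF.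
rewrite gE det_mx2 g00 g01 g10 g11 h00 h01 h10 h11 => tr dt.
exists k; split => //.
- rewrite -mulrA tr /shape_tr !scE [dot q p]dotC; ring.
- rewrite expr2 mulrA dt -kD /shape_det !scE; ring.
Qed.

Lemma param_curvature M U phi u nu l1 l2 :
  local_param M U phi -> U u -> dot nu nu = 1 ->
  (forall v, tangent M (phi u) v -> dot nu v = 0) ->
  principal_curvatures M (phi u) nu l1 l2 ->
  let D := gram_at b0 b1 phi u in
  exists k, [/\ k ^+ 2 = D, cross ('D_b0 phi u) ('D_b1 phi u) = k *: nu,
    k * (l1 + l2) * D = - shape_tr_at b0 b1 phi u & l1 * l2 * D ^+ 2 = shape_det_at b0 b1 phi u].
Proof.
move=> lp Uu nn tan pc D.
have D0 : 0 < D by exact: param_gram_gt0 lp Uu.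
have tanw w : dot nu ('D_w phi u) = 0 by apply: tan; exists U, phi, u, w.
have oU : open U by case: lp.
have Cphi : Ck 2 U phi by exact: (smooth_openP _ _).1 (local_param_smooth lp) 2%N.
have sym : 'D_b1 ('D_b0 phi) u = 'D_b0 ('D_b1 phi) u.
  by apply: (vderive_comm b0 b1 oU Cphi); rewrite inE.
have gE i j : first_form phi u i j = dot ('D_(basis_vec i) phi u) ('D_(basis_vec j) phi u).
  exact: mxE.
have hE i j : second_form phi u nu i j
    = - dot ('D_(basis_vec i) ('D_(basis_vec j) phi) u) nu.
  exact: mxE.
have h10 := etrans (hE 1 0) (congr1 (fun v => - dot v nu) sym).
exact: (weingarten D0 nn (tanw b0) (tanw b1) (pc U phi u lp Uu erefl)
  (gE 0 0) (gE 0 1) (gE 1 0) (gE 1 1) (hE 0 0) (hE 0 1) h10 (hE 1 1)).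
Qed.

Lemma differentiable_scale_rV (V : normedModType R) n (c : V -> R)
    (F : V -> 'rV[R]_n) x : differentiable c x -> differentiable F x ->
  differentiable (fun z => c z *: F z) x.
Proof.
move=> dc dF.
have dFk k : differentiable (fun z => F z 0 k) x.
  by apply: (@differentiable_comp _ _ _ _ F (fun u => u 0 k)) => //; exact: differentiable_coord.
apply: (differentiable_coords (rV_coordinates n)) => k.
rewrite (_ : _ \o _ = c * (fun z => F z 0 k)); last first.
  by apply/funext => z; rewrite /= /rV_coord mxE.
exact: differentiableM.
Qed.

Lemma derive_scale_rV (V : normedModType R) n (c : V -> R) (F : V -> 'rV[R]_n) x w :
  differentiable c x -> differentiable F x ->
  'D_w (fun z => c z *: F z) x = 'D_w c x *: F x + c x *: 'D_w F x.
Proof.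
move=> dc dF.
have dFk k : differentiable (fun z => F z 0 k) x.
  by apply: (@differentiable_comp _ _ _ _ F (fun u => u 0 k)) => //; exact: differentiable_coord.
have dcF := differentiable_scale_rV dc dF.
apply/rowP => k; rewrite -derive_coord// !mxE.
rewrite (_ : (fun z => (c z *: F z) 0 k) = c * (fun z => F z 0 k)); last first.
  by apply/funext => z; rewrite mxE.
rewrite deriveM; [|exact: diff_derivable|exact: diff_derivable].
by rewrite derive_coord// /GRing.scale/= addrC [F x 0 k * _]mulrC.
Qed.

Lemma sum_I2 (W : nmodType) (F : 'I_2 -> W) : \sum_(i < 2) F i = F 0 + F 1.
Proof.
by rewrite !big_ord_recl big_ord0 addr0; congr (_ + F _); exact: val_inj.
Qed.

Lemma derive_comp2 (V W : normedModType R) (phi : 'rV[R]_2 -> W)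
    (psi : V -> 'rV[R]_2) y v :
  differentiable phi (psi y) -> differentiable psi y ->
  'D_v (phi \o psi : V -> W) y =
    'D_v (fun z => psi z 0 0) y *: 'D_b0 phi (psi y)
    + 'D_v (fun z => psi z 0 1) y *: 'D_b1 phi (psi y).
Proof.
move=> dphi dpsi.
rewrite (derive_comp_coords v (rV_coordinates 2) dphi); first by rewrite sum_I2.
by move=> i; apply: differentiable_comp => //; exact: differentiable_coord.
Qed.

Lemma second_chain_rearrange n (A0 A1 A00 A01 A11 : 'rV[R]_n) c0 c1 d0 d1 f0 f1 :
  f0 *: A0 + d0 *: (c0 *: A00 + c1 *: A01) + (f1 *: A1 + d1 *: (c0 *: A01 + c1 *: A11))
  = f0 *: A0 + f1 *: A1 + (d0 * c0) *: A00 + (d0 * c1 + d1 * c0) *: A01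
    + (d1 * c1) *: A11.
Proof. by apply/rowP => k; rewrite !mxE; ring. Qed.

(** The second-order chain rule for a change of parameters.  The symmetry of the
    derivatives of [phi] is assumed at one point only, which lets the mixed term be
    written with a single vector. *)
Lemma derive2_comp2 (V : normedModType R) n (phi : 'rV[R]_2 -> 'rV[R]_n)
    (psi : V -> 'rV[R]_2) (Y : set V) (U : set 'rV[R]_2) y v w :
  open Y -> Y y -> open U -> Ck 2 U phi -> Ck 2 Y psi -> (forall z, Y z -> U (psi z)) ->
  'D_b1 ('D_b0 phi) (psi y) = 'D_b0 ('D_b1 phi) (psi y) ->
  let P0 z := psi z 0 0 in let P1 z := psi z 0 1 in
  'D_w ('D_v (phi \o psi)) y =
    'D_w ('D_v P0) y *: 'D_b0 phi (psi y) + 'D_w ('D_v P1) y *: 'D_b1 phi (psi y)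
    + ('D_v P0 y * 'D_w P0 y) *: 'D_b0 ('D_b0 phi) (psi y)
    + ('D_v P0 y * 'D_w P1 y + 'D_v P1 y * 'D_w P0 y) *: 'D_b0 ('D_b1 phi) (psi y)
    + ('D_v P1 y * 'D_w P1 y) *: 'D_b1 ('D_b1 phi) (psi y).
Proof.
move=> oY Yy oU Cphi Cpsi YU sym P0 P1.
have dphi z : Y z -> differentiable phi (psi z).
  by move=> Yz; exact: (Ck_differentiable Cphi (YU z Yz)).
have dpsi z : Y z -> differentiable psi z by exact: (Ck_differentiable Cpsi).
have CP0 : Ck 2 Y P0 := Ck_coord 0 oY Cpsi.
have CP1 : Ck 2 Y P1 := Ck_coord 1 oY Cpsi.
pose a := 'D_v P0; pose b := 'D_v P1.
pose F := 'D_b0 phi \o psi; pose H := 'D_b1 phi \o psi.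
have E : \forall z \near y, 'D_v (phi \o psi) z = a z *: F z + b z *: H z.
  apply: (open_near oY Yy) => z Yz.
  exact: (derive_comp2 v (dphi z Yz) (dpsi z Yz)).
have da : differentiable a y := Ck_differentiable (Ck_derive v CP0) Yy.
have db : differentiable b y := Ck_differentiable (Ck_derive v CP1) Yy.
have dD0 : differentiable ('D_b0 phi) (psi y).
  exact: (Ck_differentiable (Ck_derive b0 Cphi) (YU _ Yy)).
have dD1 : differentiable ('D_b1 phi) (psi y).
  exact: (Ck_differentiable (Ck_derive b1 Cphi) (YU _ Yy)).
have dF : differentiable F y := differentiable_comp (dpsi y Yy) dD0.
have dH : differentiable H y := differentiable_comp (dpsi y Yy) dD1.
have DF : 'D_w F y = 'D_w P0 y *: 'D_b0 ('D_b0 phi) (psi y)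
    + 'D_w P1 y *: 'D_b1 ('D_b0 phi) (psi y) := derive_comp2 w dD0 (dpsi y Yy).
have DH : 'D_w H y = 'D_w P0 y *: 'D_b0 ('D_b1 phi) (psi y)
    + 'D_w P1 y *: 'D_b1 ('D_b1 phi) (psi y) := derive_comp2 w dD1 (dpsi y Yy).
have scal (c : V -> R) (K : V -> 'rV[R]_n) : differentiable c y -> differentiable K y ->
    derivable (fun z => c z *: K z) y w.
  by move=> dc dK; exact: (diff_derivable (differentiable_scale_rV dc dK)).
apply: (etrans (near_eq_derive w E)).
apply: (etrans (deriveD (scal _ _ da dF) (scal _ _ db dH))).
apply: (etrans (congr2 +%R (derive_scale_rV w da dF) (derive_scale_rV w db dH))).
have DF' := etrans DF (congr1 (fun X => 'D_w P0 y *: 'D_b0 ('D_b0 phi) (psi y)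
  + 'D_w P1 y *: X) sym).
apply: (etrans (congr2 (fun X Y => 'D_w a y *: F y + a y *: X
  + ('D_w b y *: H y + b y *: Y)) DF' DH)).
exact: second_chain_rearrange.
Qed.

End ParamCurvature.

Section MapCurvature.
Context {R : realType}.
Implicit Types (M : set 'rV[R]_3).

Local Notation b0 := (@basis_vec R 0).
Local Notation b1 := (@basis_vec R 1).

(** [gram], [shape_tr] and [shape_det] pick up the powers 2, 3 and 4 of the
    Jacobian [J]: the tangential parts of the second derivatives are orthogonal to
    the normal and drop out. *)
Lemma reparam_invariants (A0 A1 A00 A01 A11 p q r s t : 'rV[R]_3) a0 a1 c0 c1 f0 f1 g0 g1 h0 h1 :
  p = a0 *: A0 + a1 *: A1 -> q = c0 *: A0 + c1 *: A1 ->
  r = f0 *: A0 + f1 *: A1 + (a0 * a0) *: A00 + (a0 * a1 + a1 * a0) *: A01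
    + (a1 * a1) *: A11 ->
  s = g0 *: A0 + g1 *: A1 + (c0 * a0) *: A00 + (c0 * a1 + c1 * a0) *: A01
    + (c1 * a1) *: A11 ->
  t = h0 *: A0 + h1 *: A1 + (c0 * c0) *: A00 + (c0 * c1 + c1 * c0) *: A01
    + (c1 * c1) *: A11 ->
  let J := a0 * c1 - a1 * c0 in
  [/\ cross p q = J *: cross A0 A1, gram p q = J ^+ 2 * gram A0 A1,
    shape_tr p q r s t = J ^+ 3 * shape_tr A0 A1 A00 A01 A11 &
    shape_det p q r s t = J ^+ 4 * shape_det A0 A1 A00 A01 A11].
Proof.
move=> ep eq er es et J.
have nE : cross p q = J *: cross A0 A1.
  by rewrite ep eq /J; apply: eq_row3; rewrite !mxE/=; ring.
have n0 : dot A0 (cross A0 A1) = 0 by rewrite dotE !row3E; ring.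
have n1 : dot A1 (cross A0 A1) = 0 by rewrite dotE !row3E; ring.
have scE v : second_coef p q v = J * dot v (cross A0 A1).
  by rewrite /second_coef nE dotC dotZl dotC.
have bil (x y z w k : R) : dot (x *: A0 + y *: A1 + z *: A00 + w *: A01 + k *: A11)
    (cross A0 A1) = z * second_coef A0 A1 A00 + w * second_coef A0 A1 A01
      + k * second_coef A0 A1 A11.
  by rewrite !dotDl !dotZl n0 n1 /second_coef; ring.
split => //.
- by rewrite /gram nE dotZl dotC dotZl; ring.
- rewrite /shape_tr !scE er es et !bil ep eq !dotDl !dotZl
    ![dot _ (_ *: A0 + _ *: A1)]dotC !dotDl !dotZl [dot A1 A0]dotC /J; ring.
- rewrite /shape_det !scE er es et !bil /J; ring.
Qed.

(** Principal curvatures are defined through diffeomorphic local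
    parametrizations, but a space-time chart gives at each time only a smooth map
    [Z] into the surface.  Composing with a local inverse of a parametrization
    [phi] writes [Z] as a reparametrization of [phi]; all three identities are
    homogeneous in the Jacobian, so they survive even where it vanishes. *)
Lemma curvature_invariants M (Z : 'rV[R]_2 -> 'rV[R]_3) (Y : set 'rV[R]_2) y nu l1 l2 :
  (exists U phi, local_param M U phi /\ (phi @` U) (Z y)) ->
  open Y -> Y y -> Ck 2 Y Z -> (forall z, Y z -> M (Z z)) ->
  dot nu nu = 1 -> (forall v, tangent M (Z y) v -> dot nu v = 0) ->
  principal_curvatures M (Z y) nu l1 l2 ->
  let D := gram_at b0 b1 Z y in let P := shape_tr_at b0 b1 Z y in
  let B := shape_det_at b0 b1 Z y in
  [/\ (l1 + l2) ^+ 2 * D ^+ 3 = P ^+ 2, l1 * l2 * D ^+ 2 = B &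
    D ^+ 5 *: (- ((l1 + l2) * (l1 ^+ 2 + l2 ^+ 2)) *: nu)
    = (P * (P ^+ 2 - 2 * B * D)) *: cross ('D_b0 Z y) ('D_b1 Z y)].
Proof.
move=> [U [phi [lp [u Uu phiu]]]] oY Yy CZ YM nn tan pc D P B.
rewrite -phiu in tan pc.
have [k [kD nE HP KB]] := param_curvature lp Uu nn tan pc.
have [N [g [oN Nu sg gN gK]]] := local_param_inverse lp Uu.
have oU : open U by case: lp.
have Cphi : Ck 2 U phi by exact: (smooth_openP _ _).1 (local_param_smooth lp) 2%N.
pose psi := g \o Z.
have cZ z : Y z -> {for z, continuous Z}.
  by move=> Yz; apply: differentiable_continuous; exact: (Ck_differentiable CZ).
pose Y' := Y `&` Z @^-1` N.
have oY' : open Y'.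
  rewrite openE => z [Yz Nz]; apply: filterI; first exact: open_nbhs_nbhs.
  by apply: (cZ z Yz); exact: open_nbhs_nbhs.
have Y'y : Y' y by split; rewrite //= -phiu.
have Cg : Ck 2 N g by exact: (smooth_openP _ _).1 sg 2%N.
have CZ' : Ck 2 Y' Z by apply: Ck_sub CZ => z [].
have Cpsi : Ck 2 Y' psi.
  apply: (Ck_coords oY') => i.
  apply: (Ck_comp (f := fun v => g v 0 i) (rV_coordinates 3) oY' (Ck_coord i oN Cg)).
    by move=> j; exact: (Ck_coord j oY' CZ').
  by move=> z [].
have psiU z : Y' z -> U (psi z) by move=> [Yz Nz]; have [] := gN _ (YM _ Yz) Nz.
have psiZ : {in Y', phi \o psi =1 Z}.
  by move=> z /set_mem[Yz Nz]; have [] := gN _ (YM _ Yz) Nz.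
have psiy : psi y = u by rewrite /psi /= -phiu gK// phiu; case: Y'y.
have inY : y \in Y' by rewrite inE.
have sym : 'D_b1 ('D_b0 phi) (psi y) = 'D_b0 ('D_b1 phi) (psi y).
  by apply: (vderive_comm b0 b1 oU Cphi); rewrite inE psiy.
have D1 v : {in Y', 'D_v (phi \o psi) =1 'D_v Z} := eq_on_derive v oY' psiZ.
have D2 v w : 'D_w ('D_v (phi \o psi)) y = 'D_w ('D_v Z) y :=
  eq_on_derive w oY' (D1 v) inY.
have dphi : differentiable phi (psi y).
  by rewrite psiy; exact: (Ck_differentiable Cphi).
have dpsi : differentiable psi y by exact: (Ck_differentiable Cpsi).
have E1 v := etrans (esym (D1 v y inY)) (derive_comp2 v dphi dpsi).
have E2 v w := etrans (esym (D2 v w))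
  (derive2_comp2 v w oY' Y'y oU Cphi Cpsi psiU sym).
have [cE DE PE BE] := reparam_invariants (E1 b0) (E1 b1) (E2 b0 b0) (E2 b1 b0) (E2 b1 b1).
rewrite psiy in cE DE PE BE.
rewrite /D /P /B /gram_at /shape_tr_at /shape_det_at DE PE BE cE.
move: kD nE HP KB; rewrite /gram_at /shape_tr_at /shape_det_at.
move: (gram _ _) (cross _ _) (shape_tr _ _ _ _ _) (shape_det _ _ _ _ _) (_ - _).
move=> D0 n0 P0 B0 J kD -> HP KB.
have {HP} -> : P0 = - (k * (l1 + l2) * D0) by rewrite HP opprK.
rewrite -KB -kD; split; first by ring.
  by ring.
by rewrite !scalerA; congr (_ *: _); ring.
Qed.

End MapCurvature.

(** * A chart normalized at a point *)

Section PrincipalChart.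
Context {R : realType}.
Implicit Types (M : set 'rV[R]_3).

Local Notation b0 := (@basis_vec R 0).
Local Notation b1 := (@basis_vec R 1).

Definition quadratic (e a c f g h : R) (y : 'rV[R]_2) : R :=
  e + a * y 0 0 + c * y 0 1 + f / 2 * (y 0 0 * y 0 0) + g * (y 0 0 * y 0 1)
  + h / 2 * (y 0 1 * y 0 1).

(** The quadratics form a family closed under differentiation, so that their
    second derivatives come from a double rewrite. *)
Lemma derive_quadratic e a c f g h v :
  'D_v (quadratic e a c f g h) =
  quadratic (a * v 0 0 + c * v 0 1) (f * v 0 0 + g * v 0 1)
    (g * v 0 0 + h * v 0 1) 0 0 0.
Proof.
apply/funext => y.
have X i : is_derive y v (fun y : 'rV[R]_2 => y 0 i) (v 0 i).
  apply: DeriveDef; first by apply: diff_derivable; exact: differentiable_coord.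
  by rewrite (derive_coord (f := id)) ?derive_id//; exact: ex_diff.
have Z (k : R) (p : 'rV[R]_2 -> R) dp : is_derive y v p dp ->
    is_derive y v (fun y => k * p y) (k * dp) by move=> H; exact: is_deriveZ.
have D (p q : 'rV[R]_2 -> R) dp dq : is_derive y v p dp -> is_derive y v q dq ->
    is_derive y v (fun y => p y + q y) (dp + dq) by move=> H K; exact: is_deriveD.
have P (p q : 'rV[R]_2 -> R) dp dq : is_derive y v p dp -> is_derive y v q dq ->
    is_derive y v (fun y => p y * q y) (p y * dq + q y * dp).
  by move=> H K; exact: is_deriveM.
have H := D _ _ _ _ (D _ _ _ _ (D _ _ _ _ (D _ _ _ _ (D _ _ _ _ (is_derive_cst e y v)
  (Z a _ _ (X 0))) (Z c _ _ (X 1))) (Z (f / 2) _ _ (P _ _ _ _ (X 0) (X 0))))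
  (Z g _ _ (P _ _ _ _ (X 0) (X 1)))) (Z (h / 2) _ _ (P _ _ _ _ (X 1) (X 1))).
apply: (etrans (@derive_val _ _ _ _ _ _ _ H)).
by rewrite /quadratic; field.
Qed.

Lemma derive_quadraticE e a c f g h v y :
  'D_v (quadratic e a c f g h) y =
  quadratic (a * v 0 0 + c * v 0 1) (f * v 0 0 + g * v 0 1)
    (g * v 0 0 + h * v 0 1) 0 0 0 y.
Proof. exact: (congr1 (fun F => F y) (derive_quadratic e a c f g h v)). Qed.

Lemma singular_form (m00 m01 m11 : R) : m00 * m11 = m01 ^+ 2 ->
  exists v0 v1, [/\ (v0 != 0) || (v1 != 0), m00 * v0 + m01 * v1 = 0 &
    m01 * v0 + m11 * v1 = 0].
Proof.
move=> E; have [m0|m0] := boolP ((m01 != 0) || (m00 != 0)).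
  by exists m01, (- m00); rewrite oppr_eq0; split=> //; [ring|rewrite mulrN [m11 * _]mulrC E; ring].
move: m0; rewrite negb_or !negbK => /andP[/eqP m01_0 /eqP m00_0].
by exists 1, 0; rewrite oner_eq0 m01_0 m00_0; split=> //; ring.
Qed.

(** The hypothesis says that [B_ij + l g_ij] is a singular form, and its kernel
    vector [v] is a principal direction.  The vector [w] is [v] turned by a right
    angle in the plane of [p] and [q]; normalizing both gives an orthonormal pair
    that also diagonalizes [B_ij]. *)
Lemma principal_frame (p q : 'rV[R]_3) (B00 B01 B11 l : R) : 0 < gram p q ->
  (B00 + l * dot p p) * (B11 + l * dot q q) = (B01 + l * dot p q) ^+ 2 ->
  exists a0 a1 c0 c1, let p' := a0 *: p + a1 *: q in let q' := c0 *: p + c1 *: q in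
  [/\ dot p' p' = 1, dot q' q' = 1, dot p' q' = 0 &
    a0 * c0 * B00 + (a0 * c1 + a1 * c0) * B01 + a1 * c1 * B11 = 0].
Proof.
move=> D0 /singular_form[v0 [v1 [v_neq0 m0 m1]]].
have gE := gramE p q.
pose v := v0 *: p + v1 *: q.
have dE (x y z w : R) : dot (x *: p + y *: q) (z *: p + w *: q)
   = x * z * dot p p + (x * w + y * z) * dot p q + y * w * dot q q.
  by rewrite !dotE !mxE; ring.
have E0 : 0 < dot v v.
  rewrite lt_neqAle dot_ge0 andbT eq_sym; apply/eqP => /dot_eq0 v00.
  have c0 : cross v q = v0 *: cross p q by apply: eq_row3; rewrite !mxE/=; ring.
  have c1 : cross p v = v1 *: cross p q by apply: eq_row3; rewrite !mxE/=; ring.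
  have z u : cross 0 u = 0 by apply: eq_row3; rewrite !mxE/=; ring.
  have z' u : cross u 0 = 0 by apply: eq_row3; rewrite !mxE/=; ring.
  move: c0 c1; rewrite v00 z z'.
  have n0 : cross p q != 0.
    by apply: contraTneq D0 => n0; rewrite /gram n0 dot0l ltxx.
  move=> /esym/eqP; rewrite scaler_eq0 (negbTE n0) orbF => /eqP v0_0.
  move=> /esym/eqP; rewrite scaler_eq0 (negbTE n0) orbF => /eqP v1_0.
  by move: v_neq0; rewrite v0_0 v1_0 eqxx.
pose w0 := - (dot p q * v0 + dot q q * v1).
pose w1 := dot p p * v0 + dot p q * v1.
pose w := w0 *: p + w1 *: q.
have wE : dot w w = gram p q * dot v v.
  by rewrite /w /v !dE gE /w0 /w1; ring.
have W0 : 0 < dot w w by rewrite wE mulr_gt0.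
pose x := (Num.sqrt (dot v v))^-1; pose y := (Num.sqrt (dot w w))^-1.
have xE : x ^+ 2 * dot v v = 1.
  by rewrite /x exprVn sqr_sqrtr ?ltW// mulVf// gt_eqF.
have yE : y ^+ 2 * dot w w = 1.
  by rewrite /y exprVn sqr_sqrtr ?ltW// mulVf// gt_eqF.
exists (x * v0), (x * v1), (y * w0), (y * w1); split.
- by rewrite -xE /v !dE; ring.
- by rewrite -yE /w !dE; ring.
- by rewrite !dE /w0 /w1; ring.
- have -> : x * v0 * (y * w0) * B00 + (x * v0 * (y * w1) + x * v1 * (y * w0)) * B01
     + x * v1 * (y * w1) * B11 =
    x * y * (w0 * ((B00 + l * dot p p) * v0 + (B01 + l * dot p q) * v1)
      + w1 * ((B01 + l * dot p q) * v0 + (B11 + l * dot q q) * v1)).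
    by rewrite /w0 /w1; ring.
  by rewrite m0 m1; ring.
Qed.

Lemma orthonormal_expand (p q v : 'rV[R]_3) : dot p p = 1 -> dot q q = 1 -> dot p q = 0 ->
  v = dot v p *: p + dot v q *: q + second_coef p q v *: cross p q.
Proof.
move=> pp qq pq.
have g1 : gram p q = 1 by rewrite gramE pp qq pq; ring.
have E : gram p q *: v - second_coef p q v *: cross p q
  = dot v q *: (dot p p *: q - dot p q *: p) - dot v p *: (dot p q *: q - dot q q *: p).
  by rewrite gramE; apply: eq_row3; rewrite /second_coef !dotE !mxE/=; ring.
rewrite g1 pp qq pq !scale1r !scale0r subr0 sub0r scalerN opprK in E.
by rewrite [dot v p *: p + _]addrC -E subrK.
Qed.

Lemma quadratic_smooth e a c f g h k : Ck k setT (quadratic e a c f g h).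
Proof.
have oT : open ([set: 'rV[R]_2]) := openT.
have X i : Ck k setT (fun y : 'rV[R]_2 => y 0 i) by exact: (Ck_coord (f := id) i oT (@Ck_id _ _ _ _)).
have C (b : R) : Ck k setT (cst b : 'rV[R]_2 -> R) by exact: Ck_cst.
have S (b : R) p : Ck k setT p -> Ck k setT (fun y : 'rV[R]_2 => b * p y).
  by move=> Cp; exact: (Ck_mul oT (C b) Cp).
apply: (Ck_add oT); last by apply: S; exact: (Ck_mul oT).
apply: (Ck_add oT); last by apply: S; exact: (Ck_mul oT).
apply: (Ck_add oT); last by apply: S; exact: (Ck_mul oT).
apply: (Ck_add oT); last by apply: S.
exact: (Ck_add oT (C e) (S a _ (X 0))).
Qed.

(** Precompose a parametrization with a quadratic map [psi].  Its linear part
    takes the coordinate vectors to an orthonormal principal frame, and its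
    quadratic part subtracts the tangential part of the second derivatives:
    the Christoffel symbols vanish at the point and the second derivatives become
    normal, with the mixed one zero.  [a] and [b] are the principal curvatures up
    to a common sign, the orientation of the chart being left free. *)
Lemma principal_chart M U phi u nu l1 l2 :
  local_param M U phi -> U u -> dot nu nu = 1 ->
  (forall v, tangent M (phi u) v -> dot nu v = 0) ->
  principal_curvatures M (phi u) nu l1 l2 ->
  exists (zeta : 'rV[R]_2 -> 'rV[R]_3) (Y : set 'rV[R]_2) (a b : R),
  [/\ open Y, Y 0, smooth_open Y zeta, forall z, Y z -> M (zeta z) & zeta 0 = phi u] /\
  let p := 'D_b0 zeta 0 in let q := 'D_b1 zeta 0 in
  [/\ dot p p = 1, dot q q = 1 & dot p q = 0] /\
  [/\ 'D_b0 ('D_b0 zeta) 0 = a *: cross p q, 'D_b0 ('D_b1 zeta) 0 = 0 &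
   'D_b1 ('D_b1 zeta) 0 = b *: cross p q].
Proof.
move=> lp Uu nn tan pc.
have [k [kD nE HP KB]] := param_curvature lp Uu nn tan pc.
have D0 := param_gram_gt0 lp Uu.
have oU : open U by case: lp.
have sphi := local_param_smooth lp.
have Cphi : Ck 2 U phi by exact: (smooth_openP _ _).1 sphi 2%N.
have sym : 'D_b1 ('D_b0 phi) u = 'D_b0 ('D_b1 phi) u.
  by apply: (vderive_comm b0 b1 oU Cphi); rewrite inE.
have [A0 [A1 [A00 [A01 [A11 [[eA0 eA1 eA00 eA01 eA11] [{}kD {}HP {}KB {}D0]]]]]]] :
    exists A0 A1 A00 A01 A11,
    [/\ A0 = 'D_b0 phi u, A1 = 'D_b1 phi u, A00 = 'D_b0 ('D_b0 phi) u,
       A01 = 'D_b0 ('D_b1 phi) u & A11 = 'D_b1 ('D_b1 phi) u] /\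
    [/\ k ^+ 2 = gram A0 A1,
       k * (l1 + l2) * gram A0 A1 = - shape_tr A0 A1 A00 A01 A11,
       l1 * l2 * gram A0 A1 ^+ 2 = shape_det A0 A1 A00 A01 A11 & 0 < gram A0 A1].
  do 5!eexists; split; first by split; reflexivity.
  by split; [exact: kD|exact: HP|exact: KB|exact: D0].
have [|a0 [a1 [c0 [c1 [pp qq pq pr]]]]] := @principal_frame A0 A1 (second_coef A0 A1 A00)
    (second_coef A0 A1 A01) (second_coef A0 A1 A11) (k * l1) D0.
  apply/eqP; rewrite -subr_eq0; apply/eqP.
  transitivity (shape_det A0 A1 A00 A01 A11 + k * l1 * shape_tr A0 A1 A00 A01 A11
     + k ^+ 2 * l1 ^+ 2 * gram A0 A1).
    by rewrite /shape_det /shape_tr gramE; ring.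
  have -> : shape_tr A0 A1 A00 A01 A11 = - (k * (l1 + l2) * gram A0 A1).
    by rewrite HP opprK.
  by rewrite -KB -kD; ring.
set p := a0 *: A0 + a1 *: A1 in pp pq; set q := c0 *: A0 + c1 *: A1 in qq pq.
pose r := (a0 * a0) *: A00 + (a0 * a1 + a1 * a0) *: A01 + (a1 * a1) *: A11.
pose s := (c0 * a0) *: A00 + (c0 * a1 + c1 * a0) *: A01 + (c1 * a1) *: A11.
pose t := (c0 * c0) *: A00 + (c0 * c1 + c1 * c0) *: A01 + (c1 * c1) *: A11.
(* second-order coefficients of [psi]: minus the tangential part of [w], in the
   basis [A0], [A1] *)
pose f0 w := - (dot w p * a0 + dot w q * c0).
pose f1 w := - (dot w p * a1 + dot w q * c1).
pose Q0 := quadratic (u 0 0) a0 c0 (f0 r) (f0 s) (f0 t).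
pose Q1 := quadratic (u 0 1) a1 c1 (f1 r) (f1 s) (f1 t).
pose psi y : 'rV[R]_2 := \row_i (if i == 0 then Q0 y else Q1 y).
have psi0 : (fun y => psi y 0 0) = Q0 by apply/funext => y; rewrite mxE.
have psi1 : (fun y => psi y 0 1) = Q1 by apply/funext => y; rewrite mxE.
have Cpsi n : Ck n setT psi.
  apply: (Ck_coords openT) => i.
  have [->|i0] := eqVneq i 0; first by rewrite psi0; exact: quadratic_smooth.
  rewrite (_ : (fun y => psi y 0 i) = Q1); first exact: quadratic_smooth.
  by apply/funext => y; rewrite mxE (negbTE i0).
have dpsi y : differentiable psi y by exact: (Ck_differentiable (Cpsi 0%N)).
have psi_0 : psi 0 = u.
  rewrite (rV2_basis u) (rV2_basis (psi 0)) -[psi 0 0 0]/((fun y => psi y 0 0) 0) psi0.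
  rewrite -[psi 0 0 1]/((fun y => psi y 0 1) 0) psi1 /Q0 /Q1 /quadratic !mxE.
  by congr (_ *: _ + _ *: _); ring.
pose Y := psi @^-1` U.
have oY : open Y.
  by apply: open_comp oU => y _; apply: differentiable_continuous; exact: dpsi.
have Y0 : Y 0 by rewrite /Y /= psi_0.
have CY n : Ck n Y psi by exact: (Ck_sub (@subsetT _ _) (Cpsi n)).
exists (phi \o psi), Y, (second_coef p q r), (second_coef p q t).
have szeta : smooth_open Y (phi \o psi).
  apply/smooth_openP => n; apply: (Ck_coords oY) => i.
  have Cphin : Ck n U phi by exact: (smooth_openP _ _).1 sphi n.
  apply: (Ck_comp (f := fun v => phi v 0 i) (rV_coordinates 2) oY (Ck_coord i oU Cphin)).
    by move=> j; exact: (Ck_coord j oY (CY n)).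
  by [].
split.
  split; [exact: oY|exact: Y0|exact: szeta| |exact: (congr1 phi psi_0)].
  by move=> z Yz; exact: (local_param_in lp Yz).
have dphi : differentiable phi (psi 0) by rewrite psi_0; exact: (Ck_differentiable Cphi).
have sym' : 'D_b1 ('D_b0 phi) (psi 0) = 'D_b0 ('D_b1 phi) (psi 0) by rewrite psi_0.
have E1 v := derive_comp2 v dphi (dpsi 0).
have E2 v w := derive2_comp2 v w oY Y0 oU Cphi (CY 2%N) (fun z Yz => Yz) sym'.
have d0 v : 'D_v (fun z => psi z 0 0) 0 = a0 * v 0 0 + c0 * v 0 1.
  by rewrite psi0 derive_quadraticE /quadratic !mxE; ring.
have d1 v : 'D_v (fun z => psi z 0 1) 0 = a1 * v 0 0 + c1 * v 0 1.
  by rewrite psi1 derive_quadraticE /quadratic !mxE; ring.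
have dd0 v w : 'D_w ('D_v (fun z => psi z 0 0)) 0 = f0 r * v 0 0 * w 0 0
    + f0 s * (v 0 0 * w 0 1 + v 0 1 * w 0 0) + f0 t * v 0 1 * w 0 1.
  by rewrite psi0 derive_quadratic derive_quadraticE /quadratic !mxE; ring.
have dd1 v w : 'D_w ('D_v (fun z => psi z 0 1)) 0 = f1 r * v 0 0 * w 0 0
    + f1 s * (v 0 0 * w 0 1 + v 0 1 * w 0 0) + f1 t * v 0 1 * w 0 1.
  by rewrite psi1 derive_quadratic derive_quadraticE /quadratic !mxE; ring.
have eA0' : 'D_b0 phi (psi 0) = A0 := etrans (congr1 ('D_b0 phi) psi_0) (esym eA0).
have eA1' : 'D_b1 phi (psi 0) = A1 := etrans (congr1 ('D_b1 phi) psi_0) (esym eA1).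
have eA00' : 'D_b0 ('D_b0 phi) (psi 0) = A00 := etrans (congr1 ('D_b0 ('D_b0 phi)) psi_0) (esym eA00).
have eA01' : 'D_b0 ('D_b1 phi) (psi 0) = A01 := etrans (congr1 ('D_b0 ('D_b1 phi)) psi_0) (esym eA01).
have eA11' : 'D_b1 ('D_b1 phi) (psi 0) = A11 := etrans (congr1 ('D_b1 ('D_b1 phi)) psi_0) (esym eA11).
have E1' v := etrans (E1 v) (congr2 +%R (congr2 *:%R (d0 v) eA0') (congr2 *:%R (d1 v) eA1')).
have E2' v w := etrans (E2 v w) (congr2 +%R (congr2 +%R (congr2 +%R (congr2 +%R
  (congr2 *:%R (dd0 v w) eA0') (congr2 *:%R (dd1 v w) eA1'))
  (congr2 *:%R (congr2 *%R (d0 v) (d0 w)) eA00'))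
  (congr2 *:%R (congr2 +%R (congr2 *%R (d0 v) (d1 w)) (congr2 *%R (d1 v) (d0 w))) eA01'))
  (congr2 *:%R (congr2 *%R (d1 v) (d1 w)) eA11')).
have cut w : f0 w *: A0 + f1 w *: A1 + w = second_coef p q w *: cross p q.
  rewrite {3}(orthonormal_expand w pp qq pq) /f0 /f1 /p /q.
  by apply/rowP => i; rewrite !mxE; ring.
have s0 : second_coef p q s = 0.
  rewrite -[RHS](mulr0 (a0 * c1 - a1 * c0)) -pr /second_coef /s /p /q.
  by rewrite !dotE !mxE/=; ring.
have [e00 e01 e10 e11] : [/\ b0 0 0 = 1, b0 0 1 = 0, b1 0 0 = 0 & b1 0 1 = 1].
  by split; rewrite mxE.
have Ep : 'D_b0 (phi \o psi) 0 = p.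
  by apply: (etrans (E1' b0)); rewrite e00 e01 /p !(mulr1, mulr0, addr0).
have Eq : 'D_b1 (phi \o psi) 0 = q.
  by apply: (etrans (E1' b1)); rewrite e10 e11 /q !(mulr1, mulr0, add0r).
have Er : 'D_b0 ('D_b0 (phi \o psi)) 0 = second_coef p q r *: cross p q.
  apply: (etrans (E2' b0 b0)); rewrite e00 e01 -cut /r.
  by clear; apply/rowP => i; rewrite !mxE; ring.
have Es : 'D_b0 ('D_b1 (phi \o psi)) 0 = 0.
  apply: (etrans (E2' b1 b0)); rewrite e00 e01 e10 e11.
  have cs : second_coef p q s *: cross p q = 0 by rewrite s0 scale0r.
  rewrite -[RHS]cs -cut; move: (f0 s) (f1 s) (f0 r) (f0 t) (f1 r) (f1 t) => *; rewrite /s.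
  by clear; apply/rowP => i; rewrite !mxE; ring.
have Et : 'D_b1 ('D_b1 (phi \o psi)) 0 = second_coef p q t *: cross p q.
  apply: (etrans (E2' b1 b1)); rewrite e10 e11 -cut /t.
  by clear; apply/rowP => i; rewrite !mxE; ring.
split.
  split; [exact: (etrans (congr2 _ Ep Ep) pp)|exact: (etrans (congr2 _ Eq Eq) qq)|].
  exact: (etrans (congr2 _ Ep Eq) pq).
have En := congr2 cross Ep Eq.
split; first exact: (etrans Er (congr1 _ (esym En))).
  exact: Es.
exact: (etrans Et (congr1 _ (esym En))).
Qed.

End PrincipalChart.

(** * Space-time: coordinates, slices and regularity of the invariants *)

Section SpaceTime.
Context {R : realType}.

(** Coordinates of (point, time), the time being the [unit] index. *)
Definition pair_coord n (k : 'I_n + unit) (w : 'rV[R]_n * R^o) : R :=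
  match k with inl i => w.1 0 i | inr _ => w.2 end.

Lemma pair_coord_is_linear n (k : 'I_n + unit) : linear (pair_coord k).
Proof. by case: k => [i|[]] a u v //=; rewrite !mxE. Qed.

HB.instance Definition _ n (k : 'I_n + unit) :=
  GRing.isLinear.Build R ('rV[R]_n * R^o)%type R _ (@pair_coord n k)
    (@pair_coord_is_linear n k).

Lemma pair_coord_continuous n (k : 'I_n + unit) : continuous (@pair_coord n k).
Proof.
case: k => [i|[]] w /=; last exact: cvg_snd.
apply: (@continuous_comp _ _ _ fst (fun u : 'rV[R]_n => u 0 i)); first exact: cvg_fst.
exact: coord_continuous.
Qed.

Definition pair_base n (k : 'I_n + unit) : 'rV[R]_n * R^o :=
  match k with inl i => (delta_mx 0 i, 0) | inr _ => (0, 1) end.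

Lemma pair_coordinates n :
  coordinates (@pair_base n) (fun k : 'I_n + unit => @pair_coord n k).
Proof.
split=> [k|[u t]]; first exact: pair_coord_continuous.
rewrite big_sumType/= (big_pred1 tt) => [|[]//].
have -> : \sum_(i < n) pair_coord (inl i) (u, t : R^o) *: @pair_base n (inl i) = (u, 0).
  rewrite {2}(row_sum_delta u).
  elim/big_ind2 : _ => //[x a y c -> ->|i _].
    by congr pair; rewrite /= addr0.
  by congr pair; rewrite /= scaler0.
congr pair; first by rewrite /= scaler0 addr0.
by rewrite /= add0r [_ *: _]mulr1.
Qed.

Lemma Ck_linear_map (V W : normedModType R) k (A : set V) (l : {linear V -> W}) :
  open A -> continuous l -> Ck k A l.
Proof. by move=> oA cl; apply: (Ck_linear (f := id) oA cl); exact: Ck_id. Qed.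

Lemma Ck_pair_comp (n m k : nat) (A : set ('rV[R]_2 * R^o)) (Y : set 'rV[R]_2)
    (O : set ('rV[R]_n * R^o)) (F : 'rV[R]_n * R^o -> 'rV[R]_m)
    (sigma : 'rV[R]_2 -> 'rV[R]_n) :
  open A -> open Y -> open O -> Ck k O F -> Ck k Y sigma ->
  (forall z, A z -> Y z.1 /\ O (sigma z.1, z.2)) ->
  Ck k A (fun z => F (sigma z.1, z.2)).
Proof.
move=> oA oY oO CF Cs AYO; apply: (Ck_coords oA) => i.
pose h (z : 'rV[R]_2 * R^o) : 'rV[R]_n * R^o := (sigma z.1, z.2).
apply: (Ck_comp (f := fun w => F w 0 i) (g := h) (pair_coordinates n) oA
  (Ck_coord i oO CF)) => [[j|[]]|z Az]; last by case: (AYO z Az).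
- apply: (Ck_comp (f := fun v => sigma v 0 j) (g := fst) (rV_coordinates 2) oA
    (Ck_coord j oY Cs)) => [a|z Az]; last by case: (AYO z Az).
  have fst_smooth : Ck k A (fun z : 'rV[R]_2 * R^o => z.1 0 a : R) :=
    Ck_linear_map (l := @pair_coord 2 (inl a)) oA (@pair_coord_continuous 2 (inl a)).
  exact: fst_smooth.
- have snd_smooth : Ck k A (fun z : 'rV[R]_2 * R^o => z.2 : R) :=
    Ck_linear_map (l := @pair_coord 2 (inr tt)) oA (@pair_coord_continuous 2 (inr tt)).
  exact: snd_smooth.
Qed.

Lemma derive_slice (W : normedModType R) (f : 'rV[R]_2 * R^o -> W) v y t :
  'D_(v, 0) f (y, t) = 'D_v (fun y => f (y, t)) y.
Proof.
have E (h : R) : h *: ((v, 0) : 'rV[R]_2 * R^o) + (y, t) = (h *: v + y, t).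
  by congr pair; rewrite /= scaler0 add0r.
pose q (h : R) := h^-1 *: (f (h *: v + y, t) - f (y, t)).
have Eq : (fun h : R => h^-1 *: ((f \o shift ((y, t) : 'rV[R]_2 * R^o))
    (h *: ((v, 0) : 'rV[R]_2 * R^o)) - f (y, t))) = q.
  by apply/funext => h; rewrite /q -E.
exact: (congr1 (fun F : R -> W => lim (F h @[h --> 0^'])) Eq).
Qed.

Lemma derive_slice_fun (W : normedModType R) (f : 'rV[R]_2 * R^o -> W) v t :
  (fun y => 'D_(v, 0) f (y, t)) = 'D_v (fun y => f (y, t)).
Proof. by apply/funext => y; exact: derive_slice. Qed.

Lemma Ck_slice m k (A : set ('rV[R]_2 * R^o))
    (Z : 'rV[R]_2 * R^o -> 'rV[R]_m) t : open A -> Ck k A Z ->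
  open [set y | A (y, t)] /\ Ck k [set y | A (y, t)] (fun y => Z (y, t)).
Proof.
move=> oA CZ; have oS : open [set y | A (y, t)].
  apply: (@open_comp _ _ (fun y : 'rV[R]_2 => (y, t) : 'rV[R]_2 * R^o)) => // y _.
  apply: differentiable_continuous; apply: (differentiable_pair (f := id)).
    exact: ex_diff.
  exact: differentiable_cst.
split=> //; apply: (Ck_coords oS) => i.
apply: (Ck_comp (f := fun w => Z w 0 i) (g := fun y => (y, t : R^o))
  (pair_coordinates 2) oS (Ck_coord i oA CZ)) => [[j|[]]|//].
- exact: (Ck_coord (f := id) j oS (@Ck_id _ _ _ _)).
- exact: Ck_cst.
Qed.

Local Notation b0 := (@basis_vec R 0).
Local Notation b1 := (@basis_vec R 1).
Local Notation e1 := ((b0, 0) : 'rV[R]_2 * R^o).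
Local Notation e2 := ((b1, 0) : 'rV[R]_2 * R^o).

Lemma derive2_slice (W : normedModType R) (f : 'rV[R]_2 * R^o -> W) v w y t :
  'D_(w, 0) ('D_(v, 0) f) (y, t) = 'D_w ('D_v (fun y => f (y, t))) y.
Proof.
apply: (etrans (derive_slice _ _ _ _)).
exact: (congr1 (fun g => 'D_w g y) (derive_slice_fun _ _ _)).
Qed.

Lemma gram_slice (Z : 'rV[R]_2 * R^o -> 'rV[R]_3) y t :
  gram_at e1 e2 Z (y, t) = gram_at b0 b1 (fun y => Z (y, t)) y.
Proof. exact: (congr2 gram (derive_slice _ _ _ _) (derive_slice _ _ _ _)). Qed.

Lemma cross_slice (Z : 'rV[R]_2 * R^o -> 'rV[R]_3) y t :
  cross ('D_e1 Z (y, t)) ('D_e2 Z (y, t)) =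
  cross ('D_b0 (fun y => Z (y, t)) y) ('D_b1 (fun y => Z (y, t)) y).
Proof. exact: (congr2 cross (derive_slice _ _ _ _) (derive_slice _ _ _ _)). Qed.

Lemma congr5 (A B : Type) (f : A -> A -> A -> A -> A -> B) a a' b b' c c' d d' e e' :
  a = a' -> b = b' -> c = c' -> d = d' -> e = e' -> f a b c d e = f a' b' c' d' e'.
Proof. by do 5!move=> ->. Qed.

Lemma shape_tr_slice (Z : 'rV[R]_2 * R^o -> 'rV[R]_3) y t :
  shape_tr_at e1 e2 Z (y, t) = shape_tr_at b0 b1 (fun y => Z (y, t)) y.
Proof.
exact: (congr5 shape_tr (derive_slice _ _ _ _) (derive_slice _ _ _ _)
  (derive2_slice _ _ _ _ _) (derive2_slice _ _ _ _ _) (derive2_slice _ _ _ _ _)).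
Qed.

Lemma shape_det_slice (Z : 'rV[R]_2 * R^o -> 'rV[R]_3) y t :
  shape_det_at e1 e2 Z (y, t) = shape_det_at b0 b1 (fun y => Z (y, t)) y.
Proof.
exact: (congr5 shape_det (derive_slice _ _ _ _) (derive_slice _ _ _ _)
  (derive2_slice _ _ _ _ _) (derive2_slice _ _ _ _ _) (derive2_slice _ _ _ _ _)).
Qed.

End SpaceTime.

Section Invariants.
Context {R : realType} {V : normedModType R}.
Implicit Types (A : set V) (p q r s t : V -> 'rV[R]_3).

Lemma Ck_sub_fun k A (f g : V -> R) : open A -> Ck k A f -> Ck k A g ->
  Ck k A (fun z => f z - g z).
Proof.
move=> oA Cf Cg; have C1 := Ck_mul oA (@Ck_cst _ _ _ k A (-1 : R)) Cg.
rewrite (_ : (fun z => _) = fun z => f z + (-1) * g z); first exact: Ck_add.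
by apply/funext => z; rewrite mulN1r.
Qed.

Lemma Ck_scale_fun k A (c : R) (f : V -> R) : open A -> Ck k A f ->
  Ck k A (fun z => c * f z).
Proof. by move=> oA; exact: (Ck_mul oA (@Ck_cst _ _ _ k A c)). Qed.

Lemma Ck_exp k A (f : V -> R) n : open A -> Ck k A f -> Ck k A (fun z => f z ^+ n).
Proof.
move=> oA Cf; elim: n => [|n IH].
  by rewrite (_ : (fun z => _) = cst 1); [exact: Ck_cst|apply/funext => z; rewrite expr0].
by under eq_fun do rewrite exprS; exact: Ck_mul.
Qed.

Lemma Ck_dot k A p q : open A -> Ck k A p -> Ck k A q ->
  Ck k A (fun z => dot (p z) (q z)).
Proof.
move=> oA Cp Cq; under eq_fun do rewrite dotE.
have c i := Ck_mul oA (Ck_coord i oA Cp) (Ck_coord i oA Cq).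
exact: (Ck_add oA (Ck_add oA (c 0) (c 1)) (c 2)).
Qed.

Lemma Ck_cross k A p q : open A -> Ck k A p -> Ck k A q ->
  Ck k A (fun z => cross (p z) (q z)).
Proof.
move=> oA Cp Cq; apply: (Ck_coords oA).
have c i j := Ck_sub_fun oA (Ck_mul oA (Ck_coord i oA Cp) (Ck_coord j oA Cq))
  (Ck_mul oA (Ck_coord j oA Cp) (Ck_coord i oA Cq)).
by apply: forall_I3; under eq_fun do rewrite row3E; exact: c.
Qed.

Lemma Ck_gram k A p q : open A -> Ck k A p -> Ck k A q ->
  Ck k A (fun z => gram (p z) (q z)).
Proof.
by move=> oA Cp Cq; have C := Ck_cross oA Cp Cq; exact: (Ck_dot oA C C).
Qed.

Lemma Ck_shape_tr k A p q r s t : open A -> Ck k A p -> Ck k A q -> Ck k A r ->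
  Ck k A s -> Ck k A t -> Ck k A (fun z => shape_tr (p z) (q z) (r z) (s z) (t z)).
Proof.
move=> oA Cp Cq Cr Cs Ct; have C := Ck_cross oA Cp Cq.
have sc w Cw := @Ck_dot k A w _ oA Cw C.
exact: (Ck_add oA (Ck_sub_fun oA (Ck_mul oA (Ck_dot oA Cp Cp) (sc _ Ct))
  (Ck_mul oA (Ck_scale_fun 2 oA (Ck_dot oA Cp Cq)) (sc _ Cs)))
  (Ck_mul oA (Ck_dot oA Cq Cq) (sc _ Cr))).
Qed.

Lemma Ck_shape_det k A p q r s t : open A -> Ck k A p -> Ck k A q -> Ck k A r ->
  Ck k A s -> Ck k A t -> Ck k A (fun z => shape_det (p z) (q z) (r z) (s z) (t z)).
Proof.
move=> oA Cp Cq Cr Cs Ct; have C := Ck_cross oA Cp Cq.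
have sc w Cw := @Ck_dot k A w _ oA Cw C.
exact: (Ck_sub_fun oA (Ck_mul oA (sc _ Cr) (sc _ Ct)) (Ck_exp 2 oA (sc _ Cs))).
Qed.

Lemma Ck_at k A (e1 e2 : V) Z : open A -> Ck k.+2 A Z ->
  [/\ Ck k A (gram_at e1 e2 Z), Ck k A (shape_tr_at e1 e2 Z) &
      Ck k A (shape_det_at e1 e2 Z)].
Proof.
move=> oA CZ.
have C1 v : Ck k A ('D_v Z) := Ck_le (leqnSn _) (Ck_derive v CZ).
have C2 v w : Ck k A ('D_v ('D_w Z)) := Ck_derive v (Ck_derive w CZ).
split; first exact: (Ck_gram oA (C1 _) (C1 _)).
  exact: (Ck_shape_tr oA (C1 _) (C1 _) (C2 _ _) (C2 _ _) (C2 _ _)).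
exact: (Ck_shape_det oA (C1 _) (C1 _) (C2 _ _) (C2 _ _) (C2 _ _)).
Qed.

Lemma Ck_wden k A (B D : V -> R) : open A -> Ck k A B -> Ck k A D ->
  Ck k A (fun z => wden (B z) (D z)).
Proof.
by move=> oA CB CD; exact: (Ck_mul oA (Ck_scale_fun 2 oA CB) (Ck_exp 4 oA CD)).
Qed.

Lemma Ck_wnum k A (P B D : V -> R) : open A -> Ck k A P -> Ck k A B -> Ck k A D ->
  Ck k A (fun z => wnum (P z) (B z) (D z)).
Proof.
move=> oA CP CB CD; have CP2 := Ck_exp 2 oA CP.
exact: (Ck_mul oA CP2 (Ck_sub_fun oA CP2 (Ck_mul oA (Ck_scale_fun 4 oA CB) CD))).
Qed.

Lemma Ck_defect k A (e1 e2 : V) Z c N0 : open A -> Ck k.+2 A Z ->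
  Ck k A (defect_at e1 e2 Z c N0).
Proof.
move=> oA CZ; have [CD CP CB] := Ck_at e1 e2 oA CZ.
exact: (Ck_sub_fun oA (Ck_scale_fun c oA (Ck_wnum oA CP CB CD))
  (Ck_scale_fun N0 oA (Ck_wden oA CB CD))).
Qed.

End Invariants.

(** * Turning a frame into the standard basis *)

Section Frame.
Context {R : realType}.
Implicit Types (u v w p q : 'rV[R]_3).

(** For orthonormal [E1], [E2] this is the rotation of space taking [E1], [E2] to
    the first two unit vectors.  The jet computations are made after applying it;
    all invariants are unchanged. *)
Definition frame (E1 E2 v : 'rV[R]_3) : 'rV[R]_3 :=
  row3 (dot v E1) (dot v E2) (dot v (cross E1 E2)).

Lemma frame_is_linear E1 E2 : linear (frame E1 E2).
Proof.
move=> a u v; apply: eq_row3; rewrite !(mxE, row3E)/= !dotE !mxE; ring.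
Qed.

HB.instance Definition _ E1 E2 :=
  GRing.isLinear.Build R 'rV[R]_3 'rV[R]_3 _ (frame E1 E2) (frame_is_linear E1 E2).

Lemma frame_continuous E1 E2 : continuous (frame E1 E2).
Proof.
move=> v; have oT : open ([set: 'rV[R]_3]) := openT.
have C E : Ck 0 setT (fun v => dot v E).
  exact: (Ck_dot oT (@Ck_id _ _ _ _) (@Ck_cst _ _ _ 0%N setT E)).
have C3 : Ck 0 setT (frame E1 E2).
  by apply: (Ck_coords oT); apply: forall_I3; under eq_fun do rewrite row3E; exact: C.
exact: (differentiable_continuous (Ck_differentiable C3 I)).
Qed.

Lemma derive_frame (V : normedModType R) E1 E2 (f : V -> 'rV[R]_3) (x v : V) :
  differentiable f x -> 'D_v (frame E1 E2 \o f) x = frame E1 E2 ('D_v f x).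
Proof. by move=> df; exact: (derive_linear v (@frame_continuous E1 E2) df). Qed.

Section Orthonormal.
Context (E1 E2 : 'rV[R]_3).
Context (E11 : dot E1 E1 = 1) (E22 : dot E2 E2 = 1) (E12 : dot E1 E2 = 0).

Lemma dot_frame u v : dot (frame E1 E2 u) (frame E1 E2 v) = dot u v.
Proof.
rewrite [in RHS](orthonormal_expand v E11 E22 E12) dotE !row3E.
by rewrite /second_coef [RHS]dotC !dotDl !dotZl ![dot _ u]dotC; ring.
Qed.

Lemma cross_frame u v : cross (frame E1 E2 u) (frame E1 E2 v) = frame E1 E2 (cross u v).
Proof.
have eE1 : E1 = cross E2 (cross E1 E2).
  transitivity (dot E2 E2 *: E1 - dot E1 E2 *: E2).
    by rewrite E22 E12 scale1r scale0r subr0.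
  by apply: eq_row3; rewrite !dotE !mxE/=; ring.
have eE2 : E2 = cross (cross E1 E2) E1.
  transitivity (dot E1 E1 *: E2 - dot E1 E2 *: E1).
    by rewrite E11 E12 scale1r scale0r subr0.
  by apply: eq_row3; rewrite !dotE !mxE/=; ring.
have lagrange a b : dot u a * dot v b - dot u b * dot v a = dot (cross u v) (cross a b).
  by rewrite !dotE !row3E; ring.
apply: eq_row3; rewrite !row3E lagrange //.
- by rewrite -eE1.
- by rewrite -eE2.
Qed.

Lemma second_coef_frame p q v :
  second_coef (frame E1 E2 p) (frame E1 E2 q) (frame E1 E2 v) = second_coef p q v.
Proof. by rewrite /second_coef cross_frame dot_frame. Qed.

Lemma gram_frame p q : gram (frame E1 E2 p) (frame E1 E2 q) = gram p q.
Proof. by rewrite /gram cross_frame dot_frame. Qed.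

Lemma shape_tr_frame p q u v w :
  shape_tr (frame E1 E2 p) (frame E1 E2 q) (frame E1 E2 u) (frame E1 E2 v) (frame E1 E2 w)
  = shape_tr p q u v w.
Proof. by rewrite /shape_tr !second_coef_frame !dot_frame. Qed.

Lemma shape_det_frame p q u v w :
  shape_det (frame E1 E2 p) (frame E1 E2 q) (frame E1 E2 u) (frame E1 E2 v) (frame E1 E2 w)
  = shape_det p q u v w.
Proof. by rewrite /shape_det !second_coef_frame. Qed.

End Orthonormal.

Section FrameMap.
Context {V : normedModType R} (E1 E2 : 'rV[R]_3) (Z : V -> 'rV[R]_3) (A : set V).
Context (E11 : dot E1 E1 = 1) (E22 : dot E2 E2 = 1) (E12 : dot E1 E2 = 0).
Context (oA : open A) (CZ : Ck 2 A Z).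

Lemma derive_frame_on (v : V) : {in A, 'D_v (frame E1 E2 \o Z) =1 frame E1 E2 \o 'D_v Z}.
Proof. by move=> x /set_mem Ax; exact: (derive_frame _ _ _ (Ck_differentiable CZ Ax)). Qed.

Lemma derive2_frame_on (v w : V) :
  {in A, 'D_w ('D_v (frame E1 E2 \o Z)) =1 frame E1 E2 \o 'D_w ('D_v Z)}.
Proof.
move=> x xA; apply: (etrans (eq_on_derive w oA (derive_frame_on v) xA)).
exact: (derive_frame _ _ _ (Ck_differentiable (Ck_derive v CZ) (set_mem xA))).
Qed.

Lemma gram_at_frame (e1 e2 : V) : {in A, gram_at e1 e2 (frame E1 E2 \o Z) =1 gram_at e1 e2 Z}.
Proof.
move=> x xA; apply: etrans (gram_frame E11 E22 E12 _ _).
exact: (congr2 gram (derive_frame_on e1 xA) (derive_frame_on e2 xA)).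
Qed.

Lemma shape_tr_at_frame (e1 e2 : V) :
  {in A, shape_tr_at e1 e2 (frame E1 E2 \o Z) =1 shape_tr_at e1 e2 Z}.
Proof.
move=> x xA; apply: etrans (shape_tr_frame E11 E22 E12 _ _ _ _ _).
exact: (congr5 shape_tr (derive_frame_on e1 xA) (derive_frame_on e2 xA)
  (derive2_frame_on e1 e1 xA) (derive2_frame_on e2 e1 xA) (derive2_frame_on e2 e2 xA)).
Qed.

Lemma shape_det_at_frame (e1 e2 : V) :
  {in A, shape_det_at e1 e2 (frame E1 E2 \o Z) =1 shape_det_at e1 e2 Z}.
Proof.
move=> x xA; apply: etrans (shape_det_frame E11 E22 E12 _ _ _ _ _).
exact: (congr5 shape_det (derive_frame_on e1 xA) (derive_frame_on e2 xA)
  (derive2_frame_on e1 e1 xA) (derive2_frame_on e2 e1 xA) (derive2_frame_on e2 e2 xA)).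
Qed.

End FrameMap.
End Frame.

(** * Charts of the moving surface *)

Section FlowChart.
Context {R : realType}.

(** The flow is stated with a one-dimensional limit inside the time interval; at
    an interior time it is the partial derivative of the chart. *)
Lemma derive_time (Z : 'rV[R]_2 * R^o -> 'rV[R]_3) (A : set ('rV[R]_2 * R^o)) y (t T : R)
    (x : R -> 'rV[R]_3) v :
  open A -> A (y, t) -> 0 < t < T ->
  (forall s : R, A (y, s) -> 0 <= s < T -> Z (y, s) = x s) ->
  (s - t)^-1 *: (x s - x t) @[s --> within [set s | 0 <= s < T] t^'] --> v ->
  'D_(0, 1) Z (y, t) = v.
Proof.
move=> oA Ayt /andP[t0 tT] Zx xv; apply: cvg_lim => //.
have E (h : R) : h *: ((0, 1) : 'rV[R]_2 * R^o) + (y, t) = (y, h + t).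
  by congr pair; rewrite /= ?scaler0 ?add0r// /GRing.scale/= mulr1.
have Zt : Z (y, t) = x t by apply: Zx => //; rewrite ltW.
have nA : \forall h \near (0 : R), A (y, h + t).
  have L : (s *: ((0, 1) : 'rV[R]_2 * R^o) + (y, t)) @[s --> (0 : R)] --> ((y, t) : 'rV[R]_2 * R^o).
    exact: line_cvg.
  have : \forall h \near (0 : R), A (h *: ((0, 1) : 'rV[R]_2 * R^o) + (y, t)).
    by apply: L; exact: open_nbhs_nbhs.
  by apply: filterS => h; rewrite E.
have nT : \forall h \near (0 : R), 0 <= h + t < T.
  pose d := Num.min t (T - t).
  have d0 : 0 < d by rewrite lt_min t0 subr_gt0.
  apply/nbhs_ballP; exists d => // h; rewrite /ball/= sub0r normrN lt_min => /andP[h1 h2].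
  move: h1 h2; rewrite !ltr_norml => /andP[h1 _] /andP[_ h2]; apply/andP; split; lra.
move=> P /xv.
rewrite /within/= => /nbhs_ballP[e /= e0 He].
have nE : \forall h \near (0 : R), `|h| < e.
  apply/nbhs_ballP; exists e => // h; rewrite /ball/= sub0r normrN //.
have : \forall h \near (0 : R), h != 0 ->
   P (h^-1 *: ((Z \o shift ((y, t) : 'rV[R]_2 * R^o)) (h *: ((0, 1) : 'rV[R]_2 * R^o))
      - Z (y, t))).
  move: nA nT nE; apply: filterS3 => h Ah hT he h0.
  rewrite /= E (Zx _ Ah hT) Zt.
  have := He (h + t); rewrite /ball/= opprD addrCA subrr addr0 normrN => /(_ he).
  have ht : h + t != t by rewrite -subr_eq0 addrK.
  by move=> /(_ ht hT); rewrite addrK.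
by [].
Qed.

(** With [F] a smooth local extension of [(x, t) |-> X t x] and [g] one of the
    inverse of [X t0], the map [Z (y, t) = F (g (zeta y), t)] is smooth on an open
    set and follows the flow above the chart [zeta] of the surface at time [t0]. *)
Lemma flow_chart n (T : R) (M : R -> set 'rV[R]_3) (S : set 'rV[R]_n)
    (X : R -> 'rV[R]_n -> 'rV[R]_3) (t0 : R)
    (zeta : 'rV[R]_2 -> 'rV[R]_3) (Y : set 'rV[R]_2) y0 :
  diffeo S (M t0) (X t0) ->
  smooth_on (S `*` [set t : R^o | 0 <= t < T])
    (fun z : 'rV[R]_n * R^o => X z.2 z.1) ->
  0 <= t0 < T -> open Y -> smooth_open Y zeta -> (forall y, Y y -> M t0 (zeta y)) ->
  Y y0 ->
  exists (A : set ('rV[R]_2 * R^o)) (Z : 'rV[R]_2 * R^o -> 'rV[R]_3)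
     (sigma : 'rV[R]_2 -> 'rV[R]_n),
  [/\ open A, A (y0, t0), forall k, Ck k A Z & forall y (t : R), A (y, t) ->
    [/\ Y y, S (sigma y), X t0 (sigma y) = zeta y & 0 <= t < T -> Z (y, t) = X t (sigma y)]].
Proof.
move=> hX hs t0T oY sz YM Yy0.
have [N [g [oN Ny0 sg gN gK]]] := diffeo_inverse hX (YM _ Yy0).
pose Y' := Y `&` zeta @^-1` N.
have oY' : open Y'.
  rewrite openE => z [Yz Nz]; apply: filterI; first exact: open_nbhs_nbhs.
  by apply: (smooth_open_continuous sz Yz); exact: open_nbhs_nbhs.
pose sigma := g \o zeta.
have Cs k : Ck k Y' sigma.
  have Cg : Ck k N g := (smooth_openP _ _).1 sg k.
  have Cz : Ck k Y' zeta by apply: (Ck_sub _ ((smooth_openP _ _).1 sz k)) => z [].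
  apply: (Ck_coords oY') => i.
  apply: (Ck_comp (f := fun v => g v 0 i) (rV_coordinates 3) oY' (Ck_coord i oN Cg)).
    by move=> j; exact: (Ck_coord j oY' Cz).
  by move=> z [].
have Y'S y : Y' y -> S (sigma y) /\ X t0 (sigma y) = zeta y.
  by move=> [Yy Ny]; exact: gN (YM _ Yy) Ny.
have Y'y0 : Y' y0 by split.
have [Sx0 _] := Y'S _ Y'y0.
have [N1 [F [oN1 N1x FN eF]]] := hs (sigma y0, t0) (conj Sx0 t0T).
pose h (z : 'rV[R]_2 * R^o) : 'rV[R]_n * R^o := (sigma z.1, z.2).
pose A := [set z : 'rV[R]_2 * R^o | Y' z.1] `&` h @^-1` N1.
have ch z : Y' z.1 -> {for z, continuous h}.
  move=> Yz; apply: differentiable_continuous; apply: differentiable_pair.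
    apply: (@differentiable_comp _ _ _ _ fst sigma).
      by apply: (@linear_differentiable _ _ _ fst) => ?; exact: cvg_fst.
    exact: (Ck_differentiable (Cs 0%N)).
  by apply: (@linear_differentiable _ _ _ snd) => ?; exact: cvg_snd.
have oA : open A.
  rewrite openE => z [Yz Nz]; apply: filterI.
    have cf : continuous (fst : 'rV[R]_2 * R^o -> 'rV[R]_2) by move=> ?; exact: cvg_fst.
    by apply: (cf z); exact: open_nbhs_nbhs.
  by apply: (ch z Yz); exact: open_nbhs_nbhs.
exists A, (F \o h), sigma; split => //.
- move=> k; apply: (Ck_pair_comp oA oY' oN1 ((smooth_openP _ _).1 FN k) (Cs k)) => z [Yz Nz].
  by split.
- move=> y t [/= Y'y Nyt]; have [Sy Xy] := Y'S y Y'y.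
  split=> //; first by case: Y'y.
  move=> tT; apply: eF; rewrite inE; split=> //.
Qed.

End FlowChart.

(** * The maximum of the pinching quotient *)

(** The comparison [w - e r <= N0 / k - e t0] at time [r], cleared of
    denominators; [q >= 0] is the common factor of [wnum] and [wden]. *)
Lemma defect_of_quotient (R : realFieldType) (c d q k N0 e r t0 : R) :
  0 < c -> 0 < d -> 0 <= q -> 0 < k ->
  (c + d) ^+ 2 * (c - d) ^+ 2 / (2 * c * d) - e * r <= N0 / k - e * t0 ->
  k * ((c + d) ^+ 2 * (c - d) ^+ 2 * q) - N0 * (2 * c * d * q)
    <= k * e * ((r - t0) * (2 * c * d * q)).
Proof.
move=> c0 d0 q0 k0 Hmax.
have cd0 : 0 < 2 * c * d by rewrite -mulrA mulr_gt0// mulr_gt0.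
have : (c + d) ^+ 2 * (c - d) ^+ 2 / (2 * c * d) <= N0 / k + e * (r - t0) by lra.
rewrite ler_pdivrMr// => Hw.
have Hk : k * ((c + d) ^+ 2 * (c - d) ^+ 2) <= (N0 + k * e * (r - t0)) * (2 * c * d).
  have -> : (N0 + k * e * (r - t0)) * (2 * c * d)
    = k * ((N0 / k + e * (r - t0)) * (2 * c * d)) by field; rewrite gt_eqF.
  by rewrite ler_pM2l.
have := ler_wpM2r q0 Hk; rewrite -subr_ge0 => Hq; rewrite -subr_ge0.
rewrite (_ : _ - _ = (N0 + k * e * (r - t0)) * (2 * c * d) * q
   - k * ((c + d) ^+ 2 * (c - d) ^+ 2) * q)//; ring.
Qed.

Section MaxPrinciple.
Context {R : realType} (T : R) (M : R -> set 'rV[R]_3)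
  (n : nat) (S : set 'rV[R]_n) (X : R -> 'rV[R]_n -> 'rV[R]_3)
  (nu : R -> 'rV[R]_3 -> 'rV[R]_3) (l1 l2 : R -> 'rV[R]_3 -> R).
Context (hM : forall t, 0 <= t < T -> closed_surface (M t))
  (hconvex : forall t, 0 <= t < T -> strictly_convex (M t))
  (hnu : forall t p, 0 <= t < T -> M t p ->
    outer_unit_normal (M t) p (nu t p))
  (hl : forall t p, 0 <= t < T -> M t p ->
    principal_curvatures (M t) p (nu t p) (l1 t p) (l2 t p))
  (hX : forall t, 0 <= t < T -> diffeo S (M t) (X t))
  (hsmooth : smooth_on (S `*` [set t : R^o | 0 <= t < T])
    (fun z : 'rV[R]_n * R^o => X z.2 z.1))
  (hflow : forall t x, 0 <= t < T -> S x ->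
    let p := X t x in
    let H := l1 t p + l2 t p in
    let A2 := l1 t p ^+ 2 + l2 t p ^+ 2 in
    (s - t)^-1 *: (X s x - X t x)
      @[s --> within [set s | 0 <= s < T] t^'] --> - (H * A2) *: nu t p).

Local Notation b0 := (@basis_vec R 0).
Local Notation b1 := (@basis_vec R 1).
Local Notation e1 := ((b0, 0) : 'rV[R]_2 * R^o).
Local Notation e2 := ((b1, 0) : 'rV[R]_2 * R^o).
Local Notation et := ((0, 1) : 'rV[R]_2 * R^o).

Let w t p := (l1 t p + l2 t p) ^+ 2 * (l1 t p - l2 t p) ^+ 2
               / (2 * l1 t p * l2 t p).
Let W (z : 'rV[R]_n * R^o) := w z.2 (X z.2 z.1).

Lemma X_in t x : 0 <= t < T -> S x -> M t (X t x).
Proof. by move=> tT Sx; case: (hX tT) => <- _ _; exists x. Qed.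

Lemma X_inj t x y : 0 <= t < T -> S x -> S y -> X t x = X t y -> x = y.
Proof.
move=> tT Sx Sy; case: (hX tT) => _ _ [g [_ gK]] E.
by rewrite -(gK x) ?inE// E gK ?inE.
Qed.

Lemma curvatures_gt0 t p : 0 <= t < T -> M t p -> 0 < l1 t p /\ 0 < l2 t p.
Proof. by move=> tT Mp; exact: (hconvex tT Mp (hnu tT Mp) (hl tT Mp)). Qed.

Lemma chart_invariants (A : set ('rV[R]_2 * R^o)) (Z : 'rV[R]_2 * R^o -> 'rV[R]_3)
    (sigma : 'rV[R]_2 -> 'rV[R]_n) :
  open A -> Ck 2 A Z ->
  (forall y (t : R), A (y, t) -> 0 <= t < T -> S (sigma y) /\ Z (y, t) = X t (sigma y)) ->
  forall y (t : R), A (y, t) -> 0 <= t < T ->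
  let p := X t (sigma y) in
  let D := gram_at e1 e2 Z (y, t) in let P := shape_tr_at e1 e2 Z (y, t) in
  let B := shape_det_at e1 e2 Z (y, t) in
  [/\ (l1 t p + l2 t p) ^+ 2 * D ^+ 3 = P ^+ 2, l1 t p * l2 t p * D ^+ 2 = B &
    D ^+ 5 *: (- ((l1 t p + l2 t p) * (l1 t p ^+ 2 + l2 t p ^+ 2)) *: nu t p)
    = (P * (P ^+ 2 - 2 * B * D)) *: cross ('D_e1 Z (y, t)) ('D_e2 Z (y, t))].
Proof.
move=> oA CZ AX y t Ayt tT p.
rewrite gram_slice shape_tr_slice shape_det_slice cross_slice.
have [Sy Zy] := AX y t Ayt tT.
have Mp : M t p := X_in tT Sy.
have [oS CS] := Ck_slice t oA CZ.
have [hp _ _ _] := hM tT.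
have [U [phi [lp im]]] := hp _ Mp.
have [nn tan _] := hnu tT Mp.
have pc := hl tT Mp.
rewrite /p -Zy in im nn tan pc *.
apply: (curvature_invariants (M := M t) (ex_intro _ U (ex_intro _ phi (conj lp im))) oS Ayt CS _ nn tan pc).
move=> z Az; have [Sz Zz] := AX z t Az tT.
by rewrite Zz; exact: X_in.
Qed.

Lemma near_continuous (U V : topologicalType) (f : U -> V) x (P : set V) :
  {for x, continuous f} -> nbhs (f x) P -> nbhs x (fun z => P (f z)).
Proof. by move=> cf; exact: cf. Qed.

Lemma near_sub (U : topologicalType) (x : U) (P Q : set U) :
  (forall z, P z -> Q z) -> nbhs x P -> nbhs x Q.
Proof. by move=> PQ; apply: filterS. Qed.

Lemma near_and4 (U : topologicalType) (x : U) (P1 P2 P3 P4 Q : set U) :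
  (forall z, P1 z -> P2 z -> P3 z -> P4 z -> Q z) ->
  nbhs x P1 -> nbhs x P2 -> nbhs x P3 -> nbhs x P4 -> nbhs x Q.
Proof.
move=> PQ n1 n2 n3 n4; apply: filterS (filterI (filterI n1 n2) (filterI n3 n4)).
by move=> z [[? ?] [? ?]]; exact: PQ.
Qed.

(** A function on a subset that agrees near each of its points with a function
    continuous at that point.  The extensions may differ from point to point. *)
Lemma within_continuous_local (U V : topologicalType) (f : U -> V) (A : set U) :
  (forall x, A x -> exists h : U -> V, {for x, continuous h} /\
     \forall z \near x, A z -> f z = h z) ->
  {within A, continuous f}.
Proof.
move=> loc; apply/subspace_continuousP => x Ax P Pfx.
have [h [ch fh]] := loc x Ax.
have fx : f x = h x := nbhs_singleton fh Ax.
have hP := near_continuous ch (eq_ind _ (fun y => nbhs y P) Pfx _ fx).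
have : \forall z \near x, A z -> P (f z).
  by move: fh hP; apply: filterS2 => z fhz Phz Az; rewrite fhz.
by [].
Qed.

Lemma curvature_wnum_wden (a b P B D : R) :
  (a + b) ^+ 2 * D ^+ 3 = P ^+ 2 -> a * b * D ^+ 2 = B ->
  wnum P B D = (a + b) ^+ 2 * (a - b) ^+ 2 * D ^+ 6 /\
  wden B D = 2 * a * b * D ^+ 6.
Proof.
move=> HP HB; rewrite /wnum /wden -HP -HB; split; ring.
Qed.

(** The curvatures [l1], [l2] are only given point by point; the continuity of
    [W] comes from the formula [wnum / wden] in a space-time chart,
    composed with the chart's coordinates [yy] of a point of [S]. *)
Lemma W_locally_continuous x1 (t1 : R) : S x1 -> 0 <= t1 < T ->
  exists h : 'rV[R]_n * R^o -> R, {for (x1, t1 : R^o), continuous h} /\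
    \forall z \near ((x1, t1) : 'rV[R]_n * R^o), S z.1 -> 0 <= z.2 < T -> W z = h z.
Proof.
move=> Sx1 t1T.
have Mp := X_in t1T Sx1.
have [hp _ _ _] := hM t1T.
have [U [phi [lp [u1 Uu1 phiu1]]]] := hp _ Mp.
have oU : open U by case: lp.
have [A [Z [sigma [oA Au1 CZ AZ]]]] := flow_chart (hX t1T) hsmooth t1T oU
  (local_param_smooth lp) (fun u => local_param_in lp) Uu1.
have [N [g [oN Nu sg gN gK]]] := local_param_inverse lp Uu1.
have [N1 [F [oN1 N1x FN eF]]] := hsmooth (x := (x1, t1)) (conj Sx1 t1T).
have AX y (t : R) : A (y, t) -> 0 <= t < T -> S (sigma y) /\ Z (y, t) = X t (sigma y).
  by move=> Ayt tT; have [_ Sy _ Zy] := AZ y t Ayt; split=> //; exact: Zy.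
have inv := chart_invariants oA (CZ 2%N) AX.
have [CD CP CB] := Ck_at e1 e2 oA (CZ 2%N).
pose num z := wnum (shape_tr_at e1 e2 Z z) (shape_det_at e1 e2 Z z) (gram_at e1 e2 Z z).
pose den z := wden (shape_det_at e1 e2 Z z) (gram_at e1 e2 Z z).
have Cnum : Ck 0 A num := Ck_wnum oA CP CB CD.
have Cden : Ck 0 A den := Ck_wden oA CB CD.
have x1E : F (x1, t1) = phi u1.
  by rewrite phiu1; apply: eF; rewrite inE.
pose yy (z : 'rV[R]_n * R^o) : 'rV[R]_2 * R^o := (g (F (z.1, t1)), z.2).
have yy1 : yy (x1, t1) = (u1, t1).
  by rewrite /yy /= x1E gK.
pose sl (z : 'rV[R]_n * R^o) : 'rV[R]_n * R^o := (z.1, t1).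
have dsl : differentiable sl (x1, t1 : R^o).
  apply: differentiable_pair.
    by apply: (@linear_differentiable _ _ _ fst) => ?; exact: cvg_fst.
  exact: differentiable_cst.
have dFsl : differentiable (F \o sl) (x1, t1 : R^o).
  by apply: differentiable_comp; [exact: dsl|exact: (FN [::])].
have dg : differentiable (g \o (F \o sl)) (x1, t1 : R^o).
  apply: differentiable_comp; first exact: dFsl.
  have -> : (F \o sl) (x1, t1 : R^o) = phi u1 by exact: x1E.
  exact: (sg [::]).
have cyy : {for (x1, t1 : R^o), continuous yy}.
  apply: differentiable_continuous; apply: differentiable_pair; first exact: dg.
  by apply: (@linear_differentiable _ _ _ snd) => ?; exact: cvg_snd.
have dnum : {for (u1, t1 : R^o), continuous num}.
  exact: (differentiable_continuous (Ck_differentiable Cnum Au1)).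
have dden : {for (u1, t1 : R^o), continuous den}.
  exact: (differentiable_continuous (Ck_differentiable Cden Au1)).
have cFsl := differentiable_continuous dFsl.
have D0 : 0 < gram_at e1 e2 Z (u1, t1).
  rewrite gram_slice; have <- : gram_at b0 b1 phi u1 = gram_at b0 b1 (fun y => Z (y, t1)) u1.
    have [oS _] := Ck_slice t1 oA (CZ 2%N).
    have E : {in [set y | A (y, t1)], phi =1 (fun y => Z (y, t1))}.
      move=> y /set_mem Ay; have [_ Sy <- ->] := AZ y t1 Ay; first by [].
      exact: t1T.
    have inu : u1 \in [set y | A (y, t1)] by rewrite inE.
    exact: (congr2 gram (eq_on_derive b0 oS E inu) (eq_on_derive b1 oS E inu)).
  exact: (param_gram_gt0 lp Uu1).
have den0 : den (u1, t1) != 0.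
  have [_ HB _] := inv _ _ Au1 t1T.
  have [_ Sy _] := AZ _ _ Au1; move=> /(_ t1T) Zy.
  have [a0 b0'] := curvatures_gt0 t1T (X_in t1T Sy).
  by rewrite /den /wden -HB !mulf_neq0 ?expf_neq0 ?pnatr_eq0 ?gt_eqF.
exists (fun z => num (yy z) / den (yy z)); split.
  have cn : {for (x1, t1 : R^o), continuous (num \o yy)}.
    by apply: continuous_comp; [exact: cyy|rewrite yy1].
  have cd : {for (x1, t1 : R^o), continuous (den \o yy)}.
    by apply: continuous_comp; [exact: cyy|rewrite yy1].
  apply: cvgM; first exact: cn.
  by apply: cvgV; [rewrite /= yy1|exact: cd].
have nA : \forall z \near ((x1, t1) : 'rV[R]_n * R^o), A (yy z).
  by apply: cyy; rewrite yy1; exact: open_nbhs_nbhs.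
have nd : nbhs (yy (x1, t1)) [set y | den y != 0].
  rewrite yy1; apply: (near_continuous (P := [set r : R | r != 0]) dden).
  by apply: open_nbhs_nbhs; split; [exact: open_neq|exact: den0].
have nden := near_continuous cyy nd.
have nN' : nbhs ((F \o sl) (x1, t1 : R^o)) N.
  by apply: open_nbhs_nbhs; split=> //; rewrite /= x1E.
have nN := near_continuous cFsl nN'.
have nN1' : nbhs (sl (x1, t1 : R^o)) N1 by exact: open_nbhs_nbhs.
have nN1 := near_continuous (differentiable_continuous dsl) nN1'.
apply: (@near_and4 ('rV[R]_n * R^o)%type (x1, t1) _ _ _ _ _ _ nA nden nN nN1).
move=> -[x t] /= Axt dxt Nx N1x' Sx tT.
have Fx : F (x, t1) = X t1 x by apply: eF; rewrite inE.
have [_ Sy Xy Zy] := AZ _ _ Axt.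
have [Uy phiy] := gN _ (X_in t1T Sx) (eq_ind _ N Nx _ Fx).
have Ex : sigma (yy (x, t)).1 = x.
  by apply: (X_inj t1T Sy Sx); apply: (etrans Xy); rewrite /yy /= Fx.
have [] := inv _ _ Axt tT; rewrite Ex => HP HB _.
have [En Ed] := curvature_wnum_wden HP HB.
rewrite /W /w /= /num En /den Ed.
have [a0 b0'] := curvatures_gt0 tT (X_in tT Sx).
have D6 : gram_at e1 e2 Z (yy (x, t)) ^+ 6 != 0.
  move: dxt; rewrite /den Ed mulf_eq0 negb_or => /andP[_]; exact.
by rewrite -[RHS]mulf_div divff// mulr1.
Qed.

(** [S] is the image of the compact surface at time [0] under the continuous
    inverse of the embedding. *)
Lemma S_compact : 0 < T -> compact S.
Proof.
move=> T0; have T00 : 0 <= (0 : R) < T by rewrite lexx.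
have [_ _ cM _] := hM T00.
have [im _ [g [sg gK]]] := hX T00.
have -> : S = g @` M 0.
  apply/seteqP; split => [x Sx|_ [p Mp <-]].
    by exists (X 0 x); [exact: X_in|rewrite gK// inE].
  have : (X 0 @` S) p by rewrite im.
  by move=> [x Sx <-]; rewrite gK// inE.
apply: continuous_compact => //.
apply: within_continuous_local => p Mp.
have [N [F [oN Np FN eF]]] := sg p Mp.
exists F; split; first exact: (smooth_open_continuous FN Np).
have nN : nbhs p N by exact: open_nbhs_nbhs.
by apply: filterS nN => q Nq Mq; rewrite eF// inE.
Qed.

Lemma W_attains_max (f : R -> R) (s t : R) : 0 <= s -> s <= t -> t < T -> continuous f ->
  exists x0 t0, [/\ S x0, s <= t0 <= t &
    forall x r, S x -> s <= r <= t -> W (x, r) - f r <= W (x0, t0) - f t0].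
Proof.
move=> s0 st tT cf.
have T0 : 0 < T by rewrite (le_lt_trans s0)// (le_lt_trans st).
pose K : set ('rV[R]_n * R^o) := S `*` [set r : R^o | s <= r <= t].
have cI : compact [set r : R^o | s <= r <= t].
  have -> : [set r : R^o | s <= r <= t] = [set` `[s, t]].
    by apply/seteqP; split => r /=; rewrite in_itv.
  exact: segment_compact.
have cK : compact K by apply: compact_setX => //; exact: S_compact.
have K0 : K !=set0.
  have sT : 0 <= s < T by rewrite s0 (le_lt_trans st).
  have [_ [p Mp] _ _] := hM sT.
  have [im _ _] := hX sT; have : (X s @` S) p by rewrite im.
  by move=> [x Sx _]; exists (x, s); split=> //=; rewrite lexx.
have [|[x0 t0] /set_mem[Sx0 t0I] max] := @compact_EVT_max _ R
   (fun z : 'rV[R]_n * R^o => W z - f z.2) K K0 cK; last first.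
  exists x0, t0; split => // x r Sx rI.
  by apply: (max (x, r)); rewrite inE.
apply: within_continuous_local => -[x1 t1] [/= Sx1 /andP[st1 t1t]].
have t1T : 0 <= t1 < T by rewrite (le_trans s0)// (le_lt_trans t1t).
have [h [ch Wh]] := W_locally_continuous Sx1 t1T.
exists (fun z => h z - f z.2); split.
  apply: cvgB; first exact: ch.
  have csnd : continuous (snd : 'rV[R]_n * R^o -> R^o) by move=> ?; exact: cvg_snd.
  exact: (continuous_comp (csnd (x1, t1)) (cf t1)).
apply: (near_sub _ Wh) => -[x r] Wxr [/= Sx /andP[sr rt]].
by rewrite Wxr//= (le_trans s0)// (le_lt_trans rt).
Qed.

(** The contradiction described at the top.  The chart, the frame and the jets at
    [(0, t0)] are assembled, [flow_defect_le0] gives a nonpositive time derivative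
    of the defect [G], and the maximality of [w - e r] at earlier times gives a
    positive one. *)
Lemma no_late_max (s t0 e : R) x0 : 0 <= s -> s < t0 -> t0 < T -> S x0 -> 0 < e ->
  (forall x (r : R), S x -> s <= r <= t0 -> W (x, r) - e * r <= W (x0, t0) - e * t0) ->
  False.
Proof.
move=> s0 st0 t0T Sx0 e0 maxW.
have t0pos : 0 < t0 by rewrite (le_lt_trans s0).
have t0I : 0 <= t0 < T by rewrite ltW.
have Mp := X_in t0I Sx0.
have [hp _ _ _] := hM t0I.
have [U [phi [lp [u0 Uu0 phiu0]]]] := hp _ Mp.
have [nn tan _] := hnu t0I Mp.
have pc := hl t0I Mp.
rewrite -phiu0 in nn tan pc.
have [zeta [Y [a [b [[oY Y0 szeta zetaM zeta0] H]]]]] := principal_chart lp Uu0 nn tan pc.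
(* the frame is kept opaque so that it does not unfold into derivatives *)
have [E1 eE1] : {v | v = 'D_b0 zeta 0} := exist _ _ erefl.
have [E2 eE2] : {v | v = 'D_b1 zeta 0} := exist _ _ erefl.
have [[E11 E22 E12] [Er Es Et]] : [/\ dot E1 E1 = 1, dot E2 E2 = 1 & dot E1 E2 = 0] /\
  [/\ 'D_b0 ('D_b0 zeta) 0 = a *: cross E1 E2, 'D_b0 ('D_b1 zeta) 0 = 0 &
   'D_b1 ('D_b1 zeta) 0 = b *: cross E1 E2].
  by move: (E1) eE1 (E2) eE2 => _ -> _ ->; exact: H.
have [A [Z [sigma [oA A0 CZ AZ]]]] := flow_chart (hX t0I) hsmooth t0I oY szeta zetaM Y0.
have sigma0 : sigma 0 = x0.
  have [_ Sy Xy _] := AZ _ _ A0; apply: (X_inj t0I Sy Sx0).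
  by apply: (etrans Xy); apply: (etrans zeta0).
(* restricting to interior times makes the flow equation hold on an open set *)
pose A' := A `&` [set z : 'rV[R]_2 * R^o | 0 < z.2 < T].
have csnd : continuous (snd : 'rV[R]_2 * R^o -> R^o) by move=> ?; exact: cvg_snd.
have oA' : open A'.
  apply: openI => //; apply: (@open_comp _ _ snd [set r : R^o | 0 < r < T]).
    by move=> z _; exact: csnd.
  have -> : [set r : R^o | 0 < r < T] = [set r : R | 0 < r] `&` [set r : R | r < T].
    by apply/seteqP; split => r /=; [move=> /andP[]|move=> [-> ->]].
  by apply: openI; [exact: open_gt|exact: open_lt].
have A'0 : A' (0, t0) by split=> //=; rewrite t0pos.
have CZ' k : Ck k A' Z by apply: Ck_sub (CZ k) => z [].
have AX y (t : R) : A' (y, t) -> 0 <= t < T -> S (sigma y) /\ Z (y, t) = X t (sigma y).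
  by move=> [Ayt _] tT; have [_ Sy _ Zy] := AZ y t Ayt; split=> //; exact: Zy.
have inv := chart_invariants oA' (CZ' 2%N) AX.
(* at time [t0] the derivatives of [Z] in space are those of [zeta] *)
have [oS _] := Ck_slice t0 oA' (CZ' 2%N).
have slice : {in [set y | A' (y, t0)], (fun y => Z (y, t0)) =1 zeta}.
  by move=> y /set_mem [Ay _]; have [_ Sy <- ->] := AZ y t0 Ay.
have in0 : (0 : 'rV[R]_2) \in [set y | A' (y, t0)] by rewrite inE.
have S1 v := etrans (derive_slice Z v 0 t0) (eq_on_derive v oS slice in0).
have S2 v u := etrans (derive2_slice Z v u 0 t0)
  (eq_on_derive u oS (eq_on_derive v oS slice) in0).
(* after the rotation the first and second derivatives are in normal form *)
pose F := frame E1 E2.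
have x0A' : ((0, t0) : 'rV[R]_2 * R^o) \in A' by rewrite inE.
have D1 (v : 'rV[R]_2 * R^o) := derive_frame_on E1 E2 (CZ' 2%N) v.
have D2 (v u : 'rV[R]_2 * R^o) := derive2_frame_on E1 E2 oA' (CZ' 2%N) v u.
have n1 : dot (cross E1 E2) (cross E1 E2) = 1.
  by rewrite -/(gram E1 E2) gramE E11 E22 E12; ring.
have n2 : dot (cross E1 E2) E1 = 0 by rewrite dotE !row3E; ring.
have n3 : dot (cross E1 E2) E2 = 0 by rewrite dotE !row3E; ring.
have FE1 : F E1 = row3 1 0 0 by rewrite /F /frame E11 E12 dotC n2.
have FE2 : F E2 = row3 0 1 0 by rewrite /F /frame E22 dotC E12 dotC n3.
have Fn c : F (c *: cross E1 E2) = row3 0 0 c.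
  by rewrite /F /frame !dotZl n1 n2 n3 !mulr0 mulr1.
have F0 : F 0 = row3 0 0 0 by rewrite /F /frame !dot0l.
have Zp : 'D_e1 (F \o Z) (0, t0) = row3 1 0 0.
  exact: (etrans (D1 e1 _ x0A') (etrans (congr1 F (etrans (S1 b0) (esym eE1))) FE1)).
have Zq : 'D_e2 (F \o Z) (0, t0) = row3 0 1 0.
  exact: (etrans (D1 e2 _ x0A') (etrans (congr1 F (etrans (S1 b1) (esym eE2))) FE2)).
have Zr : 'D_e1 ('D_e1 (F \o Z)) (0, t0) = row3 0 0 a.
  exact: (etrans (D2 e1 e1 _ x0A') (etrans (congr1 F (etrans (S2 b0 b0) Er)) (Fn a))).
have Zs : 'D_e1 ('D_e2 (F \o Z)) (0, t0) = row3 0 0 0.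
  exact: (etrans (D2 e2 e1 _ x0A') (etrans (congr1 F (etrans (S2 b1 b0) Es)) F0)).
have Zt : 'D_e2 ('D_e2 (F \o Z)) (0, t0) = row3 0 0 b.
  exact: (etrans (D2 e2 e2 _ x0A') (etrans (congr1 F (etrans (S2 b1 b1) Et)) (Fn b))).
have GF := gram_at_frame E11 E22 E12 (CZ' 2%N) e1 e2.
have PF := shape_tr_at_frame E11 E22 E12 oA' (CZ' 2%N) e1 e2.
have BF := shape_det_at_frame E11 E22 E12 oA' (CZ' 2%N) e1 e2.
have D_1 : gram_at e1 e2 Z (0, t0) = 1.
  apply: (etrans (esym (GF _ x0A'))); apply: (etrans (congr2 gram Zp Zq)).
  by rewrite gramE !dotE !row3E; ring.
have P_ab : shape_tr_at e1 e2 Z (0, t0) = a + b.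
  apply: (etrans (esym (PF _ x0A'))); apply: (etrans (congr5 shape_tr Zp Zq Zr Zs Zt)).
  by rewrite /shape_tr /second_coef !dotE !row3E; ring.
have B_ab : shape_det_at e1 e2 Z (0, t0) = a * b.
  apply: (etrans (esym (BF _ x0A'))); apply: (etrans (congr5 shape_det Zp Zq Zr Zs Zt)).
  by rewrite /shape_det /second_coef !dotE !row3E; ring.
have [] := inv _ _ A'0 t0I; rewrite D_1 P_ab B_ab sigma0 !expr1n !mulr1 => Hab Kab _.
have [L10 L20] := curvatures_gt0 t0I Mp.
have ab0 : 0 < a * b by rewrite -Kab mulr_gt0.
have FE u : F u = frame E1 E2 u by [].
have C4 : Ck 4 A' (F \o Z).
  exact: (Ck_linear oA' (@frame_continuous _ E1 E2) (CZ' 4)).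
have flowF z : A' z -> gram_at e1 e2 (F \o Z) z ^+ 5 *: 'D_et (F \o Z) z
     = (shape_tr_at e1 e2 (F \o Z) z * (shape_tr_at e1 e2 (F \o Z) z ^+ 2
         - 2 * shape_det_at e1 e2 (F \o Z) z * gram_at e1 e2 (F \o Z) z))
       *: cross ('D_e1 (F \o Z) z) ('D_e2 (F \o Z) z).
  case: z => y r Ayr; have zA : ((y, r) : 'rV[R]_2 * R^o) \in A' by rewrite inE.
  have rT : 0 < r < T by case: Ayr.
  have rI : 0 <= r < T by move: rT => /andP[r0 ->]; rewrite ltW.
  have [_ _ Hf] := inv y r Ayr rI.
  have [Sy _] := AX y r Ayr rI.
  have Zt_eq : 'D_et Z (y, r) = - ((l1 r (X r (sigma y)) + l2 r (X r (sigma y)))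
     * (l1 r (X r (sigma y)) ^+ 2 + l2 r (X r (sigma y)) ^+ 2)) *: nu r (X r (sigma y)).
    apply: (derive_time (x := fun q => X q (sigma y)) oA' Ayr rT).
      by move=> q Ayq qI; have [] := AX y q Ayq qI.
    exact: (hflow rI Sy).
  rewrite -Zt_eq in Hf.
  have Ec : cross ('D_e1 (F \o Z) (y, r)) ('D_e2 (F \o Z) (y, r))
      = F (cross ('D_e1 Z (y, r)) ('D_e2 Z (y, r))).
    exact: (etrans (congr2 cross (D1 e1 _ zA) (D1 e2 _ zA)) (cross_frame E11 E22 E12 _ _)).
  have Ez : 'D_et (F \o Z) (y, r) = F ('D_et Z (y, r)) := D1 et _ zA.
  have scaleF c u : c *: F u = F (c *: u) by rewrite /F [RHS]linearZ.
  have G5 : gram_at e1 e2 (F \o Z) (y, r) ^+ 5 = gram_at e1 e2 Z (y, r) ^+ 5.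
    exact: (congr1 (fun q => q ^+ 5) (GF _ zA)).
  have PP : shape_tr_at e1 e2 (F \o Z) (y, r) * (shape_tr_at e1 e2 (F \o Z) (y, r) ^+ 2
      - 2 * shape_det_at e1 e2 (F \o Z) (y, r) * gram_at e1 e2 (F \o Z) (y, r))
    = shape_tr_at e1 e2 Z (y, r) * (shape_tr_at e1 e2 Z (y, r) ^+ 2
      - 2 * shape_det_at e1 e2 Z (y, r) * gram_at e1 e2 Z (y, r)).
    by rewrite (GF _ zA) (PF _ zA) (BF _ zA).
  apply: (etrans (congr2 *:%R G5 Ez)); apply: (etrans (scaleF _ _)).
  apply: (etrans (congr1 F Hf)); apply: (etrans (esym (scaleF _ _))).
  exact: (congr2 *:%R (esym PP) (esym Ec)).
pose k := 2 * a * b; pose N0 := (a ^+ 2 - b ^+ 2) ^+ 2.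
have k0 : 0 < k by rewrite /k -mulrA mulr_gt0.
pose G := defect_at e1 e2 (F \o Z) k N0.
pose den z := wden (shape_det_at e1 e2 (F \o Z) z) (gram_at e1 e2 (F \o Z) z).
have W0 : W (x0, t0) = N0 / k.
  have Ek : 2 * l1 t0 (X t0 x0) * l2 t0 (X t0 x0) = k by rewrite /k -!mulrA Kab.
  rewrite /W /w /= Ek; congr (_ / _).
  transitivity ((a + b) ^+ 2 * ((a + b) ^+ 2 - 4 * (a * b))).
    by rewrite -Hab -Kab; ring.
  by rewrite /N0; ring.
(* maximality over the earlier times, without denominators *)
have key y (r : R) : A' (y, r) -> s <= r <= t0 -> G (y, r) <= k * e * ((r - t0) * den (y, r)).
  move=> Ayr rst; have zA : ((y, r) : 'rV[R]_2 * R^o) \in A' by rewrite inE.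
  have rI : 0 <= r < T by case: Ayr => _ /= /andP[r0 ->]; rewrite ltW.
  have [HP HB _] := inv y r Ayr rI; have [Sy _] := AX y r Ayr rI.
  have [L1 L2] := curvatures_gt0 rI (X_in rI Sy).
  have := maxW (sigma y) r Sy rst; rewrite W0 /W /w /=.
  have [En Ed] := curvature_wnum_wden HP HB.
  have -> : G (y, r) = k * wnum (shape_tr_at e1 e2 Z (y, r)) (shape_det_at e1 e2 Z (y, r))
      (gram_at e1 e2 Z (y, r)) - N0 * wden (shape_det_at e1 e2 Z (y, r)) (gram_at e1 e2 Z (y, r)).
    by rewrite -(GF _ zA) -(PF _ zA) -(BF _ zA).
  have -> : den (y, r) = wden (shape_det_at e1 e2 Z (y, r)) (gram_at e1 e2 Z (y, r)).
    by rewrite -(GF _ zA) -(BF _ zA).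
  rewrite En Ed.
  have D6 : 0 <= gram_at e1 e2 Z (y, r) ^+ 6.
    by rewrite exprn_even_ge0.
  exact: defect_of_quotient.
have Gx : G (0, t0) = 0.
  apply: (etrans (_ : _ = k * wnum (a + b) (a * b) 1 - N0 * wden (a * b) 1)).
    by rewrite -D_1 -P_ab -B_ab -(GF _ x0A') -(PF _ x0A') -(BF _ x0A').
  by rewrite /wnum /wden /k /N0; ring.
have denx : den (0, t0) = k.
  by rewrite /den (GF _ x0A') (BF _ x0A') D_1 B_ab /wden /k; ring.
have CG : Ck 1 A' G := Ck_defect e1 e2 k N0 oA' (Ck_le (isT : (3 <= 4)%N) C4).
have line_in v : \forall h \near (0 : R), A' (h *: v + ((0, t0) : 'rV[R]_2 * R^o)).
  by apply: line_cvg; exact: open_nbhs_nbhs.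
have t0st : s <= t0 <= t0 by rewrite ltW//=.
have maxS (v : 'rV[R]_2) : \forall h \near (0 : R),
    G (h *: ((v, 0) : 'rV[R]_2 * R^o) + (0, t0)) <= G (0, t0).
  apply: filterS (line_in ((v, 0) : 'rV[R]_2 * R^o)) => h Ah.
  have E : h *: ((v, 0) : 'rV[R]_2 * R^o) + (0, t0) = (h *: v, t0).
    by congr pair; rewrite /= ?addr0 // scaler0 add0r.
  by rewrite E in Ah *; rewrite Gx (le_trans (key _ _ Ah t0st))// subrr mul0r mulr0.
have Gt := flow_defect_le0 oA' A'0 C4 ab0 Zp Zq Zr Zs Zt flowF CG (maxS b0) (maxS b1).
have Cden : Ck 0 A' den.
  have [CD _ CB] := Ck_at e1 e2 oA' (Ck_le (isT : (2 <= 4)%N) C4).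
  exact: (Ck_wden oA' CB CD).
have cden := differentiable_continuous (Ck_differentiable Cden A'0).
have dG := Ck_differentiable CG A'0.
have denx0 : 0 < den (0, t0) by rewrite denx.
have Gle : \forall h \near (0 : R), h < 0 ->
    G (h *: et + (0, t0)) <= k * e * (h * den (h *: et + (0, t0))).
  have late : \forall h \near (0 : R), s < h + t0.
    apply/nbhs_ballP; exists (t0 - s); first by rewrite /= subr_gt0.
    move=> h; rewrite /ball/= sub0r normrN ltr_norml => /andP[h1 _].
    by move: h1; rewrite opprB ltrBlDr.
  move: (line_in et) late; apply: filterS2 => h Ah sh h0.
  have E : h *: et + (0, t0) = (0, h + t0).
    by congr pair; rewrite /= ?scaler0 ?add0r// /GRing.scale/= mulr1.
  rewrite E in Ah *.
  have rI : s <= h + t0 <= t0 by rewrite ltW//= gerDr ltW.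
  by have := key _ _ Ah rI; rewrite addrK.
have := derive_gt0_left dG cden (mulr_gt0 k0 e0) denx0 Gx Gle.
by rewrite ltNge => /negP; apply.
Qed.

Lemma max_exists t : 0 <= t < T -> exists m, is_max (w t @` M t) m.
Proof.
move=> tT; have [im _ _] := hX tT; have /andP[t0 tT'] := tT.
have [x [r [Sx rI max]]] := W_attains_max t0 (lexx t) tT' (@cst_continuous R R (0 : R)).
have Er : r = t by apply/eqP; rewrite eq_le andbC.
exists (w t (X t x)); split; first by exists (X t x) => //; exact: X_in.
move=> _ [p Mp <-]; have : (X t @` S) p by rewrite im.
move=> [y Sy <-]; have := max y t Sy; rewrite lexx => /(_ isT).
by rewrite !subr0 /W /= Er.
Qed.

(** If the maximum grew from [s] to [t], subtracting [e r] with half of the average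
    slope as [e] would still leave the value at time [t] above all values at time
    [s], so the maximum over the whole time interval would be attained late. *)
Lemma max_nonincreasing s t ms mt : 0 <= s -> s <= t -> t < T ->
  is_max (w s @` M s) ms -> is_max (w t @` M t) mt -> mt <= ms.
Proof.
move=> s0 st tT [_ ubs] [[p Mp wp] ubt].
have sT : 0 <= s < T by rewrite s0 (le_lt_trans st).
have tT' : 0 <= t < T by rewrite tT (le_trans s0).
have WS r x m : 0 <= r < T -> S x -> ubound (w r @` M r) m -> W (x, r) <= m.
  by move=> rT Sx ub; apply: ub; exists (X r x) => //; exact: X_in.
rewrite leNgt; apply/negP => lt_m.
move: st; rewrite le_eqVlt => /orP[/eqP E|st].
  have : mt <= ms by apply: ubs; rewrite E; exists p.
  by rewrite leNgt lt_m.
pose e := (mt - ms) / (2 * (t - s)).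
have e0 : 0 < e by rewrite divr_gt0 ?subr_gt0// mulr_gt0// subr_gt0.
have et_lt : e * (t - s) < mt - ms.
  have -> : e * (t - s) = (mt - ms) / 2.
    by rewrite /e; field; rewrite subr_eq0 gt_eqF.
  by rewrite ltr_pdivrMr// ltr_pMr ?ltr1n// subr_gt0.
have ce : continuous (fun r : R => e * r).
  by move=> r; apply: cvgM; [exact: cvg_cst|exact: cvg_id].
have [x0 [t0 [Sx0 /andP[st0 t0t] max]]] := W_attains_max s0 (ltW st) tT ce.
have [im _ _] := hX tT'; have : (X t @` S) p by rewrite im.
move=> [y Sy yp].
have Wy : W (y, t) = mt by rewrite /W /= yp.
move: st0; rewrite le_eqVlt => /orP[/eqP E|st0].
  have := max y t Sy; rewrite (ltW st) lexx => /(_ isT); rewrite Wy -E => Hm.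
  by have := WS s x0 ms sT Sx0 ubs; move: Hm et_lt; lra.
apply: (no_late_max s0 st0 (le_lt_trans t0t tT) Sx0 e0) => x r Sx /andP[sr rt0].
by apply: max => //; rewrite sr (le_trans rt0).
Qed.

End MaxPrinciple.

Theorem theorem11p2 (R : realType) (T : R) (M : R -> set 'rV[R]_3)
  (n : nat) (S : set 'rV[R]_n) (X : R -> 'rV[R]_n -> 'rV[R]_3)
  (nu : R -> 'rV[R]_3 -> 'rV[R]_3) (l1 l2 : R -> 'rV[R]_3 -> R)
  (hM : forall t, 0 <= t < T -> closed_surface (M t))
  (hconvex : forall t, 0 <= t < T -> strictly_convex (M t))
  (hnu : forall t p, 0 <= t < T -> M t p ->
    outer_unit_normal (M t) p (nu t p))
  (hl : forall t p, 0 <= t < T -> M t p ->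
    principal_curvatures (M t) p (nu t p) (l1 t p) (l2 t p))
  (hX : forall t, 0 <= t < T -> diffeo S (M t) (X t))
  (hsmooth : smooth_on (S `*` [set t : R^o | 0 <= t < T])
    (fun z : 'rV[R]_n * R^o => X z.2 z.1))
  (hflow : forall t x, 0 <= t < T -> S x ->
    let p := X t x in
    let H := l1 t p + l2 t p in
    let A2 := l1 t p ^+ 2 + l2 t p ^+ 2 in
    (s - t)^-1 *: (X s x - X t x)
      @[s --> within [set s | 0 <= s < T] t^'] --> - (H * A2) *: nu t p) :
  let w t p := (l1 t p + l2 t p) ^+ 2 * (l1 t p - l2 t p) ^+ 2
               / (2 * l1 t p * l2 t p) in
  exists m : R -> R,
    (forall t, 0 <= t < T -> is_max (w t @` M t) (m t)) /\
    (forall s t, 0 <= s -> s <= t -> t < T -> m t <= m s).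
Proof.
move=> w.
have mP t : exists m, 0 <= t < T -> is_max (w t @` M t) m.
  have [tT|tT] := boolP (0 <= t < T); last by exists 0.
  by have [m mmax] := max_exists hM hconvex hnu hl hX hsmooth tT; exists m.
have [m mmax] := choice mP; exists m; split=> // s t s0 st tT.
apply: (max_nonincreasing hM hconvex hnu hl hX hsmooth hflow s0 st tT).
  by apply: mmax; rewrite s0 (le_lt_trans st).
by apply: mmax; rewrite tT (le_trans s0).
Qed.
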